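(* Let $\mathbb{S}=\mathbb{R}_+=[0,\infty)$ or $\mathbb{S}=\mathbb{N}_0$. Let $E^\odot=(E_t)_{t\in\mathbb{S}}$ be a product system of correspondences over a unital $C^*$-algebra $\mathcal{B}$ and let $\xi^\odot=(\xi_t)_{t\in\mathbb{S}}$ be a contractive unit for $E^\odot$ (that is, $\langle\xi_t,\xi_t\rangle\le\mathbf{1}$ for all $t$). Then there exists a unique strict weak dilation $(E,\vartheta,\xi)$ of the CP-semigroup $T=(T_t)_{t\in\mathbb{S}}$ on $\mathcal{B}$, $T_t(b):=\langle\xi_t,b\xi_t\rangle$, fulfilling: (1) The product system associated with the strict $E$-semigroup $\vartheta=(\vartheta_t)_{t\in\mathbb{S}}$ on $\mathscr{B}^a(E)$ is $E^\odot$. (2) $E$ is generated by $E^\odot$ in the sense that $\bigcup_{t\in\mathbb{S}}\vartheta_t(\xi\xi^* )E$ is total in $E$.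
   Context: A correspondence over $\mathcal{B}$ is a Hilbert $\mathcal{B}$-module with a nondegenerate left action of $\mathcal{B}$ by adjointable operators; $\odot$ is the internal tensor product over $\mathcal{B}$. A product system over $\mathcal{B}$ is a family $E^\odot=(E_t)_{t\in\mathbb{S}}$ of correspondences over $\mathcal{B}$ with $E_0=\mathcal{B}$ and bilinear (i.e. $\mathcal{B}$--$\mathcal{B}$-linear) unitaries $u_{s,t}\colon E_s\odot E_t\to E_{s+t}$ that compose associatively and such that $u_{0,t}$ and $u_{t,0}$ are the canonical identifications; one writes $x_s\odot y_t\in E_{s+t}$ for $u_{s,t}(x_s\odot y_t)$. No continuity or measurability in $t$ is required. A unit for $E^\odot$ is a family $\xi^\odot=(\xi_t)_{t\in\mathbb{S}}$ with $\xi_t\in E_t$, $\xi_0=\mathbf{1}$ and $\xi_s\odot\xi_t=\xi_{s+t}$ for all $s,t$. For a Hilbert $\mathcal{B}$-module $E$, $\mathscr{B}^a(E)$ is the $C^*$-algebra of adjointable operators on $E$; for $x,y\in E$, $b\in\mathcal{B}$, $xy^*$ denotes the operator $z\mapsto x\langle y,z\rangle$ and $xby^*$ the operator $z\mapsto xb\langle y,z\rangle$. An $E$-semigroup on $\mathscr{B}^a(E)$ is a semigroup $\vartheta=(\vartheta_t)_{t\in\mathbb{S}}$ (with $\vartheta_0=\mathrm{id}$) of not necessarily unital $*$-endomorphisms. It is strict if every $\vartheta_t$ is strict on bounded subsets (equivalently, $\vartheta_t(\mathscr{K}(E))$ acts nondegenerately on $\vartheta_t(\mathbf{1})E$, where $\mathscr{K}(E)$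 denotes the compact operators). A unit vector in $E$ is an element $\xi\in E$ with $\langle\xi,\xi\rangle=\mathbf{1}$. A (strict) weak dilation of a semigroup $T$ of contractive CP-maps $T_t$ on $\mathcal{B}$ is a triple $(E,\vartheta,\xi)$ of a Hilbert $\mathcal{B}$-module $E$, a strict $E$-semigroup $\vartheta$ on $\mathscr{B}^a(E)$ and a unit vector $\xi\in E$ such that $T_t(b)=\langle\xi,\vartheta_t(\xi b\xi^* )\xi\rangle$ for all $t\in\mathbb{S}$, $b\in\mathcal{B}$. Product system associated with a strict $E$-semigroup $\vartheta$ on $\mathscr{B}^a(E)$, where $E$ has a unit vector $\xi$: its members are the submodules $\vartheta_t(\xi\xi^* )E\subset E$ with left action $bx_t:=\vartheta_t(\xi b\xi^* )x_t$ (for $t=0$, $\xi\mathcal{B}$ is identified with $\mathcal{B}$ via $\xi b\mapsto b$), and the product is given by the bilinear unitaries $x_s\odot y_t\mapsto\vartheta_t(x_s\xi^* )y_t$. The associated product system is determined up to isomorphism, so that it ''is $E^\odot$'' means that it is isomorphic to $E^\odot$, i.e. for each $t$ there is a bilinear unitary between the members, these unitaries respecting the products and being the canonical identification at $t=0$. Uniqueness is understood up to unitary equivalence: two weak dilations $(E,\vartheta,\xi)$ and $(\tilde E,\tilde\vartheta,\tilde\xi)$ are unitarily equivalent if there is a unitary $v\colon E\to\tilde E$ of Hilbert $\mathcal{B}$-modules with $v\xi=\tilde\xi$ and $v\vartheta_t(a)v^*=\tilde\vartheta_t(vav^* )$ for all $t\in\mathbb{S}$ and all $a\in\mathscr{B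}^a(E)$.
   Formalization: In (1), the isomorphism from E⊙ to the associated product system is also required to send the unit ξ_t to θ_t(ξξ* )ξ; with a bare isomorphism uniqueness fails (e.g. B=E_n=ℂ over ℕ₀, ξ_n=4^-n). *)

(* Defs.v *)
From HB Require Import structures.
From mathcomp Require Import all_boot all_order all_algebra.
From mathcomp Require Import all_classical all_reals all_analysis.
From mathcomp Require Import complex.
Set Implicit Arguments.
Unset Strict Implicit.
Unset Printing Implicit Defensive.
Import Order.TTheory GRing.Theory Num.Theory.
Import numFieldNormedType.Exports.
Local Open Scope classical_set_scope.
Local Open Scope ring_scope.

(* The multiplication is a field of the record instead of coming from          *)
(* [algType], because [algType] would exclude the zero algebra. Norms take     *)
(* values in R[i], as everywhere in [normedModType R[i]].                      *)
Record cstarAlg (R : realType) := CStarAlg {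
  cs_space : completeNormedModType R[i];
  cs_one : cs_space;
  cs_mul : cs_space -> cs_space -> cs_space;
  cs_star : cs_space -> cs_space;
  cs_mulA : associative cs_mul;
  cs_mul1l : left_id cs_one cs_mul;
  cs_mul1r : right_id cs_one cs_mul;
  cs_mulDl : left_distributive cs_mul +%R;
  cs_mulDr : right_distributive cs_mul +%R;
  cs_scaleAl : forall (c : R[i]) a b, c *: cs_mul a b = cs_mul (c *: a) b;
  cs_scaleAr : forall (c : R[i]) a b, c *: cs_mul a b = cs_mul a (c *: b);
  cs_starK : involutive cs_star;
  cs_starD : forall a b, cs_star (a + b) = cs_star a + cs_star b;
  cs_starZ : forall (c : R[i]) a, cs_star (c *: a) = Num.conj c *: cs_star a;
  cs_starM : forall a b, cs_star (cs_mul a b) = cs_mul (cs_star b) (cs_star a);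
  cs_normM : forall a b, `|cs_mul a b| <= `|a| * `|b|;
  cs_norm_star : forall a, `|cs_mul (cs_star a) a| = `|a| ^+ 2
}.

Definition cs_car (R : realType) (B : cstarAlg R) : Type := cs_space B.
Coercion cs_car : cstarAlg >-> Sortclass.

HB.instance Definition _ (R : realType) (B : cstarAlg R) :=
  CompleteNormedModule.copy (cs_car B) (cs_space B).
HB.instance Definition _ (R : realType) (B : cstarAlg R) :=
  GRing.Zmodule_isPzRing.Build (cs_car B)
    (@cs_mulA R B) (@cs_mul1l R B) (@cs_mul1r R B) (@cs_mulDl R B) (@cs_mulDr R B).

Definition star (R : realType) (B : cstarAlg R) (a : B) : B := cs_star a.

Definition cpos (R : realType) (B : cstarAlg R) (a : B) : Prop :=
  exists b : B, a = star b * b.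
Definition cle (R : realType) (B : cstarAlg R) (a b : B) : Prop := cpos (b - a).

(* [ract x b] is the right action x b. *)
HB.mixin Record isPreHilbertModule (R : realType) (B : cstarAlg R) E
    of GRing.Lmodule R[i] E := {
  ract : E -> B -> E;
  ip : E -> E -> B;
  ractDl : forall x y b, ract (x + y) b = ract x b + ract y b;
  ractDr : forall x b c, ract x (b + c) = ract x b + ract x c;
  ractM : forall x b c, ract x (b * c) = ract (ract x b) c;
  ract1 : forall x, ract x 1 = x;
  ractZl : forall (k : R[i]) x b, ract (k *: x) b = k *: ract x b;
  ractZr : forall (k : R[i]) x b, ract x (k *: b) = k *: ract x b;
  ipDr : forall x y z, ip x (y + z) = ip x y + ip x z;
  ipZr : forall (k : R[i]) x y, ip x (k *: y) = k *: ip x y;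
  ip_ract : forall x y b, ip x (ract y b) = ip x y * b;
  ip_star : forall x y, star (ip x y) = ip y x;
  ip_pos : forall x, cpos (ip x x);
  ip_eq0 : forall x, ip x x = 0 -> x = 0
}.

#[short(type="preHilbModType")]
HB.structure Definition PreHilbertModule (R : realType) (B : cstarAlg R) :=
  {E of GRing.Lmodule R[i] E & isPreHilbertModule R B E}.

Definition hnorm (R : realType) (B : cstarAlg R) (E : preHilbModType B)
  (x : E) : R[i] := sqrtC `|ip x x|.

HB.mixin Record isHilbertModule (R : realType) (B : cstarAlg R) E
    of PreHilbertModule R B E := {
  hilb_complete : forall u : nat -> E,
    (forall e : R[i], 0 < e -> exists N, forall m n,
       (N <= m)%N -> (N <= n)%N -> hnorm (u m - u n : E) < e) ->
    exists l : E, forall e : R[i], 0 < e -> exists N, forall n,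
       (N <= n)%N -> hnorm (u n - l) < e
}.

#[short(type="hilbModType")]
HB.structure Definition HilbertModule (R : realType) (B : cstarAlg R) :=
  {E of PreHilbertModule R B E & isHilbertModule R B E}.

(* The closed linear span of A is everything. *)
Definition total (R : realType) (B : cstarAlg R) (E : hilbModType B)
    (A : set E) : Prop :=
  forall (x : E) (e : R[i]), 0 < e ->
  exists (n : nat) (c : 'I_n -> R[i]) (a : 'I_n -> E),
    (forall i, A (a i)) /\ hnorm (x - \sum_(i < n) c i *: a i) < e.

Section InnerProduct.
Variables (R : realType) (B : cstarAlg R) (E : hilbModType B).
Implicit Types x y z : E.

Lemma ipDl x y z : ip (x + y) z = ip x z + ip y z.
Proof. by rewrite -ip_star ipDr /star cs_starD -!/(star _) !ip_star. Qed.

Lemma ipZl (k : R[i]) x y : ip (k *: x) y = Num.conj k *: ip x y.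
Proof. by rewrite -ip_star ipZr /star cs_starZ -!/(star _) ip_star. Qed.

Lemma ip_inj x y : (forall z, ip z x = ip z y) -> x = y.
Proof.
move=> h; apply/subr0_eq/(@ip_eq0 _ B).
suff {h} ipB z : ip z (x - y) = ip z x - ip z y by rewrite ipB h subrr.
by rewrite ipDr -(scaleN1r y) ipZr scaleN1r.
Qed.

End InnerProduct.

Record adjop (R : realType) (B : cstarAlg R) (E F : hilbModType B) := AdjOp {
  op :> E -> F;
  op_adj : F -> E;
  op_adjP : forall x y, ip (op x) y = ip x (op_adj y)
}.

Section Adjointable.
Variables (R : realType) (B : cstarAlg R).
Implicit Types E F G : hilbModType B.

Lemma op_adjP' E F (a : adjop E F) x y : ip (op_adj a x) y = ip x (a y).
Proof. by rewrite -ip_star -op_adjP ip_star. Qed.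

Lemma adjop_eq E F (a b : adjop E F) : op a = op b -> a = b.
Proof.
case: a b => [f f' hf] [g g' hg] /= fg; rewrite -{}fg in hg *.
suff fg' : f' = g' by rewrite -{}fg' in hg *; congr AdjOp; exact: Prop_irrelevance.
by apply/funext => y; apply: ip_inj => z; rewrite -hf hg.
Qed.

HB.instance Definition _ E F := gen_eqMixin (adjop E F).
HB.instance Definition _ E F := gen_choiceMixin (adjop E F).

Lemma adj_zeroP E F (x : E) (y : F) : ip (0 : F) y = ip x (0 : E).
Proof. by rewrite -(scale0r (0 : F)) ipZl -(scale0r (0 : E)) ipZr conjC0 !scale0r. Qed.
Definition adj_zero E F : adjop E F :=
  @AdjOp _ _ _ _ (fun=> 0) (fun=> 0) (@adj_zeroP E F).

Lemma adj_addP E F (a b : adjop E F) x y :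
  ip (a x + b x) y = ip x (op_adj a y + op_adj b y).
Proof. by rewrite ipDl ipDr !op_adjP. Qed.
Definition adj_add E F (a b : adjop E F) : adjop E F := AdjOp (adj_addP a b).

Lemma adj_scaleP E F (k : R[i]) (a : adjop E F) x y :
  ip (k *: a x) y = ip x (Num.conj k *: op_adj a y).
Proof. by rewrite ipZl ipZr op_adjP. Qed.
Definition adj_scale E F (k : R[i]) (a : adjop E F) : adjop E F :=
  AdjOp (adj_scaleP k a).

Lemma adj_addA E F : associative (@adj_add E F).
Proof. by move=> a b c; apply/adjop_eq/funext => x /=; rewrite addrA. Qed.
Lemma adj_addC E F : commutative (@adj_add E F).
Proof. by move=> a b; apply/adjop_eq/funext => x /=; rewrite addrC. Qed.
Lemma adj_add0 E F : left_id (@adj_zero E F) (@adj_add E F).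
Proof. by move=> a; apply/adjop_eq/funext => x /=; rewrite add0r. Qed.
Lemma adj_addN E F :
  left_inverse (@adj_zero E F) (adj_scale (-1)) (@adj_add E F).
Proof.
by move=> a; apply/adjop_eq/funext => x /=; rewrite scaleN1r addNr.
Qed.
HB.instance Definition _ E F := GRing.isZmodule.Build (adjop E F)
  (@adj_addA E F) (@adj_addC E F) (@adj_add0 E F) (@adj_addN E F).

Lemma adj_scaleA E F (k l : R[i]) (a : adjop E F) :
  adj_scale k (adj_scale l a) = adj_scale (k * l) a.
Proof. by apply/adjop_eq/funext => x /=; rewrite scalerA. Qed.
Lemma adj_scale1 E F : left_id 1 (@adj_scale E F).
Proof. by move=> a; apply/adjop_eq/funext => x /=; rewrite scale1r. Qed.
Lemma adj_scaleDr E F : right_distributive (@adj_scale E F) +%R.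
Proof. by move=> k a b; apply/adjop_eq/funext => x /=; rewrite scalerDr. Qed.
Lemma adj_scaleDl E F (a : adjop E F) :
  {morph (@adj_scale E F)^~ a : k l / k + l}.
Proof. by move=> k l; apply/adjop_eq/funext => x /=; rewrite scalerDl. Qed.
HB.instance Definition _ E F := GRing.Zmodule_isLmodule.Build R[i] (adjop E F)
  (@adj_scaleA E F) (@adj_scale1 E F) (@adj_scaleDr E F) (@adj_scaleDl E F).

Lemma adj_oneP E (x y : E) : ip (id x) y = ip x (id y).
Proof. by []. Qed.
Definition adj_one E : adjop E E := AdjOp (@adj_oneP E).

Lemma adj_compP E F G (a : adjop F G) (b : adjop E F) x y :
  ip (a (b x)) y = ip x (op_adj b (op_adj a y)).
Proof. by rewrite !op_adjP. Qed.
Definition adj_comp E F G (a : adjop F G) (b : adjop E F) : adjop E G :=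
  AdjOp (adj_compP a b).

Definition adj_star E F (a : adjop E F) : adjop F E := AdjOp (op_adjP' a).

(* [ketbra x y] is the operator x y^* : z |-> x <y, z>, so that the operator   *)
(* x b y^* is [ketbra (ract x b) y]. *)
Lemma ketbraP E F (x : F) (y z : E) (w : F) :
  ip (ract x (ip y z)) w = ip z (ract y (ip x w)).
Proof. by rewrite -ip_star !ip_ract /star cs_starM -!/(star _) !ip_star. Qed.
Definition ketbra E F (x : F) (y : E) : adjop E F := AdjOp (ketbraP x y).

(* The operator norm of a is at most c. *)
Definition opnorm_le E F (a : adjop E F) (c : R[i]) : Prop :=
  0 <= c /\ forall x, hnorm (a x) <= c * hnorm x.

(* The norm closure of the span of the operators x y^*. *)
Definition compact_op E (k : adjop E E) : Prop :=
  forall e : R[i], 0 < e ->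
  exists (n : nat) (x y : 'I_n -> E),
    opnorm_le (k - \sum_(i < n) ketbra (x i) (y i)) e.

(* The strict topology is given by the seminorms a |-> |a k| and a |-> |k a|   *)
(* with k compact.                                                             *)
Definition strict_cvg E (X : set_system (adjop E E)) (a : adjop E E) : Prop :=
  forall k, compact_op k -> forall e : R[i], 0 < e ->
  \forall b \near X,
    opnorm_le (adj_comp (b - a) k) e /\ opnorm_le (adj_comp k (b - a)) e.

Definition op_bounded E (A : set (adjop E E)) : Prop :=
  exists c : R[i], forall a, A a -> opnorm_le a c.

(* Continuity for the strict topologies of the restrictions to bounded sets.   *)
Definition strict_on_bounded E (th : adjop E E -> adjop E E) : Prop :=
  forall A, op_bounded A -> forall a, A a ->
  forall X : set_system (adjop E E), Filter X -> X A ->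
  strict_cvg X a -> strict_cvg (th @ X) (th a).

Record star_endomorphism E (th : adjop E E -> adjop E E) : Prop := {
  se_linear : linear th;
  se_comp : forall a b, th (adj_comp a b) = adj_comp (th a) (th b);
  se_star : forall a, th (adj_star a) = adj_star (th a)
}.

Record unitary E F := Unitary {
  un_op :> adjop E F;
  un_starL : adj_comp (adj_star un_op) un_op = adj_one E;
  un_starR : adj_comp un_op (adj_star un_op) = adj_one F
}.

(* v a v^* *)
Definition conj_op E F (v : unitary E F) (a : adjop E E) : adjop F F :=
  adj_comp v (adj_comp a (adj_star v)).

End Adjointable.

HB.mixin Record isCorrespondence (R : realType) (B : cstarAlg R) E
    of HilbertModule R B E := {
  lact : B -> adjop (E : hilbModType B) (E : hilbModType B);
  lactD : forall a b, lact (a + b) = lact a + lact b;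
  lactZ : forall (k : R[i]) b, lact (k *: b) = k *: lact b;
  lactM : forall a b, lact (a * b) = adj_comp (lact a) (lact b);
  lact_star : forall b, lact (star b) = adj_star (lact b);
  lact_nondeg : total [set z : E | exists b x, z = lact b x]
}.

#[short(type="corrType")]
HB.structure Definition Correspondence (R : realType) (B : cstarAlg R) :=
  {E of HilbertModule R B E & isCorrespondence R B E}.

(* B as a correspondence over itself. *)
Definition regular (R : realType) (B : cstarAlg R) : Type := B.

Section Regular.
Variables (R : realType) (B : cstarAlg R).
Implicit Types x y z a b : B.

HB.instance Definition _ := GRing.Lmodule.copy (regular B) B.

Lemma reg_ipDr x y z : star x * (y + z) = star x * y + star x * z.
Proof. exact: mulrDr. Qed.
Lemma reg_ipZr (k : R[i]) x y : star x * (k *: y) = k *: (star x * y).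
Proof. by symmetry; apply: cs_scaleAr. Qed.
Lemma reg_ip_ract x y b : star x * (y * b) = star x * y * b.
Proof. exact: mulrA. Qed.
Lemma reg_ip_star x y : star (star x * y) = star y * x.
Proof. by rewrite /star cs_starM cs_starK. Qed.
Lemma reg_ip_pos x : cpos (star x * x).
Proof. by exists x. Qed.
Lemma reg_ip_eq0 x : star x * x = 0 -> x = 0.
Proof.
move=> /(congr1 Num.norm) /eqP; rewrite normr0 cs_norm_star sqrf_eq0.
by rewrite normr_eq0 => /eqP.
Qed.
Lemma reg_ractZl (k : R[i]) x b : (k *: x) * b = k *: (x * b).
Proof. by symmetry; apply: cs_scaleAl. Qed.
Lemma reg_ractZr (k : R[i]) x b : x * (k *: b) = k *: (x * b).
Proof. by symmetry; apply: cs_scaleAr. Qed.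

HB.instance Definition _ := @isPreHilbertModule.Build R B (regular B)
  (fun x b : B => x * b) (fun x y : B => star x * y)
  (fun x y b => mulrDl x y b) (fun x b c => mulrDr x b c)
  (fun x b c => mulrA x b c) (fun x => mulr1 x) reg_ractZl reg_ractZr
  reg_ipDr reg_ipZr reg_ip_ract reg_ip_star reg_ip_pos reg_ip_eq0.

Lemma reg_hnorm (x : regular B) : hnorm x = `|x : B|.
Proof. by rewrite /hnorm /ip /= cs_norm_star sqrCK. Qed.

Lemma reg_complete (u : nat -> regular B) :
  (forall e : R[i], 0 < e -> exists N, forall m n,
     (N <= m)%N -> (N <= n)%N -> hnorm (u m - u n) < e) ->
  exists l : regular B, forall e : R[i], 0 < e -> exists N, forall n,
     (N <= n)%N -> hnorm (u n - l) < e.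
Proof.
move=> uC; pose v : nat -> B := u.
have /cauchy_cvg vc : cauchy (v @ \oo).
  apply/cauchy_ballP => e e0; have [N NP] := uC e e0.
  exists (v @` [set n | (N <= n)%N], v @` [set n | (N <= n)%N]).
    by split; exists N => // n Nn; exists n.
  case=> _ _ [/= [m Nm <-] [n Nn <-]]; rewrite -ball_normE /ball_ /=.
  by have := NP m n Nm Nn; rewrite reg_hnorm.
exists (lim (v @ \oo)) => e e0.
move/cvgrPdist_lt : vc => /(_ e e0) [N _ NP]; exists N => n Nn.
by rewrite reg_hnorm distrC; apply: NP.
Qed.

HB.instance Definition _ := @isHilbertModule.Build R B (regular B) reg_complete.

Lemma reg_lactP b (x y : regular B) :
  ip ((b * x : B) : regular B) y = ip x ((star b * y : B) : regular B).
Proof. by rewrite /ip /= /star cs_starM -mulrA. Qed.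
Definition reg_lact b : adjop (regular B) (regular B) :=
  AdjOp (@reg_lactP b).

Lemma reg_lactD a b : reg_lact (a + b) = reg_lact a + reg_lact b.
Proof. by apply/adjop_eq/funext => x; apply: mulrDl. Qed.
Lemma reg_lactZ (k : R[i]) b : reg_lact (k *: b) = k *: reg_lact b.
Proof. by apply/adjop_eq/funext => x; apply: reg_ractZl. Qed.
Lemma reg_lactM a b : reg_lact (a * b) = adj_comp (reg_lact a) (reg_lact b).
Proof. by apply/adjop_eq/funext => x; rewrite /= mulrA. Qed.
Lemma reg_lact_star b : reg_lact (star b) = adj_star (reg_lact b).
Proof. exact/adjop_eq/funext. Qed.
Lemma reg_lact_nondeg : total [set z : regular B | exists b x, z = reg_lact b x].
Proof.
move=> x e e0; exists 1%N, (fun=> 1), (fun=> x); split=> [_|].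
  by exists 1, x => /=; rewrite mul1r.
by rewrite big_ord1 scale1r subrr reg_hnorm normr0.
Qed.
HB.instance Definition _ := @isCorrespondence.Build R B (regular B)
  reg_lact reg_lactD reg_lactZ reg_lactM reg_lact_star reg_lact_nondeg.

End Regular.

(* The half line [0, oo) as an additive monoid. *)
Record halfline (R : realType) := HalfLine {
  hl_val :> R;
  hl_ge0 : 0 <= hl_val
}.
HB.instance Definition _ (R : realType) := [isSub for @hl_val R].
HB.instance Definition _ (R : realType) := [Choice of halfline R by <:].

Section HalfLine.
Variable R : realType.
Implicit Types s t : halfline R.

Definition hl_zero : halfline R := HalfLine (lexx 0).
Definition hl_add s t : halfline R := HalfLine (addr_ge0 (hl_ge0 s) (hl_ge0 t)).
Lemma hl_addA : associative hl_add.
Proof. by move=> r s t; apply/val_inj; rewrite /= addrA. Qed.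
Lemma hl_addC : commutative hl_add.
Proof. by move=> s t; apply/val_inj; rewrite /= addrC. Qed.
Lemma hl_add0 : left_id hl_zero hl_add.
Proof. by move=> t; apply/val_inj; rewrite /= add0r. Qed.
HB.instance Definition _ :=
  GRing.isNmodule.Build (halfline R) hl_addA hl_addC hl_add0.
End HalfLine.

Variant time_kind := ContinuousTime | DiscreteTime.

Definition time (R : realType) (k : time_kind) : nmodType :=
  match k with
  | ContinuousTime => halfline R
  | DiscreteTime => nat
  end.

Section ProductSystems.
Variables (R : realType) (B : cstarAlg R).

Record bilinear_unitary (E F : corrType B) := BilinearUnitary {
  bu_unitary :> unitary E F;
  bu_ract : forall x b, bu_unitary (ract x b) = ract (bu_unitary x) b;
  bu_lact : forall b x, bu_unitary (lact b x) = lact b (bu_unitary x)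
}.

(* An internal tensor product of E and F: a correspondence generated by        *)
(* elements x (.) y with <x (.) y, x' (.) y'> = <y, <x, x'> y'> and            *)
(* b (x (.) y) = (b x) (.) y. These properties determine it up to a unique     *)
(* bilinear unitary respecting the elements x (.) y, and imply that            *)
(* (x, y) |-> x (.) y is biadditive and B-balanced.                            *)
Record internal_tensor (E F : corrType B) := InternalTensor {
  it_corr :> corrType B;
  it_tens : E -> F -> it_corr;
  it_ip : forall x x' y y',
    ip (it_tens x y) (it_tens x' y') = ip y (lact (ip x x') y');
  it_lact : forall b x y, lact b (it_tens x y) = it_tens (lact b x) y;
  it_ract : forall x y b, ract (it_tens x y) b = it_tens x (ract y b);
  it_total : total [set z : it_corr | exists x y, z = it_tens x y]
}.

Variable S : nmodType.

(* The identification of B with E_0 is the bilinear unitary [pd_one]. *)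
Record product_data := ProductData {
  pd_corr :> S -> corrType B;
  pd_one : bilinear_unitary (regular B) (pd_corr 0);
  pd_tens : forall s t, internal_tensor (pd_corr s) (pd_corr t);
  pd_u : forall s t, bilinear_unitary (pd_tens s t) (pd_corr (s + t))
}.

Definition pmul (E : product_data) (s t : S) (x : E s) (y : E t) : E (s + t) :=
  pd_u E s t (it_tens (pd_tens E s t) x y).

(* Transport along equalities of times such as r + (s + t) = r + s + t. *)
Definition ptr (E : product_data) (s t : S) (e : s = t) (x : E s) : E t :=
  eq_rect s (fun r => E r) x t e.

Record product_system := ProductSystem {
  ps_data :> product_data;
  ps_mulA : forall (r s t : S) (x : ps_data r) (y : ps_data s) (z : ps_data t),
    ptr (addrA r s t) (pmul x (pmul y z)) = pmul (pmul x y) z;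
  ps_mul1l : forall (t : S) (b : B) (x : ps_data t),
    ptr (add0r t) (pmul (pd_one ps_data b) x) = lact b x;
  ps_mul1r : forall (t : S) (x : ps_data t) (b : B),
    ptr (addr0 t) (pmul x (pd_one ps_data b)) = ract x b
}.

Record psunit (E : product_system) := PSUnit {
  pu_val :> forall t, E t;
  pu_zero : pu_val 0 = pd_one E (1 : B);
  pu_mul : forall s t, pmul (pu_val s) (pu_val t) = pu_val (s + t)
}.

Definition contractive_unit (E : product_system) (xi : psunit E) : Prop :=
  forall t, cle (ip (xi t) (xi t)) 1.

Definition unit_semigroup (E : product_system) (xi : psunit E) (t : S) (b : B) :
  B := ip (xi t) (lact b (xi t)).

Definition completely_positive (T : B -> B) : Prop :=
  linear T /\
  forall (n : nat) (a b : 'I_n -> B),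
    cpos (\sum_(i < n) \sum_(j < n) star (b i) * T (star (a i) * a j) * b j).

Record contractive_cp_semigroup (T : S -> B -> B) : Prop := {
  cp_zero : forall b, T 0 b = b;
  cp_add : forall s t b, T (s + t) b = T s (T t b);
  cp_cp : forall t, completely_positive (T t);
  cp_contr : forall t b, `|T t b| <= `|b|
}.

Record strict_Esemigroup (E : hilbModType B)
    (th : S -> adjop E E -> adjop E E) : Prop := {
  es_endo : forall t, star_endomorphism (th t);
  es_zero : forall a, th 0 a = a;
  es_add : forall s t a, th (s + t) a = th s (th t a);
  es_strict : forall t, strict_on_bounded (th t)
}.

Record weak_dilation (T : S -> B -> B) := WeakDilation {
  wd_mod : hilbModType B;
  wd_th : S -> adjop wd_mod wd_mod -> adjop wd_mod wd_mod;
  wd_xi : wd_mod;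
  wd_Esemigroup : strict_Esemigroup wd_th;
  wd_unit : ip wd_xi wd_xi = 1;
  wd_dil : forall t b,
    T t b = ip wd_xi (wd_th t (ketbra (ract wd_xi b) wd_xi) wd_xi)
}.

Section AssociatedProductSystem.
Variables (E : hilbModType B) (th : S -> adjop E E -> adjop E E) (xi : E).

Definition assoc_member (t : S) : set E := range (th t (ketbra xi xi)).
Definition assoc_lact (t : S) (b : B) (x : E) : E :=
  th t (ketbra (ract xi b) xi) x.
Definition assoc_mul (t : S) (x y : E) : E := th t (ketbra x xi) y.

(* An isomorphism from F onto the product system associated with th and xi:    *)
(* v t is a bilinear unitary from F t onto the submodule [assoc_member t].     *)
Record assoc_iso (F : product_system) (v : forall t, F t -> E) : Prop := {
  ai_ip : forall t x y, ip (v t x) (v t y) = ip x y;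
  ai_onto : forall t, range (v t) = assoc_member t;
  ai_ract : forall t x b, v t (ract x b) = ract (v t x) b;
  ai_lact : forall t b x, v t (lact b x) = assoc_lact t b (v t x);
  ai_mul : forall s t (x : F s) (y : F t),
    v (s + t) (pmul x y) = assoc_mul t (v s x) (v t y);
  ai_one : forall b : B, v 0 (pd_one F b) = ract xi b
}.

End AssociatedProductSystem.

Section Dilations.
Variable T : S -> B -> B.

Definition unitarily_equivalent (D D' : weak_dilation T) : Prop :=
  exists v : unitary (wd_mod D) (wd_mod D'),
    v (wd_xi D) = wd_xi D' /\
    forall t a, conj_op v (wd_th t a) = wd_th t (conj_op v a).

(* The product system associated with the dilation is F, with the unit u of F  *)
(* sitting in it as th_t(xi xi^* ) xi. The isomorphism alone does not determine *)
(* the dilation: let B = E_n = C over N_0 with unit xi_n = 4^-n, and let V be   *)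
(* an isometry with cyclic vector xi and <xi, V^n xi> = 4^-n c_n, which exists  *)
(* for all c_n of modulus 1 (c_0 = 1). Then th_n(a) = V^n a V^n^* gives a       *)
(* dilation of the same T generated by the same product system, but different  *)
(* sequences c are equivalent only if they differ by a sequence z^n.           *)
Definition has_product_system (F : product_system) (u : psunit F)
    (D : weak_dilation T) : Prop :=
  exists v : forall t, F t -> wd_mod D,
    assoc_iso (@wd_th T D) (wd_xi D) v /\
    forall t, v t (u t) = wd_th t (ketbra (wd_xi D) (wd_xi D)) (wd_xi D).

Definition is_generated (D : weak_dilation T) : Prop :=
  total (\bigcup_t assoc_member (@wd_th T D) (wd_xi D) t).

End Dilations.

End ProductSystems.

(* Main.v *)
(* If v_t : E_t -> E denotes the embedding of E_t as theta_t(xi xi^* )E, then a  *)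
(* dilation with the required properties satisfies                             *)
(*   <v_(s+t) x, v_t y> = <x, xi_s (.) y>,                                     *)
(* so E and the v_t are determined by this kernel. It is positive: ordering    *)
(* the times, one may successively replace the two earliest vectors x and y    *)
(* by y + xi_r (.) x, which costs |x|^2 - |xi_r (.) x|^2 >= 0 because the unit *)
(* is contractive. Its Kolmogorov decomposition is E, and                      *)
(*   v_s x (.) y |-> v_(s+t) (x (.) y)                                         *)
(* defines an isometry from the tensor product of E and E_t onto a             *)
(* complemented submodule: v_t (xi_(t-r) (.) y) is the projection of v_r y     *)
(* for r <= t. Then theta_t(a) is a (.) id on that submodule and 0 on its      *)
(* complement. Conversely, theta_t (v_s x xi^* ) v_t y = v_(s+t) (x (.) y)      *)
(* forces theta_t(a) = a (.) id on it for every dilation, and strictness,      *)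
(* tested on a bounded net of finite rank operators converging to 1, forces    *)
(* theta_t(a) to vanish on the complement.                                     *)
From HB Require Import structures.
From mathcomp Require Import all_boot all_order all_algebra.
From mathcomp Require Import all_classical all_reals all_analysis.
From mathcomp Require Import complex.
From mathcomp Require Import ring lra.
Require Import Defs.
Set Implicit Arguments.
Unset Strict Implicit.
Unset Printing Implicit Defensive.
Import Order.TTheory GRing.Theory Num.Theory.
Import numFieldNormedType.Exports.
Local Open Scope classical_set_scope.
Local Open Scope ring_scope.
Local Open Scope complex_scope.

(** * Equality of linear combinations *)

(** A dilation is governed by the inner products between the embedded copies of the E_t, and these
    can be read off from the unit: for s = r + t, a vector x of E_s meets a vector y of E_t in the
    inner product of x and xi_r (.) y. This kernel is [gram]. Existence amounts to its positivity,
    uniqueness to recovering a dilation from it.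

    Positivity is [qform_sorted]: the earliest vector is moved up to the next time, at the price of
    a term that is positive by contractivity. [kolmogorov] turns the kernel into a Hilbert module H
    with a total family v. Since the unit is inserted on the left, multiplication by E_t from the
    right respects the kernel ([gram_mul]), which yields the isometry [vm] of H (.) E_t into H. Its
    range is complemented ([vm_dense]), so [amp] can extend a (.) id by 0. The semigroup law comes
    from associativity ([vm_pmul]), strictness from [amp_strict].

    Conversely, [emb_ip] finds the kernel [gram] in every dilation with the required properties and
    [th_vth] identifies its semigroup with the amplification; on the complement this rests on
    [strict_one_perp]. Two realizations of one kernel are related by a unitary
    ([realization_unitary]) that intertwines the semigroups ([vth_conj]).

    The analysis underneath starts from the axioms of a C*-algebra: square roots by iteration, the
    equivalence of being of the form b^*b with a norm condition ([cpos_near_scalar]),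
    Cauchy-Schwarz, automatic boundedness ([adjop_bounded]) and the norm of an amplification
    ([amp_img_bound]). *)

Section ModuleNormalisation.
Variables (K : pzRingType) (V : lmodType K).

Inductive lexp := LV of nat | L0 | LA of lexp & lexp | LO of lexp | LS of K & lexp.

Fixpoint lev (e : seq V) t : V :=
  match t with
  | LV n => nth 0 e n
  | L0 => 0
  | LA a b => lev e a + lev e b
  | LO a => - lev e a
  | LS k a => k *: lev e a
  end.

(** Comparing indices by [PeanoNat.Nat.eqb] lets [cbn] reduce each coefficient to an expression in
    the scalars that [ring] can treat. *)
Fixpoint lco (n : nat) t : K :=
  match t with
  | LV m => if PeanoNat.Nat.eqb n m then 1 else 0
  | L0 => 0
  | LA a b => lco n a + lco n b
  | LO a => - lco n a
  | LS k a => k * lco n a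
  end.

Fixpoint lok (n : nat) t u : Prop :=
  if n is n'.+1 then lok n' t u /\ lco n' t = lco n' u else True.

Lemma levE e t : lev e t = \sum_(i < size e) lco i t *: nth 0 e i.
Proof.
elim: t => [m||a IHa b IHb|a IHa|k a IHa] /=; rewrite ?IHa ?IHb.
- have [ltm|lem] := ltnP m (size e).
    rewrite (bigD1 (Ordinal ltm)) //= PeanoNat.Nat.eqb_refl scale1r big1 ?addr0 //.
    move=> i im; case: PeanoNat.Nat.eqb_spec => [h|_]; last by rewrite scale0r.
    by case/eqP: im; apply: val_inj.
  rewrite nth_default // big1 // => i _.
  case: PeanoNat.Nat.eqb_spec => [h|_]; last by rewrite scale0r.
  by move: (ltn_ord i); rewrite h ltnNge lem.
- by rewrite big1 // => i _; rewrite scale0r.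
- by rewrite -big_split /=; apply: eq_bigr => i _; rewrite scalerDl.
- by rewrite -sumrN; apply: eq_bigr => i _; rewrite scaleNr.
- by rewrite scaler_sumr; apply: eq_bigr => i _; rewrite scalerA.
Qed.

Lemma lokP e t u : lok (size e) t u -> lev e t = lev e u.
Proof.
rewrite !levE; move: (nth 0 e) => f.
elim: (size e) => [|n IH] /=; first by rewrite !big_ord0.
by case=> h hn; rewrite !big_ord_recr /= IH // hn.
Qed.

End ModuleNormalisation.

(** Wrapping the tests in [match constr:(Set)] runs tactics while a term is being computed. Atoms
    are identified up to unification, as equal vectors may appear through different instances. *)
Ltac lm_index x l :=
  lazymatch l with
  | cons ?y ?l' =>
      match constr:(Set) with
      | _ => let _ := match constr:(Set) with _ => first [constr_eq x y | unify x y] end in constr:(O)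
      | _ => let n := lm_index x l' in constr:(S n)
      end
  end.
Ltac lm_add x l :=
  match constr:(Set) with
  | _ => let _ := lm_index x l in l
  | _ => constr:(cons x l)
  end.
Ltac lm_atoms l t :=
  lazymatch t with
  | (?a + ?b)%R => let l1 := lm_atoms l a in lm_atoms l1 b
  | (- ?a)%R => lm_atoms l a
  | (?k *: ?a)%R => lm_atoms l a
  | 0%R => l
  | _ => lm_add t l
  end.
Ltac lm_reify K l t :=
  lazymatch t with
  | (?a + ?b)%R =>
      let a' := lm_reify K l a in let b' := lm_reify K l b in constr:(@LA K a' b')
  | (- ?a)%R => let a' := lm_reify K l a in constr:(@LO K a')
  | (?k *: ?a)%R => let a' := lm_reify K l a in constr:(@LS K k a')
  | 0%R => constr:(@L0 K)
  | _ => let n := lm_index t l in constr:(@LV K n)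
  end.
(* Equality of linear combinations of atoms of the K-module V: leaves the      *)
(* equations between coefficients that ring does not prove.                    *)
Ltac lmod K V :=
  lazymatch goal with
  | |- @eq _ ?t ?u =>
      let l0 := lm_atoms (@nil V) t in
      let l := lm_atoms l0 u in
      let t' := lm_reify K l t in
      let u' := lm_reify K l u in
      refine (@lokP K V l t' u' _);
      cbn [lok lco size PeanoNat.Nat.eqb];
      repeat split; try ring
  end.

(** * Positivity in C*-algebras *)

Section RealNorm.
Variables (R : realType) (B : cstarAlg R).
Implicit Types (a b c x y : B) (r s t : R).

(** Real values make the estimates accessible to [lra]. *)
Definition nrm a : R := complex.Re `|a|.

Lemma normE a : `|a| = (nrm a)%:C.
Proof. by rewrite /nrm RRe_real // normr_real. Qed.

Lemma nrm_ge0 a : 0 <= nrm a.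
Proof. by rewrite -lecR -normE normr_ge0. Qed.
Lemma nrm_eq0 a : nrm a = 0 -> a = 0.
Proof. by move=> h; apply/normr0_eq0; rewrite normE h. Qed.
Lemma nrm0 : nrm 0 = 0.
Proof. by apply/complexI; rewrite -normE normr0. Qed.
Lemma nrmN a : nrm (- a) = nrm a.
Proof. by apply/complexI; rewrite -!normE normrN. Qed.
Lemma nrmD a b : nrm (a + b) <= nrm a + nrm b.
Proof. by rewrite -lecR rmorphD /= -!normE ler_normD. Qed.
Lemma nrmB a b : nrm (a - b) <= nrm a + nrm b.
Proof. by rewrite (le_trans (nrmD _ _)) // nrmN. Qed.
Lemma nrmBC a b : nrm (a - b) = nrm (b - a).
Proof. by rewrite -nrmN opprB. Qed.
Lemma nrmM a b : nrm (a * b) <= nrm a * nrm b.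
Proof. by rewrite -lecR rmorphM /= -!normE; apply: cs_normM. Qed.
Lemma nrm_starM a : nrm (star a * a) = nrm a ^+ 2.
Proof. by apply/complexI; rewrite rmorphXn /= -!normE; apply: cs_norm_star. Qed.

Lemma starK a : star (star a) = a.
Proof. exact: cs_starK. Qed.
Lemma starD a b : star (a + b) = star a + star b.
Proof. exact: cs_starD. Qed.
Lemma starM a b : star (a * b) = star b * star a.
Proof. exact: cs_starM. Qed.
Lemma starZ (k : R[i]) a : star (k *: a) = Num.conj k *: star a.
Proof. exact: cs_starZ. Qed.
Lemma starZr r a : star (r%:C *: a) = r%:C *: star a.
Proof. by rewrite starZ; congr (_ *: _); apply: conjc_real. Qed.
Lemma starN a : star (- a) = - star a.
Proof. by rewrite -scaleN1r starZ rmorphN1 scaleN1r. Qed.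
Lemma starB a b : star (a - b) = star a - star b.
Proof. by rewrite starD starN. Qed.
Lemma star0 : star (0 : B) = 0.
Proof. by rewrite -{1}(subrr (0 : B)) starB subrr. Qed.
Lemma star1 : star (1 : B) = 1.
Proof. by rewrite -[LHS]mulr1 -[X in _ * X]starK -starM mulr1 starK. Qed.

Lemma scalAl (k : R[i]) a b : (k *: a) * b = k *: (a * b).
Proof. by symmetry; apply: cs_scaleAl. Qed.
Lemma scalAr (k : R[i]) a b : a * (k *: b) = k *: (a * b).
Proof. by symmetry; apply: cs_scaleAr. Qed.

(** Cancel |b| in |b|^2 = |b^*b| <= |b^*| |b|, then exchange b and its adjoint. *)
Lemma nrm_star a : nrm (star a) = nrm a.
Proof.
have H b : nrm b <= nrm (star b).
  have [->|nb] := eqVneq (nrm b) 0; first exact: nrm_ge0.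
  have b0 : 0 < nrm b by rewrite lt_neqAle eq_sym nb nrm_ge0.
  by rewrite -(ler_pM2r b0) -expr2 -nrm_starM nrmM.
by apply/eqP; rewrite eq_le H -{2}(starK a) H.
Qed.

Lemma nrmZ (k : R[i]) a : nrm (k *: a) = complex.Re `|k| * nrm a.
Proof.
apply/complexI; rewrite rmorphM -!normE normrZ; congr (_ * _).
by symmetry; apply: RRe_real; apply: normr_real.
Qed.
Lemma nrmZr r a : nrm (r%:C *: a) = `|r| * nrm a.
Proof. by rewrite nrmZ normc_def /= expr0n addr0 sqrtr_sqr. Qed.

(** The norm of 1 is its own square, hence 0 or 1; the value 0 belongs to the zero algebra. *)
Lemma nrm1_le : nrm 1 <= 1.
Proof.
have : nrm 1 ^+ 2 = nrm 1 by rewrite -nrm_starM star1 mulr1.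
move/eqP; rewrite -subr_eq0 expr2 -{3}(mulr1 (nrm 1)) -mulrBr mulf_eq0.
case/orP => [/eqP->|]; first exact: ler01.
by rewrite subr_eq0 => /eqP ->.
Qed.

Definition clim (u : nat -> B) (l : B) :=
  forall e : R, 0 < e -> exists N, forall n, (N <= n)%N -> nrm (u n - l) < e.

Lemma nrm_complete (u : nat -> B) :
  (forall e : R, 0 < e -> exists N, forall m n,
     (N <= m)%N -> (N <= n)%N -> nrm (u m - u n) < e) ->
  exists l, clim u l.
Proof.
move=> uC; have [e e0|l lP] := @reg_complete R B u.
  have [Ie re] : complex.Im e = 0 /\ 0 < complex.Re e.
    by move: e0; rewrite ltcE /= => /andP [/eqP -> ->].
  have [N NP] := uC _ re; exists N => m n mN nN.
  rewrite reg_hnorm normE ltcE /= Ie eqxx /=; exact: NP.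
exists l => e e0; have [|N NP] := lP e%:C; first by rewrite ltcR.
by exists N => n nN; have := NP n nN; rewrite reg_hnorm normE ltcR.
Qed.

End RealNorm.

Ltac ncexp := rewrite ?(mulrDl,mulrDr,mulNr,mulrN,scalAl,scalAr,mul1r,mulr1,mulr0,mul0r,mulrA).
Ltac ncring R B := ncexp; lmod R[i] B.

Lemma bounded_nondecreasing_cauchy (R : realType) (f : nat -> R) (M : R) : nondecreasing_seq f ->
  (forall n, f n <= M) ->
  forall e : R, 0 < e -> exists N, forall m n,
     (N <= m)%N -> (m <= n)%N -> f n - f m < e.
Proof.
move=> fi fM e e0.
have fs : has_sup (range f).
  by split; [exists (f 0%N), 0%N | exists M => _ [n _ <-]].
have [_ [N _ <-] NP] := sup_adherent e0 fs.
exists N => m n Nm mn.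
have : f n <= sup (range f) by apply: ub_le_sup; [exact: fs.2|exists n].
have := fi _ _ Nm; lra.
Qed.

(** Distances dominated by the increments of a bounded monotone real sequence telescope. The square
    root iteration, the Neumann series and the gliding hump all converge for this reason. *)
Lemma increments_cauchy (R : realType) (d : nat -> nat -> R) (f : nat -> R) (M : R) :
  (forall m n, d m n = d n m) -> (forall m, d m m = 0) ->
  (forall m n p, d m p <= d m n + d n p) ->
  nondecreasing_seq f -> (forall n, f n <= M) ->
  (forall n, d n n.+1 <= f n.+1 - f n) ->
  forall e : R, 0 < e -> exists N, forall m n,
     (N <= m)%N -> (N <= n)%N -> d m n < e.
Proof.
move=> dC d0 dT fi fM df e e0.
have [N NP] := bounded_nondecreasing_cauchy fi fM e0.
have D m k : d m (m + k)%N <= f (m + k)%N - f m.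
  elim: k => [|k IH]; first by rewrite addn0 d0 subrr.
  rewrite addnS (le_trans (dT _ (m + k)%N _)) //.
  by have := df (m + k)%N; lra.
have D' m n : (m <= n)%N -> d m n <= f n - f m by move=> /subnKC <-.
exists N => m n Nm Nn; case/orP: (leq_total m n) => mn.
  exact: le_lt_trans (D' _ _ mn) (NP _ _ Nm mn).
by rewrite dC; exact: le_lt_trans (D' _ _ mn) (NP _ _ Nn mn).
Qed.

(* The iteration y' = (x + y^2) / 2 converges to 1 - sqrt (1 - x) for           *)
(* |x| <= 1, being dominated termwise by the same iteration for x = 1.          *)
Section SquareRoot.
Variables (R : realType) (B : cstarAlg R).
Implicit Types (a b c x y : B) (r s t : R).

(** The device for passing to the limit in identities: a fixed element dominated by the errors at
    steps n and n + 1 vanishes. Two consecutive steps occur because recursions relate them. *)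
Lemma clim_eq0 (u : nat -> B) (l a : B) (C : R) : clim u l ->
  (forall n, nrm a <= C * (nrm (u n - l) + nrm (u n.+1 - l))) -> a = 0.
Proof.
move=> ul aC; apply: nrm_eq0; apply/eqP; rewrite eq_le nrm_ge0 andbT.
apply/ler_addgt0Pr => e e0; rewrite add0r.
have C0 : 0 < `|C| + 1 by rewrite ltr_wpDl.
have [N NP] := ul (e / (2 * (`|C| + 1))) (divr_gt0 e0 (mulr_gt0 (ltr0Sn _ 1) C0)).
have := aC N; have := NP _ (leqnn N); have := NP _ (leqnSn N).
set p := nrm _; set q := nrm _ => p1 q1 h; apply: (le_trans h).
have pq : 0 <= q + p by rewrite addr_ge0 ?nrm_ge0.
have /le_trans : C * (q + p) <= (`|C| + 1) * (q + p).
  by rewrite ler_wpM2r // (le_trans (ler_norm C)) // lerDl.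
apply; rewrite -ler_pdivlMl // mulrC.
have -> : e / (`|C| + 1) = e / (2 * (`|C| + 1)) + e / (2 * (`|C| + 1)).
  by field; rewrite gt_eqF.
by apply: lerD; apply: ltW.
Qed.

Definition selfadj a := star a = a.

Lemma selfadj_starM a : selfadj (star a * a).
Proof. by rewrite /selfadj starM starK. Qed.
Lemma selfadjD a b : selfadj a -> selfadj b -> selfadj (a + b).
Proof. by move=> ha hb; rewrite /selfadj starD ha hb. Qed.
Lemma selfadjB a b : selfadj a -> selfadj b -> selfadj (a - b).
Proof. by move=> ha hb; rewrite /selfadj starB ha hb. Qed.
Lemma selfadjZ r a : selfadj a -> selfadj (r%:C *: a).
Proof. by move=> ha; rewrite /selfadj starZr ha. Qed.
Lemma selfadjM a b : selfadj a -> selfadj b -> a * b = b * a -> selfadj (a * b).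
Proof. by move=> ha hb ab; rewrite /selfadj starM ha hb. Qed.
Lemma selfadj1 : selfadj (1 : B). Proof. exact: star1. Qed.

Section Iteration.
Variable x : B.

Fixpoint sqrt_iter n : B :=
  if n is n'.+1 then (2^-1)%:C *: (x + sqrt_iter n' * sqrt_iter n') else 0.
Lemma sqrt_iterS n : sqrt_iter n.+1 = (2^-1)%:C *: (x + sqrt_iter n * sqrt_iter n).
Proof. by []. Qed.
Fixpoint sqrt_iter_bound n : R :=
  if n is n'.+1 then 2^-1 * (1 + sqrt_iter_bound n' ^+ 2) else 0.

Lemma sqrt_iter_bound_bound n : 0 <= sqrt_iter_bound n <= 1.
Proof.
elim: n => [|n /andP [h0 h1]] /=; first by rewrite lexx ler01.
have : sqrt_iter_bound n ^+ 2 <= 1 by rewrite expr_le1.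
have : 0 <= sqrt_iter_bound n ^+ 2 by rewrite exprn_ge0.
by move=> ? ?; apply/andP; split; lra.
Qed.

Lemma sqrt_iter_bound_nd : nondecreasing_seq sqrt_iter_bound.
Proof.
apply/nondecreasing_seqP => n /=.
have := sqr_ge0 (1 - sqrt_iter_bound n); rewrite !expr2 => h; lra.
Qed.

Hypothesis x1 : nrm x <= 1.

Lemma sqrt_iter_nrm n : nrm (sqrt_iter n) <= sqrt_iter_bound n.
Proof.
elim: n => [|n IH] /=; first by rewrite nrm0.
rewrite nrmZr gtr0_norm ?invr_gt0 // ler_wpM2l //.
apply: (le_trans (nrmD _ _)); apply: lerD => //.
by apply: (le_trans (nrmM _ _)); rewrite expr2 ler_pM ?nrm_ge0.
Qed.

Lemma sqrt_iter_inc n : nrm (sqrt_iter n - sqrt_iter n.+1) <= sqrt_iter_bound n.+1 - sqrt_iter_bound n.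
Proof.
elim: n => [|n IH].
  rewrite sub0r nrmN; apply: le_trans (sqrt_iter_nrm 1) _.
  by rewrite /= subr0.
rewrite {1}/sqrt_iter -/(sqrt_iter n.+1) -/(sqrt_iter n) -scalerBr nrmZr gtr0_norm ?invr_gt0 //.
(* This form of the difference of two squares holds without commutativity; the dominating sequence
   satisfies the same identity, so the estimates match term by term. *)
have -> : x + sqrt_iter n * sqrt_iter n - (x + sqrt_iter n.+1 * sqrt_iter n.+1) =
   sqrt_iter n * (sqrt_iter n - sqrt_iter n.+1) + (sqrt_iter n - sqrt_iter n.+1) * sqrt_iter n.+1.
  by ncring R B.
have -> : sqrt_iter_bound n.+2 - sqrt_iter_bound n.+1 = 2^-1 *
   (sqrt_iter_bound n * (sqrt_iter_bound n.+1 - sqrt_iter_bound n) + (sqrt_iter_bound n.+1 - sqrt_iter_bound n) * sqrt_iter_bound n.+1).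
  rewrite [sqrt_iter_bound n.+2]/= -/(sqrt_iter_bound n.+1).
  rewrite {2}[sqrt_iter_bound n.+1]/=; ring.
rewrite ler_wpM2l //; apply: (le_trans (nrmD _ _)); apply: lerD;
  apply: (le_trans (nrmM _ _)); rewrite ler_pM ?nrm_ge0 ?sqrt_iter_nrm //.
Qed.

Lemma sqrt_iter_clim : exists l, clim sqrt_iter l.
Proof.
apply: nrm_complete.
apply: (@increments_cauchy _ (fun m n => nrm (sqrt_iter m - sqrt_iter n)) sqrt_iter_bound 1).
- by move=> m n; rewrite nrmBC.
- by move=> m; rewrite subrr nrm0.
- by move=> m n p; have := nrmD (sqrt_iter m - sqrt_iter n) (sqrt_iter n - sqrt_iter p); rewrite addrA subrK.
- exact: sqrt_iter_bound_nd.
- by move=> n; case/andP: (sqrt_iter_bound_bound n).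
- exact: sqrt_iter_inc.
Qed.

Lemma sqrt_iter_sa n : selfadj x -> selfadj (sqrt_iter n).
Proof.
by move=> hx; elim: n => [|n IH] /=; [exact: star0 | apply/selfadjZ/selfadjD/selfadjM].
Qed.

Lemma sqrt_iter_comm n c : c * x = x * c -> c * sqrt_iter n = sqrt_iter n * c.
Proof.
move=> cx; elim: n => [|n IH] /=; first by rewrite mul0r mulr0.
by rewrite scalAr scalAl mulrDr mulrDl cx mulrA IH -mulrA IH mulrA.
Qed.

(** The iterates are real polynomials in x, so selfadjointness and commutation with the commutant of
    x survive in the limit. *)
Lemma sqrt_iter_lim : selfadj x -> exists l, [/\ selfadj l, (2%:C) *: l = x + l * l,
  nrm l <= 1 & forall c, c * x = x * c -> c * l = l * c].
Proof.
move=> hx; have [l ul] := sqrt_iter_clim; exists l.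
have l1 : nrm l <= 1.
  apply/ler_addgt0Pr => e e0; have [N /(_ _ (leqnn N)) NP] := ul _ e0.
  have := nrmD (l - sqrt_iter N) (sqrt_iter N); rewrite subrK nrmBC.
  have := sqrt_iter_nrm N; case/andP: (sqrt_iter_bound_bound N); lra.
split => //.
- apply/eqP; rewrite /selfadj -subr_eq0; apply/eqP; apply: (@clim_eq0 _ _ _ 2 ul) => n.
  have -> : star l - l = star (l - sqrt_iter n) - (l - sqrt_iter n).
    by rewrite starB (sqrt_iter_sa n hx) opprB addrA subrK.
  apply: (le_trans (nrmB _ _)); rewrite nrm_star nrmBC.
  have := nrm_ge0 (sqrt_iter n.+1 - l); lra.
- apply/eqP; rewrite -subr_eq0; apply/eqP; apply: (@clim_eq0 _ _ _ 2 ul) => n.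
  have -> : 2%:C *: l - (x + l * l) = 2%:C *: (l - sqrt_iter n.+1) +
     (sqrt_iter n * (sqrt_iter n - l) + (sqrt_iter n - l) * l).
    rewrite sqrt_iterS scalerBr scalerA -rmorphM divff ?pnatr_eq0 // scale1r.
    by ncring R B.
  apply: (le_trans (nrmD _ _)); rewrite nrmZr gtr0_norm ?ltr0n // nrmBC.
  have : nrm (sqrt_iter n * (sqrt_iter n - l) + (sqrt_iter n - l) * l) <= 2 * nrm (sqrt_iter n - l).
    have y1 : nrm (sqrt_iter n) <= 1.
      by apply: (le_trans (sqrt_iter_nrm n)); case/andP: (sqrt_iter_bound_bound n).
    have := nrmD (sqrt_iter n * (sqrt_iter n - l)) ((sqrt_iter n - l) * l).
    have := nrmM (sqrt_iter n) (sqrt_iter n - l); have := nrmM (sqrt_iter n - l) l.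
    have := ler_piMl (nrm_ge0 (sqrt_iter n - l)) y1.
    have := ler_piMr (nrm_ge0 (sqrt_iter n - l)) l1.
    lra.
  lra.
- move=> c cx; apply/eqP; rewrite -subr_eq0; apply/eqP.
  apply: (@clim_eq0 _ _ _ (2 * nrm c) ul) => n.
  have -> : c * l - l * c = (sqrt_iter n - l) * c - c * (sqrt_iter n - l).
    by rewrite mulrBr mulrBl (sqrt_iter_comm n cx); lmod R[i] B.
  apply: (le_trans (nrmB _ _)).
  have := nrmM (sqrt_iter n - l) c; have := nrmM c (sqrt_iter n - l).
  have := mulr_ge0 (nrm_ge0 c) (nrm_ge0 (sqrt_iter n.+1 - l)).
  have := nrm_ge0 (sqrt_iter n.+1 - l); lra.
Qed.

End Iteration.

(** For x = 1 - a the limit satisfies 2 l = x + l l, whence (1 - l)^2 = 1 - x = a. *)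
Lemma sqrt_near1 a : selfadj a -> nrm (1 - a) <= 1 ->
  exists e : B, [/\ selfadj e, e * e = a, nrm (1 - e) <= 1 &
    forall c, c * a = a * c -> c * e = e * c].
Proof.
move=> ha a1; have [l [hl lE l1 lc]] := sqrt_iter_lim a1 (selfadjB selfadj1 ha).
exists (1 - l); split.
- exact/selfadjB/hl/selfadj1.
- have -> : (1 - l) * (1 - l) = 1 - 2%:C *: l + l * l.
    by ncring R B.
  by rewrite lE; ncring R B.
- by rewrite subKr.
- move=> c ca; rewrite mulrBl mulrBr mul1r mulr1 lc //.
  by rewrite mulrBl mulrBr mul1r mulr1 ca.
Qed.
End SquareRoot.

Section Positivity.
Variables (R : realType) (B : cstarAlg R).
Implicit Types (a b c x y e k h p q : B) (r s t l : R).

Lemma star_i a : star ('i%C *: a) = - ('i%C *: star a).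
Proof.
rewrite starZ -scaleNr; congr (_ *: _).
by apply/eqP; rewrite eq_complex /= oppr0 !eqxx.
Qed.

(* w = e + ik satisfies w^*w = t.                                              *)
Lemma square_bound e k t : selfadj e -> selfadj k -> e * k = k * e -> 0 <= t ->
  e * e + k * k = t%:C *: (1 : B) -> nrm (e * e) <= t.
Proof.
move=> he hk ek t0 ekt; pose w : B := e + 'i%C *: k.
have sw : star w = e - 'i%C *: k by rewrite starD star_i he hk.
have w2 : nrm w ^+ 2 <= t.
  rewrite -nrm_starM sw (_ : _ * _ = t%:C *: (1 : B)).
    by rewrite nrmZr ger0_norm // ler_piMr // nrm1_le.
  have i2 : 'i%C * 'i%C = -1 :> R[i] by rewrite -expr2 sqr_i.
  by rewrite -ekt; ncexp; rewrite ek; lmod R[i] B; ring: i2.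
have ew : nrm e <= nrm w.
  have -> : e = (2^-1)%:C *: (w + star w).
    rewrite sw /w; transitivity ((2^-1 * 2)%:C *: e).
      by rewrite mulVf ?pnatr_eq0 // scale1r.
    by rewrite rmorphM; lmod R[i] B.
  rewrite nrmZr gtr0_norm ?invr_gt0 //.
  by have := nrmD w (star w); rewrite nrm_star; lra.
apply: le_trans (nrmM _ _) (le_trans _ w2).
by rewrite expr2 ler_pM ?nrm_ge0.
Qed.

(* For selfadjoint a this says that the spectrum is in [0, oo).                *)
Definition near_scalar a := selfadj a /\ exists t, 0 <= t /\ nrm (t%:C *: (1 : B) - a) <= t.

(** Here the norm description of positivity pays off: the bounds simply add, while a sum of elements
    b^*b is not visibly of that form. *)
Lemma near_scalarD a b : near_scalar a -> near_scalar b -> near_scalar (a + b).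
Proof.
move=> [ha [s [s0 sE]]] [hb [t [t0 ta]]]; split; first exact: selfadjD.
exists (s + t); split; first exact: addr_ge0.
have -> : (s + t)%:C *: (1 : B) - (a + b) = (s%:C *: (1 : B) - a) + (t%:C *: (1 : B) - b).
  by rewrite rmorphD; lmod R[i] B.
by apply: le_trans (nrmD _ _) _; apply: lerD.
Qed.

Lemma near_scalarZ r a : 0 <= r -> near_scalar a -> near_scalar (r%:C *: a).
Proof.
move=> r0 [ha [s [s0 sE]]]; split; first exact: selfadjZ.
exists (r * s); split; first exact: mulr_ge0.
have -> : (r * s)%:C *: (1 : B) - r%:C *: a = r%:C *: (s%:C *: (1 : B) - a).
  by rewrite rmorphM; lmod R[i] B.
by rewrite nrmZr ger0_norm // ler_wpM2l.
Qed.

(** Dividing by t moves a into the unit ball around 1, where [sqrt_near1] applies; t = 0 forces a =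
    0. *)
Lemma near_scalar_sqrt a : near_scalar a -> exists e, [/\ selfadj e, e * e = a, near_scalar e &
  forall c, c * a = a * c -> c * e = e * c].
Proof.
move=> [ha [t [t0 ta]]]; move: t0; rewrite le_eqVlt => /orP [/eqP t0|t0].
  exists 0; have a0 : a = 0.
    apply: nrm_eq0; apply/eqP; rewrite eq_le nrm_ge0 andbT.
    by move: ta; rewrite -t0 scale0r sub0r nrmN.
  split; rewrite ?mulr0 //; first exact: star0.
    by split; [exact: star0 | exists 0; rewrite scale0r subrr nrm0].
  by move=> c _; rewrite mulr0 mul0r.
have tn0 : t != 0 by rewrite gt_eqF.
have [|e [he ee e1 ec]] := @sqrt_near1 R B (t^-1%:C *: a) (selfadjZ _ ha).
  have -> : 1 - t^-1%:C *: a = t^-1%:C *: (t%:C *: (1 : B) - a).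
    by rewrite scalerBr scalerA -rmorphM mulVf // scale1r.
  by rewrite nrmZr gtr0_norm ?invr_gt0 // ler_pdivrMl // mulr1.
pose u := Num.sqrt t; have u0 : 0 <= u := sqrtr_ge0 t.
have uu : u * u = t by rewrite -expr2 sqr_sqrtr // ltW.
exists (u%:C *: e); split.
- exact: selfadjZ.
- by rewrite scalAl scalAr ee !scalerA -!rmorphM uu mulfV // scale1r.
- apply: near_scalarZ => //; split => //; exists 1; split; first exact: ler01.
  by rewrite scale1r.
- move=> c ca; rewrite scalAl scalAr ec //.
  by rewrite scalAl scalAr ca.
Qed.

Lemma near_scalar_cpos a : near_scalar a -> cpos a.
Proof. by move=> /near_scalar_sqrt [e [he ee _ _]]; exists e; rewrite he. Qed.

Lemma near_scalar_near t h : selfadj h -> nrm h <= t -> near_scalar (t%:C *: (1 : B) - h).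
Proof.
move=> hh ht; split; first exact/selfadjB/hh/selfadjZ/selfadj1.
by exists t; rewrite (le_trans (nrm_ge0 h) ht) subKr.
Qed.

(** The root d of t - k k commutes with k and d d + k k = t, so [square_bound] estimates d d, which
    is the element in question. *)
Lemma sq_near k t : selfadj k -> nrm (k * k) <= t -> nrm (t%:C *: (1 : B) - k * k) <= t.
Proof.
move=> hk kt; have hkk : selfadj (k * k) by apply: selfadjM.
have [d [hd dd _ dc]] := near_scalar_sqrt (near_scalar_near hkk kt).
rewrite -dd; apply: square_bound hd hk _ _ _.
- symmetry; apply: dc; rewrite mulrBr mulrBl mulrA; congr (_ - _).
  by rewrite scalAl scalAr mul1r mulr1.
- exact: le_trans (nrm_ge0 _) kt.
- by rewrite dd subrK.
Qed.

Lemma sq_near_scalar k : selfadj k -> near_scalar (k * k).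
Proof.
move=> hk; split; first exact: selfadjM.
by exists (nrm (k * k)); split; [exact: nrm_ge0 | exact: sq_near].
Qed.

(** The roots of a and of t - a commute and their squares add up to t, the situation of
    [square_bound]. *)
Lemma near_scalar_le a t : near_scalar a -> near_scalar (t%:C *: (1 : B) - a) -> 0 <= t -> nrm a <= t.
Proof.
move=> /near_scalar_sqrt [e [he ee _ ec]] /near_scalar_sqrt [k [hk kk _ kc]] t0.
rewrite -ee; apply: square_bound he hk _ t0 _; last by rewrite ee kk addrC subrK.
apply: kc; rewrite mulrBr mulrBl -ee mulrA; congr (_ - _).
by rewrite scalAl scalAr mul1r mulr1.
Qed.

(** * Neumann series and resolvents *)

Section Neumann.
Variables (x : B) (r : R).
Hypotheses (xr : nrm x <= r) (r1 : r < 1).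

Fixpoint neumann_sum n : B := if n is n'.+1 then 1 + x * neumann_sum n' else 0.
Lemma neumann_sumS n : neumann_sum n.+1 = 1 + x * neumann_sum n. Proof. by []. Qed.
Fixpoint geom_sum n : R := if n is n'.+1 then 1 + r * geom_sum n' else 0.

Let r0 : 0 <= r. Proof. exact: le_trans (nrm_ge0 _) xr. Qed.

Lemma geom_sum_ge0 n : 0 <= geom_sum n.
Proof. by elim: n => //= n IH; rewrite addr_ge0 ?ler01 // mulr_ge0. Qed.

Lemma geom_sum_nd n : geom_sum n <= geom_sum n.+1.
Proof.
elim: n => [|n IH]; first exact: geom_sum_ge0.
by rewrite /= lerD2l ler_wpM2l.
Qed.

Lemma geom_sum_ub n : geom_sum n <= (1 - r)^-1.
Proof.
have h : 0 < 1 - r by rewrite subr_gt0.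
rewrite -[leRHS]mul1r ler_pdivlMr //.
elim: n => [|n IH] /=; first by rewrite mul0r ler01.
have -> : (1 + r * geom_sum n) * (1 - r) = 1 - r + r * (geom_sum n * (1 - r)) by ring.
have := ler_wpM2l r0 IH; lra.
Qed.

Lemma neumann_sum_inc n : nrm (neumann_sum n - neumann_sum n.+1) <= geom_sum n.+1 - geom_sum n.
Proof.
elim: n => [|n IH].
  by rewrite /= !mulr0 !addr0 sub0r subr0 nrmN nrm1_le.
have -> : neumann_sum n.+1 - neumann_sum n.+2 = x * (neumann_sum n - neumann_sum n.+1).
  by rewrite [neumann_sum n.+2]neumann_sumS {1}[neumann_sum n.+1]neumann_sumS; ncring R B.
apply: le_trans (nrmM _ _) _.
have -> : geom_sum n.+2 - geom_sum n.+1 = r * (geom_sum n.+1 - geom_sum n) by rewrite /=; ring.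
by rewrite ler_pM ?nrm_ge0.
Qed.

Lemma neumann_sum_comm n : x * neumann_sum n = neumann_sum n * x.
Proof. by elim: n => [|n IH] /=; rewrite ?mulr0 ?mul0r // mulrDr mulrDl mulr1 mul1r IH mulrA -IH. Qed.

Lemma neumann : exists y, (1 - x) * y = 1 /\ y * (1 - x) = 1.
Proof.
have [|y yl] := @nrm_complete R B neumann_sum.
  apply: (@increments_cauchy _ (fun m n => nrm (neumann_sum m - neumann_sum n)) geom_sum (1 - r)^-1).
  - by move=> m n; rewrite nrmBC.
  - by move=> m; rewrite subrr nrm0.
  - by move=> m n p; have := nrmD (neumann_sum m - neumann_sum n) (neumann_sum n - neumann_sum p); rewrite addrA subrK.
  - by apply/nondecreasing_seqP => n; apply: geom_sum_nd.
  - exact: geom_sum_ub.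
  - exact: neumann_sum_inc.
have xy : x * y = y * x.
  apply/eqP; rewrite -subr_eq0; apply/eqP; apply: (@clim_eq0 _ _ _ _ _ (nrm x + nrm x) yl) => n.
  have -> : x * y - y * x = (neumann_sum n - y) * x - x * (neumann_sum n - y).
    by rewrite mulrBr mulrBl neumann_sum_comm; lmod R[i] B.
  apply: le_trans (nrmB _ _) _.
  have := nrmM (neumann_sum n - y) x; have := nrmM x (neumann_sum n - y).
  have := mulr_ge0 (nrm_ge0 x) (nrm_ge0 (neumann_sum n.+1 - y)); lra.
have y1 : (1 - x) * y = 1.
  apply/eqP; rewrite -subr_eq0; apply/eqP; apply: (@clim_eq0 _ _ _ _ _ 1 yl) => n.
  have -> : (1 - x) * y - 1 = x * (neumann_sum n - y) - (neumann_sum n.+1 - y).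
    by rewrite neumann_sumS; ncring R B.
  apply: le_trans (nrmB _ _) _.
  have := nrmM x (neumann_sum n - y); have := nrm_ge0 (neumann_sum n - y).
  move=> h0 h1; have : nrm x * nrm (neumann_sum n - y) <= nrm (neumann_sum n - y).
    by rewrite ler_piMl // (le_trans xr) // ltW.
  lra.
by exists y; split=> //; rewrite -[RHS]y1; ncexp; rewrite xy.
Qed.
End Neumann.

(** l + a is l + t times 1 - x with |x| <= t / (l + t) < 1, so the Neumann series inverts it. *)
Lemma near_scalar_inv a l : near_scalar a -> 0 < l ->
  exists q, (l%:C *: (1 : B) + a) * q = 1 /\ q * (l%:C *: (1 : B) + a) = 1.
Proof.
move=> [ha [t [t0 ta]]] l0; have lt0 : 0 < l + t by rewrite ltr_wpDr.
have ltn : l + t != 0 by rewrite gt_eqF.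
pose x : B := (l + t)^-1%:C *: (t%:C *: (1 : B) - a).
have xr : nrm x <= t / (l + t).
  by rewrite nrmZr gtr0_norm ?invr_gt0 // mulrC ler_wpM2r // invr_ge0 ltW.
have [|y [y1 y2]] := neumann xr; first by rewrite ltr_pdivrMr // mul1r ltrDr.
have E : l%:C *: (1 : B) + a = (l + t)%:C *: (1 - x).
  rewrite scalerBr scalerA -rmorphM mulfV // scale1r rmorphD.
  by lmod R[i] B.
exists ((l + t)^-1%:C *: y); rewrite E !scalAl !scalAr y1 y2 !scalerA.
by rewrite -!rmorphM mulfV // mulVf // scale1r.
Qed.

(* Otherwise l = |e^2| is in the spectrum of e^2.                              *)
Lemma spec_gap e : selfadj e ->
  (forall l, 0 < l -> exists q,
    (l%:C *: (1 : B) - e * e) * q = 1 /\ q * (l%:C *: (1 : B) - e * e) = 1) ->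
  e * e = 0.
Proof.
move=> he inv; apply: nrm_eq0; apply/eqP; rewrite eq_le nrm_ge0 andbT leNgt.
apply/negP => l0; set l := nrm (e * e) in l0.
have [q [gq qg]] := inv _ l0; pose g : B := l%:C *: (1 : B) - e * e.
rewrite -/g in gq qg.
have hee : selfadj (e * e) by apply: selfadjM.
have eg : e * g = g * e.
  by rewrite mulrBr mulrBl mulrA scalAl scalAr mul1r mulr1.
have gP : near_scalar g by apply: near_scalar_near.
have hg : selfadj g by case: gP.
have hq : selfadj q.
  have : star q * g = 1 by rewrite -{1}hg -starM gq star1.
  by move=> /(congr1 (fun z => z * q)); rewrite -mulrA gq mulr1 mul1r.
have inv_comm c : c * g = g * c -> c * q = q * c.
  by move=> cg; rewrite -[LHS]mul1r -{1}qg -!mulrA (mulrA g) -cg -!mulrA gq mulr1.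
(* As q inverts g, positivity of M - q makes M g - 1 the square of u d. So g is bounded below by 1 /
   M, and [square_bound] improves the bound l on e e to l - 1 / M. The summand 1 / l makes M
   positive and keeps l - 1 / M nonnegative. *)
pose M := nrm q + l^-1.
have M0 : 0 < M by rewrite ltr_wpDl ?nrm_ge0 ?invr_gt0.
have Mn : M != 0 by rewrite gt_eqF.
pose b : B := M%:C *: (1 : B) - q.
have bP : near_scalar b by apply: near_scalar_near => //; rewrite lerDl invr_ge0 ltW.
have [u [hu uu _ uc]] := near_scalar_sqrt gP; have [d [hd dd _ dc]] := near_scalar_sqrt bP.
have bcomm c : c * g = g * c -> c * b = b * c.
  by move=> /inv_comm cq; rewrite mulrBr mulrBl cq scalAl scalAr mul1r mulr1.
have ud : u * d = d * u by apply/dc/bcomm; rewrite -uu mulrA.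
have eu : e * u = u * e by apply: uc.
have ed : e * d = d * e by apply/dc/bcomm.
pose v := Num.sqrt M^-1; have v0 : 0 <= v := sqrtr_ge0 _.
have vv : v * v = M^-1 by rewrite -expr2 sqr_sqrtr // invr_ge0 ltW.
have kk : (u * d) * (u * d) = M%:C *: g - 1.
  rewrite {1}ud mulrA -(mulrA d) uu -mulrA (_ : g * d = d * g).
    by rewrite mulrA dd mulrBl qg scalAl mul1r.
  by rewrite -uu -mulrA ud mulrA ud mulrA.
have : l <= l - M^-1.
  apply: (@square_bound e (v%:C *: (u * d))) => //.
  - exact/selfadjZ/selfadjM.
  - by rewrite scalAl scalAr mulrA eu -mulrA ed mulrA.
  - rewrite subr_ge0 -[leRHS]invrK lef_pV2 ?posrE ?invr_gt0 //.
    by rewrite lerDr nrm_ge0.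
  rewrite scalAl scalAr scalerA -rmorphM vv kk scalerBr scalerA -rmorphM mulVf //.
  by rewrite rmorphB /g; lmod R[i] B.
have : 0 < M^-1 by rewrite invr_gt0.
lra.
Qed.

(* Kaplansky's argument: with h = b^*b, p = |h| - h and c = bp one has          *)
(* c^*c = - e^2, hence c c^* is positive; exchanging the factors in the         *)
(* resolvent, l - e^2 is invertible for all l > 0, so e = 0.                    *)
Lemma cpos_near_scalar a : cpos a -> near_scalar a.
Proof.
move=> [b ->]; set h := star b * b; have hh : selfadj h := selfadj_starM b.
have [m [hm mm mP mc]] := near_scalar_sqrt (sq_near_scalar hh).
have [u [hu uu _ uc]] := near_scalar_sqrt mP.
have hmC : h * m = m * h by apply: mc; rewrite mulrA.
have uh : h * u = u * h by apply: uc.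
have um : m * u = u * m by apply: uc.
(* Here m is |h|, so p is twice the negative part of h, to be shown to vanish. *)
pose p := m - h; have hp : selfadj p by apply: selfadjB.
have up : u * p = p * u by rewrite /p mulrBr mulrBl uh um.
pose c := b * p; pose e := u * p.
have he : selfadj e by apply: selfadjM.
have cc : star c * c = - (e * e).
  have -> : star c * c = p * h * p by rewrite /c starM hp /h !mulrA.
  have -> : e * e = p * m * p by rewrite /e {1}up -uu !mulrA.
  have hmp : (h + m) * p = 0.
    by rewrite /p mulrDl !mulrBr hmC mm addrC addrA subrK subrr.
  have aux x y z : (x + y) * z = 0 -> z * x * z = - (z * y * z).
    rewrite mulrDl => /eqP; rewrite addr_eq0 => /eqP xyz.
    by rewrite -mulrA xyz mulrN mulrA.
  exact: aux.
have cP2 : near_scalar (2%:C *: (c * star c)).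
  (* With c' for [star c], the squares of c + c' and of i (c - c') add up to 2 (c c' + c' c), and c'
     c = - e e. *)
  have -> : 2%:C *: (c * star c) = (c + star c) * (c + star c) +
     ('i%C *: (c - star c)) * ('i%C *: (c - star c)) + 2%:C *: (e * e).
    have -> : e * e = - (star c * c) by rewrite cc opprK.
    have i2 : 'i%C * 'i%C = -1 :> R[i] by rewrite -expr2 sqr_i.
    by ncring R B; ring: i2.
  apply: near_scalarD; first apply: near_scalarD.
  - by apply: sq_near_scalar; rewrite /selfadj starD starK addrC.
  - apply: sq_near_scalar; rewrite /selfadj star_i starB starK -scalerN opprB //.
  - by apply: near_scalarZ => //; apply: sq_near_scalar.
have cP1 : near_scalar (c * star c).
  have -> : c * star c = 2^-1%:C *: (2%:C *: (c * star c)).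
    by rewrite scalerA -rmorphM mulVf ?pnatr_eq0 // scale1r.
  by apply: near_scalarZ.
have e0 : e * e = 0.
  apply: spec_gap => // l l0; have [q [q1 q2]] := near_scalar_inv cP1 l0.
  have ln : l != 0 by rewrite gt_eqF.
  have -> : l%:C *: (1 : B) - e * e = l%:C *: (1 : B) + star c * c by rewrite cc.
  have E1 : c * star c * q = 1 - l%:C *: q.
    by rewrite -q1 mulrDl scalAl mul1r; lmod R[i] B.
  have E2 : q * (c * star c) = 1 - l%:C *: q.
    by rewrite -q2 mulrDr scalAr mulr1; lmod R[i] B.
  (* If q inverts l + c c', then (1 - c' q c) / l inverts l + c' c. *)
  exists (l^-1%:C *: (1 - star c * q * c)); rewrite scalAl scalAr.
  have -> : (l%:C *: (1 : B) + star c * c) * (1 - star c * q * c) =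
     l%:C *: (1 : B) + star c * c - l%:C *: (star c * q * c) -
     star c * (c * star c * q) * c.
    by ncring R B.
  have -> : (1 - star c * q * c) * (l%:C *: (1 : B) + star c * c) =
     l%:C *: (1 : B) + star c * c - l%:C *: (star c * q * c) -
     star c * (q * (c * star c)) * c.
    by ncring R B.
  rewrite E1 E2.
  have -> : l%:C *: (1 : B) + star c * c - l%:C *: (star c * q * c) -
     star c * (1 - l%:C *: q) * c = l%:C *: (1 : B) by ncring R B.
  by rewrite scalerA -rmorphM mulVf // scale1r.
have c0 : c = 0.
  apply: nrm_eq0; apply/eqP; rewrite -sqrf_eq0 -nrm_starM cc e0 oppr0.
  by rewrite nrm0.
have hp0 : h * p = 0 by rewrite /h -mulrA -/c c0 mulr0.
(* Since m m = h h, the relation h p = 0 gives m p = - h p = 0 as well. *)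
have pp0 : star p * p = 0.
  rewrite hp {1}/p mulrBl hp0 subr0 /p mulrBr mm -hmC -mulrBr -opprB mulrN.
  by rewrite -/p hp0 oppr0.
have p0 : p = 0.
  by apply: nrm_eq0; apply/eqP; rewrite -sqrf_eq0 -nrm_starM pp0 nrm0.
by rewrite -(subKr m h) -/p p0 subr0.
Qed.

Lemma cpos_selfadj a : cpos a -> selfadj a.
Proof. by move=> [b ->]; apply: selfadj_starM. Qed.

Lemma cpos0 : cpos (0 : B).
Proof. by exists 0; rewrite mulr0. Qed.

Lemma cposD a b : cpos a -> cpos b -> cpos (a + b).
Proof. by move=> /cpos_near_scalar ha /cpos_near_scalar hb; apply/near_scalar_cpos/near_scalarD. Qed.

Lemma cposZ r a : 0 <= r -> cpos a -> cpos (r%:C *: a).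
Proof. by move=> r0 /cpos_near_scalar ha; apply/near_scalar_cpos/near_scalarZ. Qed.

Lemma cpos_conj a b : cpos a -> cpos (star b * a * b).
Proof. by move=> [c ->]; exists (c * b); rewrite starM !mulrA. Qed.

Lemma cpos_near t h : selfadj h -> nrm h <= t -> cpos (t%:C *: (1 : B) - h).
Proof. by move=> hh ht; apply/near_scalar_cpos/near_scalar_near. Qed.

Lemma cle_nrm_scal a t : cpos a -> 0 <= t -> cle a (t%:C *: (1 : B)) -> nrm a <= t.
Proof. by move=> /cpos_near_scalar ha t0 /cpos_near_scalar hb; apply: near_scalar_le. Qed.

Lemma cle_trans b a c : cle a b -> cle b c -> cle a c.
Proof. by move=> h1 h2; have := cposD h2 h1; rewrite addrA subrK. Qed.

Lemma cle_nrm a b : cpos a -> cle a b -> nrm a <= nrm b.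
Proof.
move=> ha ab; apply: cle_nrm_scal (nrm_ge0 _) _ => //.
apply: (cle_trans ab); apply: cpos_near => //; apply: cpos_selfadj.
by have := cposD ab ha; rewrite subrK.
Qed.

End Positivity.

(** * Hilbert modules *)

(** Cauchy-Schwarz without vectors: X = <x, x>, Z = <z, z>, b = <z, x>, and the positive element
    assumed is the square of N x - z b. In this form it serves Hilbert modules and the possibly
    degenerate form of a kernel alike. *)
Lemma cauchy_schwarz_elt (R : realType) (B : cstarAlg R) (X Z b : B) (N : R) :
  0 < N -> selfadj Z -> nrm Z <= N ->
  cpos ((N * N)%:C *: X - (2 * N)%:C *: (star b * b) + star b * Z * b) ->
  cle (star b * b) (N%:C *: X).
Proof.
move=> N0 hZ ZN pos.
have := cposD pos (cpos_conj b (cpos_near hZ ZN)).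
have -> : (N * N)%:C *: X - (2 * N)%:C *: (star b * b) + star b * Z * b +
    star b * (N%:C *: (1 : B) - Z) * b = N%:C *: (N%:C *: X - star b * b).
  by rewrite !rmorphM; ncring R B.
have Ni : 0 <= N^-1 by rewrite invr_ge0 ltW.
move=> /(cposZ Ni); rewrite scalerA -rmorphM mulVf ?gt_eqF //.
by rewrite scale1r.
Qed.

Section Norm.
Variables (R : realType) (B : cstarAlg R) (E : hilbModType B).
Implicit Types (x y z : E) (b : B) (k : R[i]) (r : R).

Lemma ipNr x y : ip x (- y) = - ip x y.
Proof. by rewrite -scaleN1r ipZr scaleN1r. Qed.
Lemma ipBr x y z : ip x (y - z) = ip x y - ip x z.
Proof. by rewrite ipDr ipNr. Qed.
Lemma ip0r x : ip x (0 : E) = 0.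
Proof. by rewrite -(scale0r x) ipZr scale0r. Qed.
Lemma ipNl x y : ip (- x) y = - ip x y.
Proof. by rewrite -ip_star ipNr starN ip_star. Qed.
Lemma ipBl x y z : ip (x - y) z = ip x z - ip y z.
Proof. by rewrite ipDl ipNl. Qed.
Lemma ip0l x : ip (0 : E) x = 0.
Proof. by rewrite -ip_star ip0r star0. Qed.
Lemma ip_ractl x y b : ip (ract x b) y = star b * ip x y.
Proof. by rewrite -ip_star ip_ract starM ip_star. Qed.
Lemma ipZlr r x y : ip (r%:C *: x) y = r%:C *: ip x y.
Proof. by rewrite ipZl; congr (_ *: _); apply: conjc_real. Qed.
Lemma ip_sumr (I : Type) (s : seq I) (f : I -> E) x :
  ip x (\sum_(i <- s) f i) = \sum_(i <- s) ip x (f i).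
Proof.
by elim: s => [|i s IH]; rewrite ?big_nil ?ip0r // !big_cons ipDr IH.
Qed.
Lemma ip_suml (I : Type) (s : seq I) (f : I -> E) x :
  ip (\sum_(i <- s) f i) x = \sum_(i <- s) ip (f i) x.
Proof.
by elim: s => [|i s IH]; rewrite ?big_nil ?ip0l // !big_cons ipDl IH.
Qed.

Definition hn x : R := Num.sqrt (nrm (ip x x)).

Lemma hn_ge0 x : 0 <= hn x. Proof. exact: sqrtr_ge0. Qed.
Lemma hn_sqr x : hn x ^+ 2 = nrm (ip x x).
Proof. by rewrite sqr_sqrtr // nrm_ge0. Qed.

Lemma hnormE x : hnorm x = (hn x)%:C.
Proof.
have h0 : 0 <= (hn x)%:C by rewrite lecR hn_ge0.
by rewrite /hnorm normE -hn_sqr rmorphXn /= sqrCK.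
Qed.

Lemma cauchy_schwarz_cle x z r : 0 < r -> hn z ^+ 2 <= r ->
  cle (ip x z * ip z x) (r%:C *: ip x x).
Proof.
move=> r0 zr; rewrite -(ip_star z x).
apply: (@cauchy_schwarz_elt _ _ _ (ip z z)) => //.
- exact: ip_star.
- by rewrite -hn_sqr.
have := ip_pos (r%:C *: x - ract z (ip z x)).
rewrite ipBl !ipBr ipZlr ipZr ipZlr ipZr !ip_ract !ip_ractl !ip_star.
set X := ip x x; set Z := ip z z; set b := ip z x; set b' := ip x z => h.
suff -> : (r * r)%:C *: X - (2 * r)%:C *: (b' * b) + b' * Z * b =
  r%:C *: (r%:C *: X) - r%:C *: (b' * b) - (r%:C *: (b' * b) - b' * Z * b).
  exact: h.
by rewrite !rmorphM; lmod R[i] B.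
Qed.

(** The order version asks for r > 0, so r exceeds |x|^2 by an arbitrarily small amount. *)
Lemma cauchy_schwarz x y : nrm (ip x y) <= hn x * hn y.
Proof.
have H r : 0 < r -> hn x ^+ 2 <= r -> nrm (ip x y) ^+ 2 <= r * hn y ^+ 2.
  move=> r0 xr; rewrite -nrm_starM ip_star hn_sqr -{1}(gtr0_norm r0) -nrmZr.
  apply: cle_nrm; last exact: cauchy_schwarz_cle.
  by exists (ip x y); rewrite ip_star.
have H2 : nrm (ip x y) ^+ 2 <= (hn x * hn y) ^+ 2.
  apply/ler_addgt0Pr => e e0.
  have y0 : 0 < hn y ^+ 2 + 1 by rewrite ltr_wpDl // exprn_ge0 // hn_ge0.
  have d0 : 0 < e / (hn y ^+ 2 + 1) by rewrite divr_gt0.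
  have x0 : 0 <= hn x ^+ 2 by rewrite exprn_ge0 // hn_ge0.
  apply: le_trans (H (hn x ^+ 2 + e / (hn y ^+ 2 + 1)) _ _) _.
  - by rewrite ltr_wpDl.
  - by rewrite lerDl ltW.
  rewrite mulrDl -exprMn lerD2l mulrAC ler_pdivrMr // ler_pM2l //.
  by rewrite lerDl.
by rewrite -(ler_pXn2r (ltn0Sn 1)) ?nnegrE ?mulr_ge0 ?hn_ge0 ?nrm_ge0.
Qed.

Lemma hnD x y : hn (x + y) <= hn x + hn y.
Proof.
rewrite -(ler_pXn2r (ltn0Sn 1)) ?nnegrE ?addr_ge0 ?hn_ge0 // hn_sqr.
rewrite ipDl !ipDr; have h1 := cauchy_schwarz x y; have h2 := cauchy_schwarz y x.
apply: le_trans (nrmD _ _) _.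
have := nrmD (ip x x) (ip x y); have := nrmD (ip y x) (ip y y).
have := hn_sqr x; have := hn_sqr y; rewrite !expr2; lra.
Qed.

Lemma hnZ k x : hn (k *: x) = complex.Re `|k| * hn x.
Proof.
have h : 0 <= complex.Re `|k| by rewrite normc_def sqrtr_ge0.
rewrite /hn ipZl ipZr !nrmZ mulrA norm_conjC -expr2.
by rewrite sqrtrM ?sqr_ge0 // sqrtr_sqr ger0_norm.
Qed.
Lemma hnZr r x : hn (r%:C *: x) = `|r| * hn x.
Proof. by rewrite hnZ normc_def /= expr0n addr0 sqrtr_sqr. Qed.
Lemma hn0 : hn 0 = 0.
Proof. by rewrite /hn ip0r nrm0 sqrtr0. Qed.
Lemma hnN x : hn (- x) = hn x.
Proof. by rewrite /hn ipNl ipNr opprK. Qed.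
Lemma hnBC x y : hn (x - y) = hn (y - x).
Proof. by rewrite -hnN opprB. Qed.
Lemma hnB x y : hn (x - y) <= hn x + hn y.
Proof. by rewrite -(hnN y) hnD. Qed.
Lemma hn_tri y x z : hn (x - z) <= hn (x - y) + hn (y - z).
Proof. by have := hnD (x - y) (y - z); rewrite addrA subrK. Qed.
Lemma hn_eq0 x : hn x <= 0 -> x = 0.
Proof.
move=> h; apply: (@ip_eq0 _ B); apply: nrm_eq0; rewrite -hn_sqr.
by apply/eqP; rewrite sqrf_eq0 eq_le h hn_ge0.
Qed.
Lemma hn_ract x b : hn (ract x b) <= hn x * nrm b.
Proof.
rewrite -(ler_pXn2r (ltn0Sn 1)) ?nnegrE ?mulr_ge0 ?nrm_ge0 ?hn_ge0 //.
rewrite hn_sqr ip_ract ip_ractl exprMn hn_sqr.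
apply: le_trans (nrmM _ _) _.
have := ler_wpM2r (nrm_ge0 b) (nrmM (star b) (ip x x)); rewrite nrm_star.
by rewrite (mulrC (nrm b)) -mulrA -expr2.
Qed.
Lemma hn_ext x : (forall e : R, 0 < e -> hn x <= e) -> x = 0.
Proof.
by move=> h; apply: hn_eq0; apply/ler_addgt0Pr => e /h; rewrite add0r.
Qed.

Definition hlim (u : nat -> E) (l : E) :=
  forall e : R, 0 < e -> exists N, forall n, (N <= n)%N -> hn (u n - l) < e.

Lemma hn_complete (u : nat -> E) :
  (forall e : R, 0 < e -> exists N, forall m n,
     (N <= m)%N -> (N <= n)%N -> hn (u m - u n) < e) ->
  exists l, hlim u l.
Proof.
move=> uC; have [e e0|l lP] := @hilb_complete R B E u.
  have [Ie re] : complex.Im e = 0 /\ 0 < complex.Re e.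
    by move: e0; rewrite ltcE /= => /andP [/eqP -> ->].
  have [N NP] := uC _ re; exists N => m n mN nN.
  rewrite hnormE ltcE /= Ie eqxx /=; exact: NP.
exists l => e e0; have [|N NP] := lP e%:C; first by rewrite ltcR.
by exists N => n nN; have := NP n nN; rewrite hnormE ltcR.
Qed.

End Norm.

Lemma reg_hn (R : realType) (B : cstarAlg R) (b : regular B) : hn b = nrm (b : B).
Proof. by apply: complexI; rewrite -hnormE reg_hnorm normE. Qed.

Section AdjopLinear.
Variables (R : realType) (B : cstarAlg R) (E F : hilbModType B) (a : adjop E F).

Lemma opD x y : a (x + y) = a x + a y.
Proof. by apply: ip_inj => z; rewrite ipDr -!op_adjP' ipDr. Qed.
Lemma opZ (k : R[i]) x : a (k *: x) = k *: a x.
Proof. by apply: ip_inj => z; rewrite ipZr -!op_adjP' ipZr. Qed.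
Lemma op_ract x b : a (ract x b) = ract (a x) b.
Proof. by apply: ip_inj => z; rewrite ip_ract -!op_adjP' ip_ract. Qed.
Lemma op0 : a 0 = 0.
Proof. by rewrite -(scale0r 0) opZ scale0r. Qed.
Lemma opN x : a (- x) = - a x.
Proof. by rewrite -scaleN1r opZ scaleN1r. Qed.
Lemma opB x y : a (x - y) = a x - a y.
Proof. by rewrite opD opN. Qed.
Lemma op_sum (I : Type) (s : seq I) (f : I -> E) :
  a (\sum_(i <- s) f i) = \sum_(i <- s) a (f i).
Proof. by elim: s => [|i s IH]; rewrite ?big_nil ?op0 // !big_cons opD IH. Qed.
End AdjopLinear.

(** * Automatic boundedness of adjointable operators *)

Section Boundedness.
Variables (R : realType) (B : cstarAlg R) (E F : hilbModType B) (a : adjop E F).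

(* Gliding hump: if a were unbounded, a^* would be undefined at the limit of a *)
(* series of small multiples of suitable vectors a x_n.                        *)
Lemma adjop_bounded : exists C : R, 0 <= C /\ forall x, hn (a x) <= C * hn x.
Proof.
apply: contrapT => unb.
have /choice [x xP] : forall n : nat, exists x, hn x <= 1 /\ n%:R * 4 ^+ n < hn (a x).
  move=> n; apply: contrapT => nx; apply: unb.
  have c0 : 0 <= n%:R * 4 ^+ n :> R by rewrite mulr_ge0 // exprn_ge0.
  exists (n%:R * 4 ^+ n); split => // z.
  have [hz|hz] := eqVneq (hn z) 0.
    by rewrite (hn_eq0 (x := z)) ?hz // op0 !hn0 mulr0.
  have z0 : 0 < hn z by rewrite lt_neqAle eq_sym hz hn_ge0.
  rewrite leNgt; apply/negP => lt; apply: nx; exists ((hn z)^-1%:C *: z).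
  rewrite opZ !hnZr gtr0_norm ?invr_gt0 // mulVf //; split => //.
  by rewrite [ltRHS]mulrC ltr_pdivlMr.
pose z n : F := ((hn (a (x n)))^-1 * 4^-1 ^+ n)%:C *: a (x n).
(* The two candidates differ by 2 z_n, so at least one has an inner product with a x_n of norm at
   least |a x_n| |z_n|. *)
pose step n y := if hn (a (x n)) * 4^-1 ^+ n <= nrm (ip (a (x n)) (y + z n))
  then y + z n else y - z n.
pose y := fix y n := if n is n'.+1 then step n (y n') else 0.
have axgt0 n : 0 < hn (a (x n)).
  by apply: le_lt_trans (xP n).2; rewrite mulr_ge0 // exprn_ge0.
have zn n : hn (z n) = 4^-1 ^+ n.
  rewrite hnZr ger0_norm; last by rewrite mulr_ge0 ?exprn_ge0 // invr_ge0 ltW.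
  by rewrite mulrAC mulVf ?mul1r // gt_eqF.
have yz n : nrm (ip (a (x n.+1)) (y n.+1)) >= hn (a (x n.+1)) * 4^-1 ^+ n.+1.
  rewrite /= /step; case: ifPn => // ; rewrite -ltNge => lt.
  have : nrm (ip (a (x n.+1)) (2%:C *: z n.+1)) <=
     nrm (ip (a (x n.+1)) (y n + z n.+1)) + nrm (ip (a (x n.+1)) (y n - z n.+1)).
    have -> : 2%:C *: z n.+1 = (y n + z n.+1) - (y n - z n.+1) by lmod R[i] F.
    by rewrite ipBr nrmB.
  have -> : nrm (ip (a (x n.+1)) (2%:C *: z n.+1)) = 2 * (hn (a (x n.+1)) * 4^-1 ^+ n.+1).
    rewrite !ipZr !nrmZr gtr0_norm // -hn_sqr; congr (_ * _).
    rewrite ger0_norm; last by rewrite mulr_ge0 ?exprn_ge0 // invr_ge0 ltW.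
    by rewrite mulrAC expr2 mulrA mulVf ?mul1r // gt_eqF.
  lra.
(* The sum of 4^-k for k = 1, ..., n. All steps after the n-th move y_n by at most 4^-n / 3, a third
   of the size of the n-th step. *)
pose f n : R := (1 - 4^-1 ^+ n) / 3.
have yinc n : hn (y n - y n.+1) <= f n.+1 - f n.
  have -> : f n.+1 - f n = 4^-1 ^+ n.+1 by rewrite /f exprS; field.
  rewrite -zn /= /step; case: ifP => _.
    by rewrite opprD addrA subrr sub0r hnN.
  by rewrite opprB addrC subrK.
have f_nd : nondecreasing_seq f.
  by apply/nondecreasing_seqP => n; rewrite -subr_ge0 (le_trans _ (yinc n)) ?hn_ge0.
have f_le n : f n <= 3^-1.
  rewrite /f ler_pdivrMr // mulVf ?pnatr_eq0 // gerBl exprn_ge0 //.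
have [|l yl] := @hn_complete R B F y.
  apply: (@increments_cauchy _ (fun m n => hn (y m - y n)) f 3^-1) => //.
  - by move=> m n; rewrite hnBC.
  - by move=> m; rewrite subrr hn0.
  - by move=> m n p; apply: hn_tri.
have ydist n k : hn (y n - y (n + k)%N) <= f (n + k)%N - f n.
  elim: k => [|k IH]; first by rewrite addn0 !subrr hn0.
  rewrite addnS; apply: le_trans (hn_tri (y (n + k)%N) _ _) _.
  by have := yinc (n + k)%N; lra.
have ldist n : hn (y n - l) <= 4^-1 ^+ n / 3.
  apply/ler_addgt0Pr => e e0; have [N NP] := yl e e0.
  apply: le_trans (hn_tri (y (n + N)%N) _ _) _.
  have := NP _ (leq_addl n N); have := ydist n N; have := f_le (n + N)%N.
  by rewrite /f; lra.
(* Two thirds of the lower bound at step n + 1 survive in the limit l, and that bound exceeds n + 1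
   by the choice of x. *)
have key n : 2 * n.+1%:R <= 3 * hn (op_adj a l).
  have h1 : nrm (ip (a (x n.+1)) l) <= hn (op_adj a l).
    rewrite op_adjP; apply: le_trans (cauchy_schwarz _ _) _.
    by rewrite ler_piMl ?hn_ge0 // (xP _).1.
  have h2 : nrm (ip (a (x n.+1)) (y n.+1 - l)) <= hn (a (x n.+1)) * (4^-1 ^+ n.+1 / 3).
    apply: le_trans (cauchy_schwarz _ _) _.
    by rewrite ler_wpM2l ?hn_ge0.
  have h3 := nrmD (ip (a (x n.+1)) (y n.+1 - l)) (ip (a (x n.+1)) l).
  rewrite -ipDr subrK in h3.
  have h4 : n.+1%:R < hn (a (x n.+1)) * 4^-1 ^+ n.+1.
    rewrite exprVn ltr_pdivlMr ?exprn_gt0 //; exact: (xP n.+1).2.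
  have := yz n; lra.
have := archi_boundP (mulr_ge0 (ler0n R 3) (hn_ge0 (op_adj a l))).
have := key (Num.bound (3 * hn (op_adj a l))).
set m := Num.bound _; rewrite -natr1; have := ler0n R m; lra.
Qed.
End Boundedness.

Lemma adj_bound (R : realType) (B : cstarAlg R) (E F : hilbModType B)
    (a : adjop E F) (C : R) : 0 <= C -> (forall x, hn (a x) <= C * hn x) ->
  forall y, hn (op_adj a y) <= C * hn y.
Proof.
move=> C0 aC y; have [->|ny] := eqVneq (hn (op_adj a y)) 0.
  by rewrite mulr_ge0 ?hn_ge0.
have y0 : 0 < hn (op_adj a y) by rewrite lt_neqAle eq_sym ny hn_ge0.
rewrite -(ler_pM2r y0) -expr2 hn_sqr -op_adjP.
apply: le_trans (cauchy_schwarz _ _) _.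
by rewrite mulrAC ler_wpM2r ?hn_ge0.
Qed.

(** * Total families and extension of maps from them *)

Section Combinations.
Variables (R : realType) (B : cstarAlg R).
Implicit Types E F G : hilbModType B.

(** Lists of coefficients and indices make concatenation the addition of linear combinations. *)
Definition comb (I : Type) E (v : I -> E) (L : seq (R[i] * I)) : E :=
  \sum_(p <- L) p.1 *: v p.2.

Definition scale_comb (I : Type) (k : R[i]) (L : seq (R[i] * I)) :=
  [seq (k * p.1, p.2) | p <- L].

Lemma comb_nil (I : Type) E (v : I -> E) : comb v [::] = 0.
Proof. by rewrite /comb big_nil. Qed.
Lemma comb_cons (I : Type) E (v : I -> E) p L :
  comb v (p :: L) = p.1 *: v p.2 + comb v L.
Proof. by rewrite /comb big_cons. Qed.
Lemma comb_cat (I : Type) E (v : I -> E) L M :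
  comb v (L ++ M) = comb v L + comb v M.
Proof. by rewrite /comb big_cat. Qed.
Lemma comb_scale (I : Type) E (v : I -> E) k L :
  comb v (scale_comb k L) = k *: comb v L.
Proof.
rewrite /comb /scale_comb big_map scaler_sumr.
by apply: eq_bigr => p _ /=; rewrite scalerA.
Qed.
Lemma comb1 (I : Type) E (v : I -> E) i : comb v [:: (1, i)] = v i.
Proof. by rewrite /comb big_seq1 scale1r. Qed.
Lemma comb_map (I J : Type) E (v : J -> E) (h : I -> J) L :
  comb v [seq (p.1, h p.2) | p <- L] = comb (v \o h) L.
Proof. by rewrite /comb big_map. Qed.

Lemma comb_ipr (I : Type) E (v : I -> E) L x :
  ip x (comb v L) = \sum_(p <- L) p.1 *: ip x (v p.2).
Proof. by rewrite ip_sumr; apply: eq_bigr => p _; rewrite ipZr. Qed.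

Lemma ip_comb_eq (I J : Type) E F (v : I -> E) (w : I -> F) (v' : J -> F) (w' : J -> E)
  L M : (forall i j, ip (w i) (v' j) = ip (v i) (w' j)) ->
  ip (comb w L) (comb v' M) = ip (comb v L) (comb w' M).
Proof.
move=> h; rewrite !comb_ipr; apply: eq_bigr => q _; congr (_ *: _).
rewrite !ip_suml; apply: eq_bigr => p _.
by rewrite !ipZl h.
Qed.

Definition dense (I : Type) E (v : I -> E) :=
  forall (x : E) (e : R), 0 < e -> exists L, hn (x - comb v L) < e.

Lemma total_dense (I : Type) E (v : I -> E) (A : set E) :
  total A -> (forall x, A x -> exists i, x = v i) -> dense v.
Proof.
move=> tA Av x e e0; have [|n [c [a [Aa]]]] := tA x e%:C; first by rewrite ltcR.
rewrite hnormE ltcR => xe; have /choice [f fP] : forall i, exists j, a i = v j.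
  by move=> i; apply: Av.
exists [seq (c i, f i) | i <- index_enum 'I_n]; rewrite /comb big_map.
by under eq_bigr do rewrite /= -fP.
Qed.

Lemma dense_total (I : Type) E (v : I -> E) (A : set E) :
  dense v -> (forall i, A (v i)) -> total A.
Proof.
move=> dv Av x e e0.
have [Ie re] : complex.Im e = 0 /\ 0 < complex.Re e.
  by move: e0; rewrite ltcE /= => /andP [/eqP -> ->].
have [L LP] := dv x _ re.
exists (size L), (fun i => (tnth (in_tuple L) i).1), (fun i => v (tnth (in_tuple L) i).2).
split => //; rewrite hnormE ltcE /= Ie eqxx /=; congr (hn (x - _) < _): LP.
by rewrite /comb (big_tnth _ _ L).
Qed.

Lemma dense_trans (I J : Type) E (v : I -> E) (w : J -> E) : dense v ->
  (forall i (e : R), 0 < e -> exists L, hn (v i - comb w L) < e) -> dense w.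
Proof.
move=> dv vw.
have cw L (e : R) : 0 < e -> exists M, hn (comb v L - comb w M) < e.
  elim: L e => [|[c i] L IH] e e0.
    by exists [::]; rewrite !comb_nil subrr hn0.
  have e2 : 0 < e / 2 by rewrite divr_gt0.
  have [M MP] := IH _ e2.
  pose d := e / 2 / (complex.Re `|c| + 1).
  have c1 : 0 < complex.Re `|c| + 1.
    by rewrite ltr_wpDl // normc_def sqrtr_ge0.
  have [N NP] := vw i d (divr_gt0 e2 c1).
  exists (scale_comb c N ++ M); rewrite comb_cons comb_cat comb_scale /=.
  have -> : c *: v i + comb v L - (c *: comb w N + comb w M) =
     c *: (v i - comb w N) + (comb v L - comb w M) by lmod R[i] E.
  apply: le_lt_trans (hnD _ _) _; rewrite hnZ.
  have : complex.Re `|c| * hn (v i - comb w N) <= e / 2.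
    have h : (complex.Re `|c| + 1) * hn (v i - comb w N) <= e / 2.
      by rewrite mulrC -ler_pdivlMr // ltW.
    by have := hn_ge0 (v i - comb w N); lra.
  lra.
move=> x e e0; have e2 : 0 < e / 2 by rewrite divr_gt0.
have [L LP] := dv x _ e2; have [M MP] := cw L _ e2.
exists M; apply: le_lt_trans (hn_tri (comb v L) _ _) _; lra.
Qed.

(** The difference z is orthogonal to every combination c, so |z|^2 = |<z - c, z>| <= |z - c|
    |z|. *)
Lemma dense_ip_eq (I : Type) E (v : I -> E) x y : dense v ->
  (forall i, ip (v i) x = ip (v i) y) -> x = y.
Proof.
move=> dv xy; apply/eqP; rewrite -subr_eq0; apply/eqP; apply: hn_ext => e e0.
have [L /ltW LP] := dv (x - y) e e0; apply: le_trans LP.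
have [->|nz] := eqVneq (hn (x - y)) 0; first exact: hn_ge0.
have z0 : 0 < hn (x - y) by rewrite lt_neqAle eq_sym nz hn_ge0.
rewrite -(ler_pM2r z0) -expr2 hn_sqr.
have c0 : ip (comb v L) (x - y) = 0.
  rewrite /comb ip_suml big1 // => p _.
  by rewrite ipZl ipBr xy subrr scaler0.
rewrite -[ip _ _]subr0 -c0 -(ipBl (x - y) (comb v L)).
exact: cauchy_schwarz.
Qed.

(** Agreement on a total family determines the adjoints by [dense_ip_eq], and these determine the
    operators. *)
Lemma adjop_eq_dense (I : Type) E F (v : I -> E) (a b : adjop E F) : dense v ->
  (forall i, a (v i) = b (v i)) -> a = b.
Proof.
move=> dv ab.
have h y : op_adj a y = op_adj b y.
  by apply: (dense_ip_eq dv) => i; rewrite -!op_adjP ab.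
apply/adjop_eq/funext => x; apply: ip_inj => z.
by rewrite -!op_adjP' h.
Qed.

Record blin E F (f : E -> F) : Prop := {
  blD : forall x y, f (x + y) = f x + f y;
  blZ : forall (k : R[i]) x, f (k *: x) = k *: f x;
  bl_bound : exists C : R, 0 <= C /\ forall x, hn (f x) <= C * hn x
}.

(** Regarding B as a module over itself makes inner products bounded linear maps between modules, so
    that [blin_eq_dense] extends identities between them. *)
Lemma blin_ip E (z : E) : blin (fun y : E => ip z y : regular B).
Proof.
split => [y y'|k y|]; [exact: ipDr | exact: ipZr |].
exists (hn z); split; first exact: hn_ge0.
by move=> y; rewrite reg_hn; apply: cauchy_schwarz.
Qed.

Lemma adjop_blin E F (a : adjop E F) : blin a.
Proof. by split; [exact: opD | exact: opZ | exact: adjop_bounded]. Qed.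

Lemma bl_comb (I : Type) E F (f : E -> F) (v : I -> E) L : blin f ->
  f (comb v L) = comb (f \o v) L.
Proof.
move=> hf; elim: L => [|p L IH].
  by rewrite !comb_nil -(scale0r 0) (blZ hf) scale0r.
by rewrite !comb_cons (blD hf) (blZ hf) IH.
Qed.

Lemma bl0 E F (f : E -> F) : blin f -> f 0 = 0.
Proof. by move=> hf; rewrite -(scale0r 0) (blZ hf) scale0r. Qed.

Lemma blB E F (f : E -> F) : blin f -> forall x y, f (x - y) = f x - f y.
Proof.
by move=> hf x y; rewrite (blD hf) -scaleN1r (blZ hf) scaleN1r.
Qed.

Lemma blin_comp E F G (g : F -> G) (f : E -> F) : blin g -> blin f -> blin (g \o f).
Proof.
move=> hg hf; split => [x y|k x|] /=.
- by rewrite (blD hf) (blD hg).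
- by rewrite (blZ hf) (blZ hg).
have [C [C0 CP]] := bl_bound hg; have [D [D0 DP]] := bl_bound hf.
exists (C * D); split; first exact: mulr_ge0.
by move=> x; apply: le_trans (CP _) _; rewrite -mulrA ler_wpM2l.
Qed.

Lemma blin_eq_dense (I : Type) E F (v : I -> E) (f g : E -> F) : dense v ->
  blin f -> blin g -> (forall i, f (v i) = g (v i)) -> f =1 g.
Proof.
move=> dv hf hg fg x; apply/eqP; rewrite -subr_eq0; apply/eqP.
have [C [C0 CP]] := bl_bound hf; have [D [D0 DP]] := bl_bound hg.
apply: hn_ext => e e0; have CD : 0 < C + D + 1 by rewrite ltr_wpDl ?addr_ge0.
have [L LP] := dv x _ (divr_gt0 e0 CD).
have -> : f x - g x = f (x - comb v L) - g (x - comb v L).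
  rewrite (blB hf) (blB hg) (bl_comb _ _ hf) (bl_comb _ _ hg).
  have -> : f \o v = g \o v by apply/funext.
  by lmod R[i] F.
apply: le_trans (hnB _ _) _.
have := CP (x - comb v L); have := DP (x - comb v L).
have : (C + D + 1) * hn (x - comb v L) <= e.
  by rewrite mulrC -ler_pdivlMr // ltW.
have := hn_ge0 (x - comb v L); lra.
Qed.

(** The bound on combinations also makes the assignment well defined, since v may satisfy linear
    relations. *)
Lemma blin_extend (I : Type) E F (v : I -> E) (w : I -> F) (C : R) :
  dense v -> 0 <= C -> (forall L, hn (comb w L) <= C * hn (comb v L)) ->
  exists f : E -> F, [/\ blin f, forall i, f (v i) = w i &
    forall x, hn (f x) <= C * hn x].
Proof.
move=> dv C0 CP.
(* The closure of the graph: total by completeness, single-valued because [rel_bound] applies to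
   differences. *)
pose rel x y := forall e : R, 0 < e ->
  exists L, hn (x - comb v L) < e /\ hn (y - comb w L) < e.
have combB J G (u : J -> G) L M : comb u L - comb u M = comb u (L ++ scale_comb (-1) M).
  by rewrite comb_cat comb_scale scaleN1r.
have /choice [f fP] x : exists y, rel x y.
  have pos n : 0 < n.+1%:R^-1 :> R by rewrite invr_gt0.
  have /choice [L LP] n := dv x _ (pos n).
  have small (e : R) : 0 < e -> exists N, forall n, (N <= n)%N -> n.+1%:R^-1 < e.
    move=> e0; have ei : 0 <= e^-1 by rewrite invr_ge0 ltW.
    exists (Num.bound e^-1) => n Nn; rewrite -[ltRHS]invrK ltf_pV2 ?posrE ?invr_gt0 //.
    by apply: lt_le_trans (archi_boundP ei) _; rewrite ler_nat leqW.
  have [|y yP] := @hn_complete R B F (fun n => comb w (L n)).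
    move=> e e0; have C1 : 0 < 2 * (C + 1) by rewrite mulr_gt0 // ltr_wpDl.
    have [N NP] := small _ (divr_gt0 e0 C1); exists N => m n Nm Nn.
    rewrite combB; apply: le_lt_trans (CP _) _; rewrite -combB.
    have : hn (comb v (L m) - comb v (L n)) < e / (2 * (C + 1)) + e / (2 * (C + 1)).
      apply: le_lt_trans (hn_tri x _ _) _; rewrite hnBC.
      by apply: ltrD; apply: lt_trans (LP _) (NP _ _).
    rewrite [ltRHS](_ : _ = e / (C + 1)); last by field; rewrite gt_eqF // ltr_wpDl.
    rewrite ltr_pdivlMr ?ltr_wpDl //.
    have := hn_ge0 (comb v (L m) - comb v (L n)); set d := hn _ => d0 h.
    have [->|dn] := eqVneq d 0; first by rewrite mulr0.
    have : 0 < d by rewrite lt_neqAle eq_sym dn d0.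
    lra.
  exists y => e e0; have [N NP] := small _ e0; have [M MP] := yP _ e0.
  exists (L (maxn N M)); split; first exact: lt_trans (LP _) (NP _ (leq_maxl _ _)).
  by rewrite hnBC; apply: MP; rewrite leq_maxr.
have rel_bound x y : rel x y -> hn y <= C * hn x.
  move=> xy; apply/ler_addgt0Pr => e e0.
  have C1 : 0 < C + 1 by rewrite ltr_wpDl.
  have [L [/ltW L1 /ltW L2]] := xy _ (divr_gt0 e0 C1); move: L1 L2.
  have : e / (C + 1) * (C + 1) = e by rewrite divfK // gt_eqF.
  set d := e / (C + 1) => dE L1 L2; have := ler_wpM2l C0 L1; move: dE L1 L2.
  have := CP L; have := hnD (y - comb w L) (comb w L); rewrite subrK.
  have := ler_wpM2l C0 (hnB x (x - comb v L)); rewrite subKr.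
  lra.
have relD x y x' y' : rel x y -> rel x' y' -> rel (x + x') (y + y').
  move=> h h' e e0; have e2 : 0 < e / 2 by rewrite divr_gt0.
  have [L [L1 L2]] := h _ e2; have [M [M1 M2]] := h' _ e2.
  exists (L ++ M); rewrite !comb_cat; split.
    have -> : x + x' - (comb v L + comb v M) = (x - comb v L) + (x' - comb v M).
      by lmod R[i] E.
    apply: le_lt_trans (hnD _ _) _; lra.
  have -> : y + y' - (comb w L + comb w M) = (y - comb w L) + (y' - comb w M).
    by lmod R[i] F.
  apply: le_lt_trans (hnD _ _) _; lra.
have relZ k x y : rel x y -> rel (k *: x) (k *: y).
  move=> h e e0; have k0 : 0 <= complex.Re `|k| by rewrite normc_def sqrtr_ge0.
  have k1 : 0 < complex.Re `|k| + 1 by rewrite ltr_wpDl.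
  have [L []] := h _ (divr_gt0 e0 k1); rewrite !ltr_pdivlMr // => L1 L2.
  exists (scale_comb k L); rewrite !comb_scale -!scalerBr !hnZ.
  have := hn_ge0 (x - comb v L); have := hn_ge0 (y - comb w L).
  by split; lra.
have rel_eq x y y' : rel x y -> rel x y' -> y = y'.
  move=> h h'; apply/eqP; rewrite -subr_eq0; apply/eqP; apply: hn_eq0.
  have := rel_bound _ _ (relD _ _ _ _ h (relZ (-1) _ _ h')).
  by rewrite !scaleN1r subrr hn0 mulr0.
have f_bound x : hn (f x) <= C * hn x by apply: rel_bound.
exists f; split => //.
- split => [x y|k x|].
  + by apply: rel_eq (fP _) _; apply: relD.
  + by apply: rel_eq (fP _) _; apply: relZ.
  + by exists C.
- move=> i; apply: rel_eq (fP _) _ => e e0; exists [:: (1, i)].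
  by rewrite !comb1 !subrr !hn0.
Qed.

(** Only one bound is assumed: adjointness on combinations transfers it to the candidate w' for the
    adjoint, by Cauchy-Schwarz. *)
Lemma adjop_extend (I J : Type) E F (v : I -> E) (w : I -> F) (v' : J -> F)
    (w' : J -> E) (C : R) :
  dense v -> dense v' -> 0 <= C ->
  (forall L, hn (comb w L) <= C * hn (comb v L)) ->
  (forall i j, ip (w i) (v' j) = ip (v i) (w' j)) ->
  exists a : adjop E F, [/\ forall i, a (v i) = w i,
    forall j, op_adj a (v' j) = w' j & forall x, hn (a x) <= C * hn x].
Proof.
move=> dv dv' C0 CP h.
have [f [hf fv fC]] := blin_extend dv C0 CP.
have fip x M : ip (f x) (comb v' M) = ip x (comb w' M).
  rewrite -ip_star -[RHS]ip_star; congr (star _).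
  apply: (@blin_eq_dense I E (regular B) v (fun x => ip (comb v' M) (f x))
    (fun x => ip (comb w' M) x) dv).
  - exact: (blin_comp (blin_ip (comb v' M)) hf).
  - exact: blin_ip.
  - move=> i; rewrite fv -ip_star -[RHS]ip_star; congr (star _).
    by rewrite -(comb1 w) -(comb1 v); apply: ip_comb_eq.
have CP' M : hn (comb w' M) <= C * hn (comb v' M).
  set X := comb w' M; have [->|nX] := eqVneq (hn X) 0.
    by rewrite mulr_ge0 ?hn_ge0.
  have X0 : 0 < hn X by rewrite lt_neqAle eq_sym nX hn_ge0.
  rewrite -(ler_pM2r X0) -expr2 hn_sqr -fip.
  apply: le_trans (cauchy_schwarz _ _) _.
  by rewrite mulrAC ler_wpM2r ?hn_ge0.
have [g [hg gv gC]] := blin_extend dv' C0 CP'.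
have fg x y : ip (f x) y = ip x (g y).
  apply: (@blin_eq_dense J F (regular B) v' (fun y => ip (f x) y)
    (fun y => ip x (g y)) dv').
  - exact: blin_ip.
  - exact: (blin_comp (blin_ip x) hg).
  - by move=> j; rewrite gv -(comb1 v') -(comb1 w') fip.
by exists (AdjOp fg).
Qed.

End Combinations.

(** * Amplification of adjointable operators *)

Section LeftAction.
Variables (R : realType) (B : cstarAlg R) (F : corrType B).
Implicit Types (x y : F) (b c : B).

Lemma lactDE b c x : lact (b + c) x = lact b x + lact c x.
Proof. by rewrite lactD. Qed.
Lemma lactZE (k : R[i]) b x : lact (k *: b) x = k *: lact b x.
Proof. by rewrite lactZ. Qed.
Lemma lactME b c x : lact (b * c) x = lact b (lact c x).
Proof. by rewrite lactM. Qed.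
Lemma lactBE b c x : lact (b - c) x = lact b x - lact c x.
Proof. by rewrite lactDE -scaleN1r lactZE scaleN1r. Qed.
Lemma lact0E x : lact (0 : B) x = 0.
Proof. by rewrite -(scale0r 0) lactZE scale0r. Qed.
Lemma lact_ip b x y : ip (lact b x) y = ip x (lact (star b) y).
Proof. by rewrite lact_star op_adjP. Qed.

(** Nondegeneracy: 1 acts as the identity on the total set of vectors b y. *)
Lemma lact1E x : lact (1 : B) x = x.
Proof.
have d : dense (fun p : B * F => lact p.1 p.2).
  apply: (@total_dense R B _ F _ _ (lact_nondeg (s := F))) => _ [b [y ->]].
  by exists (b, y).
suff -> : lact (1 : B) = adj_one F by [].
by apply: (adjop_eq_dense d) => -[b y] /=; rewrite -lactME mul1r.
Qed.

(** Write |b|^2 - b^*b as c^*c; then |b|^2 <x, x> - <b x, b x> = <c x, c x>. *)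
Lemma lact_bound b x : hn (lact b x) <= nrm b * hn x.
Proof.
rewrite -(ler_pXn2r (ltn0Sn 1)) ?nnegrE ?mulr_ge0 ?nrm_ge0 ?hn_ge0 //.
have n0 : 0 <= nrm b ^+ 2 by rewrite exprn_ge0 // nrm_ge0.
rewrite exprMn !hn_sqr -(ger0_norm n0) -nrmZr; apply: cle_nrm; first exact: ip_pos.
have /cpos_near : selfadj (star b * b) by apply: selfadj_starM.
move=> /(_ (nrm b ^+ 2)) [|c cE]; first by rewrite nrm_starM.
rewrite /cle.
have -> : (nrm b ^+ 2)%:C *: ip x x - ip (lact b x) (lact b x) =
  ip (lact c x) (lact c x).
  by rewrite !lact_ip -!lactME -cE lactBE ipBr lactZE lact1E ipZr.
exact: ip_pos.
Qed.
End LeftAction.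

(** By Bernoulli's inequality the powers of a number above 1 are unbounded. *)
Lemma le1_of_pow2 (R : realType) (x K : R) : 0 <= x ->
  (forall n, x ^+ (2 ^ n) <= K) -> x <= 1.
Proof.
move=> x0 xK; rewrite leNgt; apply/negP => x1.
have bern n : 1 + n%:R * (x - 1) <= x ^+ n.
  elim: n => [|n IH]; first by rewrite mul0r addr0.
  rewrite exprS -natr1; have := ler_wpM2l x0 IH.
  have : 0 <= n%:R * (x - 1) * (x - 1).
    by rewrite !mulr_ge0 // subr_ge0 ltW.
  lra.
have d0 : 0 < x - 1 by rewrite subr_gt0.
have K0 : 0 <= K by apply: le_trans (xK 0%N); rewrite exprn_ge0.
have := archi_boundP (divr_ge0 K0 (ltW d0)); set n := Num.bound _.
rewrite ltr_pdivrMr // => Kn.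
have n2 : (n <= 2 ^ n)%N by apply/ltnW/ltn_expl.
have := bern (2 ^ n)%N; have := xK n.
have : n%:R * (x - 1) <= (2 ^ n)%:R * (x - 1) by rewrite ler_pM2r // ler_nat.
lra.
Qed.

Section Amplification.
Variables (R : realType) (B : cstarAlg R) (E : hilbModType B) (F : corrType B)
  (G : hilbModType B) (m : E -> F -> G).
Hypothesis m_ip : forall z x z' x', ip (m z x) (m z' x') = ip x (lact (ip z z') x').
Implicit Types (a b : adjop E E).

Definition m_perp (g : G) := forall z x, ip (m z x) g = 0.

(** Here m z x stands for z (.) x in G. Totality of the tensors together with the vectors orthogonal
    to all of them says that the closed span of the tensors is complemented. *)
Definition amp_fam (i : E * F + {g | m_perp g}) : G :=
  match i with inl p => m p.1 p.2 | inr g => sval g end.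

Definition amp_img a (i : E * F + {g | m_perp g}) : G :=
  match i with inl p => m (a p.1) p.2 | inr _ => 0 end.

Hypothesis amp_dense : dense amp_fam.

(** Testing against tensors and complement derives bilinearity and balancedness of m from [m_ip]. *)
Lemma m_extl (g h : G) : (forall z x, ip (m z x) g = ip (m z x) h) ->
  (forall k, m_perp k -> ip k g = ip k h) -> g = h.
Proof.
by move=> h1 h2; apply: (dense_ip_eq amp_dense) => -[[z x]|[k kP]] //=; apply: h2.
Qed.

Lemma perp_sym g z x : m_perp g -> ip g (m z x) = 0.
Proof. by move=> gP; rewrite -ip_star gP star0. Qed.

Lemma mDl z z' x : m (z + z') x = m z x + m z' x.
Proof.
apply: m_extl => [w y|k kP]; last by rewrite ipDr !perp_sym // addr0.
by rewrite ipDr !m_ip ipDr lactDE ipDr.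
Qed.
Lemma mZl (k : R[i]) z x : m (k *: z) x = k *: m z x.
Proof.
apply: m_extl => [w y|h hP]; last by rewrite ipZr !perp_sym // scaler0.
by rewrite ipZr !m_ip ipZr lactZE ipZr.
Qed.
Lemma mDr z x x' : m z (x + x') = m z x + m z x'.
Proof.
apply: m_extl => [w y|k kP]; last by rewrite ipDr !perp_sym // addr0.
by rewrite ipDr !m_ip opD ipDr.
Qed.
Lemma mZr (k : R[i]) z x : m z (k *: x) = k *: m z x.
Proof.
apply: m_extl => [w y|h hP]; last by rewrite ipZr !perp_sym // scaler0.
by rewrite ipZr !m_ip opZ ipZr.
Qed.
Lemma m_ract z (b : B) x : m (ract z b) x = m z (lact b x).
Proof.
apply: m_extl => [w y|k kP]; last by rewrite !perp_sym.
by rewrite !m_ip ip_ract lactME.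
Qed.
Lemma hn_m z x : hn (m z x) <= hn z * hn x.
Proof.
rewrite -(ler_pXn2r (ltn0Sn 1)) ?nnegrE ?mulr_ge0 ?hn_ge0 // hn_sqr m_ip.
apply: le_trans (cauchy_schwarz _ _) _; rewrite exprMn hn_sqr mulrC expr2 mulrA.
by rewrite ler_wpM2r ?hn_ge0 // lact_bound.
Qed.

Lemma blin_ml x : blin (fun z => m z x).
Proof.
split => [z z'|k z|]; [exact: mDl | exact: mZl |].
by exists (hn x); rewrite hn_ge0; split => // z; rewrite mulrC hn_m.
Qed.
Lemma blin_mr z : blin (fun x => m z x).
Proof.
split => [x x'|k x|]; [exact: mDr | exact: mZr |].
by exists (hn z); rewrite hn_ge0; split => // x; rewrite hn_m.
Qed.

Lemma amp_img_ip a b L M : ip (comb (amp_img a) L) (comb (amp_img b) M) =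
  ip (comb (amp_img (adj_one E)) L) (comb (amp_img (adj_comp (adj_star a) b)) M).
Proof.
apply: ip_comb_eq => -[[z x]|g] [[z' x']|g'] /=; rewrite ?ip0l ?ip0r //.
by rewrite !m_ip op_adjP.
Qed.

Let q a L := hn (comb (amp_img a) L).

Lemma amp_img_sqr a L :
  q a L ^+ 2 <= q (adj_one E) L * q (adj_comp (adj_star a) a) L.
Proof. by rewrite /q hn_sqr amp_img_ip cauchy_schwarz. Qed.

(** The crude triangle inequality: K may depend on the combination, but not on a. *)
Lemma amp_img_triv (L : seq (R[i] * (E * F + {g | m_perp g}))) : exists K : R,
  0 <= K /\ (forall a (C : R), 0 <= C -> (forall z, hn (a z) <= C * hn z) ->
    q a L <= C * K).
Proof.
elim: L => [|[c i] L [K [K0 KP]]].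
  by exists 0; split => // a C _ _; rewrite /q comb_nil hn0 mulr0.
have c0 : 0 <= complex.Re `|c| by rewrite normc_def sqrtr_ge0.
case: i => [[z x]|g].
  exists (complex.Re `|c| * (hn z * hn x) + K); split.
    by rewrite addr_ge0 // !mulr_ge0 ?hn_ge0.
  move=> a C C0 aC; rewrite /q comb_cons /=; apply: le_trans (hnD _ _) _.
  rewrite mulrDr; apply: lerD; last exact: KP.
  rewrite hnZ mulrCA ler_wpM2l //; apply: le_trans (hn_m _ _) _.
  by rewrite mulrA ler_wpM2r ?hn_ge0.
exists K; split => // a C C0 aC; rewrite /q comb_cons /= scaler0 add0r.
exact: KP.
Qed.

(* For A = a (.) id, iterating |Ax|^2 <= |x| |A^*Ax| bounds |Ax|^(2^n) by     *)
(* |x|^(2^n - 1) |b_n x| with b_n = (A^*A)^(2^(n-1)), and |b_n x| is trivially *)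
(* at most K_x C^(2^n) if C bounds a. No functional calculus in the algebra of *)
(* adjointable operators is needed.                                            *)
Lemma amp_img_bound a (C : R) L : 0 <= C -> (forall z, hn (a z) <= C * hn z) ->
  q a L <= C * q (adj_one E) L.
Proof.
move=> C0 aC; set N := q (adj_one E) L.
have N0 : 0 <= N by apply: hn_ge0.
have [NE|Nn] := eqVneq N 0.
  have := amp_img_sqr a L; rewrite -/N NE mul0r mulr0 => h.
  by rewrite -(ler_pXn2r (ltn0Sn 1)) ?nnegrE ?hn_ge0 // expr0n.
have Np : 0 < N by rewrite lt_neqAle eq_sym Nn N0.
have [CE|Cn] := eqVneq C 0.
  have [K [_ /(_ a C C0 aC)]] := amp_img_triv L.
  by rewrite CE !mul0r.
have Cp : 0 < C by rewrite lt_neqAle eq_sym Cn C0.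
pose b := fix b n := if n is n'.+1 then adj_comp (adj_star (b n')) (b n') else a.
have bC n : forall z, hn (b n z) <= C ^+ (2 ^ n) * hn z.
  elim: n => [|n IH] z; first by rewrite expr1.
  have Cn0 : 0 <= C ^+ (2 ^ n) by rewrite exprn_ge0.
  rewrite /= expnS mul2n -addnn exprD; apply: le_trans (adj_bound Cn0 IH _) _.
  by rewrite -mulrA ler_wpM2l.
have [K [K0 KP]] := amp_img_triv L.
(* The ratios satisfy r_n^2 <= r_(n+1), hence r_0^(2^n) <= r_n <= C^(2^n) K / N, and [le1_of_pow2]
   absorbs the constant K / N. *)
pose r n := q (b n) L / N.
have r0 n : 0 <= r n by rewrite divr_ge0 ?hn_ge0.
have rS n : r n ^+ 2 <= r n.+1.
  rewrite /r expr_div_n ler_pdivrMr ?exprn_gt0 // [N ^+ 2]expr2 mulrA divfK //.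
  by rewrite mulrC amp_img_sqr.
have rp n : r 0%N ^+ (2 ^ n) <= r n.
  elim: n => [|n IH]; first by rewrite expr1.
  rewrite expnSr exprM; apply: le_trans (rS n).
  by rewrite ler_pXn2r ?nnegrE ?exprn_ge0.
have : r 0%N / C <= 1.
  apply: (@le1_of_pow2 _ _ (K / N)); first by rewrite divr_ge0.
  move=> n; rewrite expr_div_n ler_pdivrMr ?exprn_gt0 //.
  apply: le_trans (rp n) _; rewrite /r mulrAC ler_wpM2r ?invr_ge0 // mulrC.
  by apply: KP => //; rewrite exprn_ge0.
by rewrite ler_pdivrMr // mul1r /r ler_pdivrMr.
Qed.

(** The image under [adj_one] is the projection onto the tensor part, and |P g|^2 = |<g, P g>|. *)
Lemma amp_one_le L : q (adj_one E) L <= hn (comb amp_fam L).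
Proof.
have h : hn (comb (amp_img (adj_one E)) L) ^+ 2 =
    nrm (ip (comb amp_fam L) (comb (amp_img (adj_one E)) L)).
  rewrite hn_sqr; congr nrm; apply: ip_comb_eq => -[[z x]|g] [[z' x']|g'] //=.
  - by rewrite ip0l perp_sym //; exact: (svalP g).
  - by rewrite ip0l ip0r.
rewrite /q; set X := comb _ L in h *; have [->|nX] := eqVneq (hn X) 0.
  exact: hn_ge0.
have X0 : 0 < hn X by rewrite lt_neqAle eq_sym nX hn_ge0.
by rewrite -(ler_pM2r X0) -expr2 h cauchy_schwarz.
Qed.

(** An extension is built from one bound of a; those built from other bounds agree with it on a
    total family, so it obeys every bound of a. *)
Lemma amp_exists a : exists t : adjop G G,
  [/\ forall z x, t (m z x) = m (a z) x, forall g, m_perp g -> t g = 0,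
      forall z x, op_adj t (m z x) = m (op_adj a z) x,
      forall g, m_perp g -> op_adj t g = 0 &
      forall C : R, 0 <= C -> (forall z, hn (a z) <= C * hn z) ->
        forall g, hn (t g) <= C * hn g].
Proof.
have ext C : 0 <= C -> (forall z, hn (a z) <= C * hn z) ->
  exists t : adjop G G, [/\ forall i, t (amp_fam i) = amp_img a i,
    forall j, op_adj t (amp_fam j) = amp_img (adj_star a) j &
    forall x, hn (t x) <= C * hn x].
  move=> C0 aC; apply: (adjop_extend amp_dense amp_dense C0).
    move=> L; apply: le_trans (amp_img_bound L C0 aC) _.
    by rewrite ler_wpM2l // amp_one_le.
  move=> [[z x]|g] [[z' x']|g'] /=; rewrite ?ip0l ?ip0r //.
  - by rewrite !m_ip op_adjP.
  - exact: (svalP g').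
  - by rewrite perp_sym //; exact: (svalP g).
have [C [C0 aC]] := adjop_bounded a; have [t [t1 t2 t3]] := ext C C0 aC.
exists t; split.
- by move=> z x; apply: (t1 (inl (z, x))).
- by move=> g gP; apply: (t1 (inr (exist _ g gP))).
- by move=> z x; apply: (t2 (inl (z, x))).
- by move=> g gP; apply: (t2 (inr (exist _ g gP))).
- move=> D D0 aD; have [u [u1 _ u3]] := ext D D0 aD.
  suff -> : t = u by [].
  by apply: (adjop_eq_dense amp_dense) => i; rewrite t1 u1.
Qed.

Definition amp a : adjop G G := sval (cid (amp_exists a)).

Lemma amp_m a z x : amp a (m z x) = m (a z) x.
Proof. by rewrite /amp; case: cid => /= t []. Qed.
Lemma amp_perp a g : m_perp g -> amp a g = 0.
Proof. by rewrite /amp; case: cid => /= t [] _ h _ _ _ /h. Qed.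
Lemma amp_adj_m a z x : op_adj (amp a) (m z x) = m (op_adj a z) x.
Proof. by rewrite /amp; case: cid => /= t []. Qed.
Lemma amp_adj_perp a g : m_perp g -> op_adj (amp a) g = 0.
Proof. by rewrite /amp; case: cid => /= t [] _ _ _ h _ /h. Qed.
Lemma amp_bound a (C : R) : 0 <= C -> (forall z, hn (a z) <= C * hn z) ->
  forall g, hn (amp a g) <= C * hn g.
Proof. by rewrite /amp; case: cid => /= t [] _ _ _ _; apply. Qed.

(** The tool for recognising amplifications: multiplicativity, the semigroup law and the comparison
    of dilations all rest on it. *)
Lemma amp_unique a (t : adjop G G) : (forall z x, t (m z x) = m (a z) x) ->
  (forall g, m_perp g -> t g = 0) -> t = amp a.
Proof.
move=> t1 t2; apply: (adjop_eq_dense amp_dense) => -[[z x]|[g gP]] /=.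
  by rewrite t1 amp_m.
by rewrite t2 // amp_perp.
Qed.

Lemma amp_star_endomorphism (a : adjop E E) (b : adjop E E) (k : R[i]) :
  [/\ amp (k *: a + b) = k *: amp a + amp b,
      amp (adj_comp a b) = adj_comp (amp a) (amp b) &
      amp (adj_star a) = adj_star (amp a)].
Proof.
split; symmetry; apply: amp_unique => [z x|g gP] /=.
- by rewrite !amp_m mDl mZl.
- by rewrite !amp_perp // scaler0 addr0.
- by rewrite !amp_m.
- by rewrite (amp_perp b gP) op0.
- by rewrite amp_adj_m.
- by rewrite amp_adj_perp.
Qed.

End Amplification.

Lemma gt0_real (R : realType) (e : R[i]) : 0 < e -> exists r : R, 0 < r /\ e = r%:C.
Proof.
case: e => x y; rewrite ltcE /= => /andP [/eqP -> x0].
by exists x.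
Qed.

Lemma ge0_real (R : realType) (e : R[i]) : 0 <= e -> exists r : R, 0 <= r /\ e = r%:C.
Proof.
case: e => x y; rewrite lecE /= => /andP [/eqP -> x0].
by exists x.
Qed.

(** * The strict topology and strong convergence of operators and adjoints *)

Section StrictTopology.
Variables (R : realType) (B : cstarAlg R).
Implicit Types E F G : hilbModType B.

Lemma opnorm_leP E F (a : adjop E F) (e : R) :
  opnorm_le a e%:C <-> 0 <= e /\ forall x, hn (a x) <= e * hn x.
Proof.
rewrite /opnorm_le lecR; split=> -[e0 h]; split => // x; have := h x;
  by rewrite !hnormE -rmorphM /= lecR.
Qed.

Lemma adjB E F (a b : adjop E F) y : op_adj (a - b) y = op_adj a y - op_adj b y.
Proof.
apply: ip_inj => x; rewrite -op_adjP (_ : (a - b) x = a x - b x).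
  by rewrite ipBl ipBr -!op_adjP.
by have -> : (a - b) x = a x + -1 *: b x by []; rewrite scaleN1r.
Qed.

Lemma opBE E F (a b : adjop E F) x : (a - b) x = a x - b x.
Proof. by have -> : (a - b) x = a x + -1 *: b x by []; rewrite scaleN1r. Qed.

Lemma sum_opE E F n (a : 'I_n -> adjop E F) x : (\sum_i a i) x = \sum_i a i x.
Proof. exact: (big_morph (fun a : adjop E F => a x)). Qed.

Lemma compact_ketbra E (x y : E) : compact_op (ketbra x y).
Proof.
move=> e /gt0_real [r [r0 ->]]; exists 1%N, (fun=> x), (fun=> y).
rewrite big_ord1 subrr; apply/opnorm_leP; split; first exact: ltW.
by move=> z; rewrite [X in hn X](_ : _ = 0) ?hn0 // mulr_ge0 ?hn_ge0 // ltW.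
Qed.

Lemma hn_unit E (xi : E) : ip xi xi = 1 -> hn xi <= 1.
Proof.
move=> xi1; rewrite -(ler_pXn2r (ltn0Sn 1)) ?nnegrE ?hn_ge0 // hn_sqr xi1.
by rewrite expr1n nrm1_le.
Qed.

Definition strong_cvg E (X : set_system (adjop E E)) (a : adjop E E) : Prop :=
  forall z (e : R), 0 < e ->
  X [set b : adjop E E | hn (b z - a z) <= e /\ hn (op_adj b z - op_adj a z) <= e].

(** Rank one operators suffice: [ketbra z xi] sends xi to z and controls values at z, while
    [ketbra xi z] on the other side controls the adjoints. *)
Lemma strict_strong_cvg E (xi : E) (X : set_system (adjop E E)) (a : adjop E E) :
  Filter X -> ip xi xi = 1 ->
  strict_cvg X a -> strong_cvg X a.
Proof.
move=> FX xi1 Xa z e e0; have e0C : 0 < e%:C by rewrite ltcR.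
have near1 := Xa _ (compact_ketbra z xi) _ e0C.
have near2 := Xa _ (compact_ketbra xi z) _ e0C.
apply: filterS2 near1 near2 => b [/opnorm_leP [_ h1] _] [_ /opnorm_leP [_ h2]].
split.
  have : hn ((b - a) (ract z (ip xi xi))) <= e * hn xi := h1 xi.
  rewrite xi1 ract1 opBE => h; apply: le_trans h _.
  by rewrite ler_piMr ?hn_unit // ltW.
rewrite -adjB; set u := op_adj (b - a) z; 
have : hn (ract xi (ip z ((b - a) u))) <= e * hn u := h2 u.
rewrite -op_adjP' -/u => h.
have [->|nu] := eqVneq (hn u) 0; first exact: ltW.
have u0 : 0 < hn u by rewrite lt_neqAle eq_sym nu hn_ge0.
rewrite -(ler_pM2r u0) -expr2; apply: le_trans h.
rewrite hn_sqr -(ler_pXn2r (ltn0Sn 1)) ?nnegrE ?hn_ge0 ?nrm_ge0 //.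
by rewrite hn_sqr ip_ract ip_ractl xi1 mulr1 nrm_starM.
Qed.

Lemma near_all (T : Type) (X : set_system T) (FX : Filter X) n (P : 'I_n -> set T) :
  (forall i, X (P i)) -> X [set b | forall i, P i b].
Proof. by move=> h; apply: filter_forall. Qed.

Lemma strong_strict_cvg E (X : set_system (adjop E E)) (a : adjop E E) (C : R) :
  Filter X -> 0 <= C -> X [set b : adjop E E | forall x, hn (b x) <= C * hn x] ->
  (forall x, hn (a x) <= C * hn x) -> strong_cvg X a -> strict_cvg X a.
Proof.
move=> FX C0 XC aC Xa k kc _ /gt0_real [e [e0 ->]].
have C1 : 0 < 2 * C + 1 by rewrite ltr_wpDl // mulr_ge0.
(* Half of e pays for replacing k by a finite rank operator, where b - a only has the bound 2 C, and
   half for convergence on the finitely many x_i and y_i. *)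
pose d := e / 2 / (2 * C + 1); have d0 : 0 < d by rewrite !divr_gt0.
have [|n [x [y /opnorm_leP [_ kxy]]]] := kc d%:C; first by rewrite ltcR.
pose K := \sum_i (hn (x i) + hn (y i)); have K0 : 0 <= K.
  by apply: sumr_ge0 => i _; rewrite addr_ge0 ?hn_ge0.
have K1 : 0 < K + 1 by rewrite ltr_wpDl.
pose c := e / 2 / (K + 1); have c0 : 0 < c by rewrite !divr_gt0.
have nx := near_all FX (fun i => Xa (x i) c c0).
have ny := near_all FX (fun i => Xa (y i) c c0).
have cK : c * K <= e / 2.
  have : c * (K + 1) = e / 2 by rewrite /c divfK // gt_eqF.
  by rewrite mulrDr mulr1; lra.
have dC : d * (2 * C) <= e / 2.
  have : d * (2 * C + 1) = e / 2 by rewrite /d divfK // gt_eqF.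
  by rewrite mulrDr mulr1; lra.
have sumx z : hn (\sum_i ract (x i) z) <= (\sum_i hn (x i)) * nrm z.
  rewrite mulr_suml; elim/big_rec2: _ => [|i u v _ h]; first by rewrite hn0.
  by apply: le_trans (hnD _ _) _; apply: lerD h; apply: hn_ract.
have hsum (I : finType) (f : I -> E) (g : I -> R) : (forall i, hn (f i) <= g i) ->
    hn (\sum_i f i) <= \sum_i g i.
  move=> fg; elim/big_rec2: _ => [|i u v _ h]; first by rewrite hn0.
  by apply: le_trans (hnD _ _) _; apply: lerD.
have KS w : \sum_i c * (hn (x i) + hn (y i)) * w = c * K * w.
  by rewrite -mulr_suml -mulr_sumr.
apply: filterS3 nx ny XC => b bx by_ bC.
have bB z : hn ((b - a) z) <= 2 * C * hn z.
  rewrite opBE; apply: le_trans (hnB _ _) _; have := bC z; have := aC z; lra.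
split; apply/opnorm_leP; split; try exact: ltW.
- move=> w; change (hn ((b - a) (k w)) <= e * hn w); pose S := \sum_i ketbra (x i) (y i) w.
  have kw : hn (k w - S) <= d * hn w.
    by have := kxy w; rewrite opBE sum_opE.
  have -> : k w = (k w - S) + S by rewrite subrK.
  rewrite opD; apply: le_trans (hnD _ _) _.
  have h1 : hn ((b - a) (k w - S)) <= e / 2 * hn w.
    apply: le_trans (bB _) _; have := ler_wpM2l (mulr_ge0 (ler0n R 2) C0) kw.
    by move=> /le_trans; apply; rewrite mulrA ler_wpM2r ?hn_ge0 // mulrC.
  have h2 : hn ((b - a) S) <= c * K * hn w.
    rewrite op_sum -KS; apply: hsum => i.
    rewrite [ketbra _ _ w]/(ract (x i) (ip (y i) w)) op_ract opBE.
    apply: le_trans (hn_ract _ _) _.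
    have := cauchy_schwarz (y i) w; have := (bx i).1.
    have := hn_ge0 (x i); have := hn_ge0 (y i); have := hn_ge0 w.
    move=> w0 y0 x0 h1' h2'; apply: (@le_trans _ _ (c * (hn (y i) * hn w))).
      by rewrite ler_pM ?hn_ge0 ?nrm_ge0.
    rewrite -mulrA ler_wpM2l //; first exact: ltW.
    by rewrite ler_wpM2r // lerDr.
  have := ler_wpM2r (hn_ge0 w) cK; lra.
- move=> w; pose v := (b - a) w; change (hn (k v) <= e * hn w); pose S := \sum_i ketbra (x i) (y i) v.
  have kv : hn (k v - S) <= d * hn v.
    by have := kxy v; rewrite opBE sum_opE.
  have -> : k v = (k v - S) + S by rewrite subrK.
  apply: le_trans (hnD _ _) _.
  have h1 : hn (k v - S) <= e / 2 * hn w.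
    apply: le_trans kv _; have := ler_wpM2l (ltW d0) (bB w).
    by move=> /le_trans; apply; rewrite mulrA ler_wpM2r ?hn_ge0.
  have h2 : hn S <= c * K * hn w.
    rewrite -KS; apply: hsum => i.
    rewrite [ketbra _ _ v]/(ract (x i) (ip (y i) v)).
    apply: le_trans (hn_ract _ _) _; rewrite /v -op_adjP' adjB.
    have := cauchy_schwarz (op_adj b (y i) - op_adj a (y i)) w; have := (by_ i).2.
    have := hn_ge0 (x i); have := hn_ge0 (y i); have := hn_ge0 w.
    move=> w0 y0 x0 h1' h2'; apply: (@le_trans _ _ (hn (x i) * (c * hn w))).
      rewrite ler_wpM2l //; apply: le_trans h2' _.
      by rewrite ler_wpM2r.
    rewrite mulrCA mulrA; rewrite ler_wpM2r // ler_wpM2l //; first exact: ltW.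
    by rewrite lerDl.
  have := ler_wpM2r (hn_ge0 w) cK; lra.
Qed.

End StrictTopology.

Section AmplificationStrict.
Variables (R : realType) (B : cstarAlg R) (E : hilbModType B) (F : corrType B)
  (G : hilbModType B) (m : E -> F -> G).
Hypothesis m_ip : forall z x z' x', ip (m z x) (m z' x') = ip x (lact (ip z z') x').
Hypothesis m_dense : dense (@amp_fam R B E F G m).
Notation amp := (amp m_ip m_dense).

(** On tensors convergence is inherited from the first factor and on the complement amplifications
    vanish; the common bound C extends it to the closed span. *)
Lemma amp_strong_cvg (X : set_system (adjop E E)) (a : adjop E E) (C : R) :
  Filter X -> 0 <= C -> X [set b : adjop E E | forall x, hn (b x) <= C * hn x] ->
  (forall x, hn (a x) <= C * hn x) -> strong_cvg X a -> strong_cvg (amp @ X) (amp a).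
Proof.
move=> FX C0 XC aC Xa g e e0.
have C1 : 0 < 2 * C + 1 by rewrite ltr_wpDl // mulr_ge0.
have e2 : 0 < e / 2 by rewrite divr_gt0.
have [L LP] := m_dense g (divr_gt0 e2 C1).
have combL : forall d : R, 0 < d -> X [set b : adjop E E |
    hn (amp b (comb (amp_fam (m := m)) L) - amp a (comb (amp_fam (m := m)) L)) <= d /\
    hn (op_adj (amp b) (comb (amp_fam (m := m)) L) -
        op_adj (amp a) (comb (amp_fam (m := m)) L)) <= d].
  elim: L {LP} => [|[c i] L IH] d d0.
    have adj0 (b : adjop G G) : op_adj b 0 = 0 by apply: (op0 (adj_star b)).
    by apply: filterE => b /=; rewrite comb_nil !op0 !adj0 !subrr !hn0; split; apply: ltW.
  have d2 : 0 < d / 2 by rewrite divr_gt0.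
  pose r := complex.Re `|c|; have r0 : 0 <= r by rewrite /r normc_def sqrtr_ge0.
  pose u (i : E * F + {g : G | m_perp m g}) : R := match i with inl p => r * hn p.2 | inr _ => 0 end.
  have u0 : 0 <= u i.
    by case: i => [p|] //=; rewrite mulr_ge0 ?hn_ge0.
  have u1 : 0 < u i + 1 by rewrite ltr_wpDl.
  have ui : forall s, s <= d / 2 / (u i + 1) -> u i * s <= d / 2.
    move=> s; rewrite ler_pdivlMr // => h.
    have [s0|s0] := leP 0 s; first by lra.
    by apply: le_trans (ltW d2); apply: mulr_ge0_le0 => //; apply: ltW.
  have hd : forall s t, s <= d / 2 -> t <= d / 2 -> s + t <= d by move=> *; lra.
  have IHd := IH _ d2.
  have comp (b : adjop G G) : b (comb (amp_fam (m := m)) ((c, i) :: L)) =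
      c *: b (amp_fam i) + b (comb (amp_fam (m := m)) L).
    by rewrite comb_cons opD opZ.
  have compa (b : adjop G G) : op_adj b (comb (amp_fam (m := m)) ((c, i) :: L)) =
      c *: op_adj b (amp_fam i) + op_adj b (comb (amp_fam (m := m)) L).
    by rewrite -[op_adj b]/(op (adj_star b)) comp.
  have cB (x y x' y' : G) : c *: x + y - (c *: x' + y') = c *: (x - x') + (y - y').
    by lmod R[i] G.
  have near_i : X [set b : adjop E E |
     hn (c *: (amp b (amp_fam i) - amp a (amp_fam i))) <= d / 2 /\
     hn (c *: (op_adj (amp b) (amp_fam i) - op_adj (amp a) (amp_fam i))) <= d / 2].
    case: i u0 u1 ui {comp compa} => [[z x]|[h hP]] u0 u1 ui /=; last first.
      apply: filterE => b /=.
      rewrite !amp_perp // !amp_adj_perp // !subrr scaler0 hn0.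
      by split; apply: ltW.
    have := Xa z _ (divr_gt0 d2 u1); apply: filterS => b [b1 b2] /=.
    have ml (s t : E) : m s x - m t x = m (s - t) x.
      by rewrite (blB (blin_ml m_ip m_dense x)).
    rewrite !amp_m !amp_adj_m !ml !hnZ -/r; split.
      apply: le_trans (ui _ b1); rewrite /u /= -mulrA ler_wpM2l //.
      by rewrite mulrC; apply: hn_m.
    apply: le_trans (ui _ b2); rewrite /u /= -mulrA ler_wpM2l //.
    by rewrite mulrC; apply: hn_m.
  apply: filterS2 near_i IHd => b [b1 b2] [b3 b4] /=.
  rewrite !comp !compa !cB.
  by split; apply: le_trans (hnD _ _) _; apply: hd.
change (X [set b : adjop E E | hn (amp b g - amp a g) <= e /\
  hn (op_adj (amp b) g - op_adj (amp a) g) <= e]).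
apply: filterS2 XC (combL _ e2) => b bC [b1 b2] /=.
have key (s t : adjop G G) : (forall h, hn (s h) <= C * hn h) ->
   (forall h, hn (t h) <= C * hn h) ->
   hn (s (comb (amp_fam (m := m)) L) - t (comb (amp_fam (m := m)) L)) <= e / 2 ->
   hn (s g - t g) <= e.
  move=> sC tC h; set f := comb _ L in LP h.
  have -> : s g - t g = (s (g - f) - t (g - f)) + (s f - t f).
    by rewrite !opB; lmod R[i] G.
  apply: le_trans (hnD _ _) _.
  have : hn (s (g - f) - t (g - f)) <= (2 * C) * hn (g - f).
    by apply: le_trans (hnB _ _) _; have := sC (g - f); have := tC (g - f); lra.
  have : hn (g - f) * (2 * C + 1) <= e / 2 by rewrite -ler_pdivlMr // ltW.
  have := hn_ge0 (g - f); lra.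
split; first by apply: key b1; apply: amp_bound.
apply: (key (adj_star (amp b)) (adj_star (amp a)) _ _ b2).
  by apply: adj_bound => //; apply: amp_bound.
by apply: adj_bound => //; apply: amp_bound.
Qed.

End AmplificationStrict.

Lemma amp_strict (R : realType) (B : cstarAlg R) (E : hilbModType B) (F : corrType B)
  (m : E -> F -> E)
  (m_ip : forall z x z' x', ip (m z x) (m z' x') = ip x (lact (ip z z') x'))
  (m_dense : dense (@amp_fam R B E F E m)) (xi : E) :
  ip xi xi = 1 -> strict_on_bounded (amp m_ip m_dense).
Proof.
move=> xi1 A [c cP] a Aa X FX XA Xa.
have [/ge0_real [C [C0 cE]] _] := cP a Aa; rewrite {c}cE in cP.
have AC b : A b -> forall x, hn (b x) <= C * hn x by move=> /cP /opnorm_leP [].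
have XC : X [set b : adjop E E | forall x, hn (b x) <= C * hn x].
  exact: filterS XA.
apply: (@strong_strict_cvg _ _ _ _ _ C) => //.
- change (X [set b : adjop E E | forall x, hn (amp m_ip m_dense b x) <= C * hn x]).
  by apply: filterS XC => b bC; apply: amp_bound.
- by apply: amp_bound => //; apply: AC.
- apply: (@amp_strong_cvg R B E F E m m_ip m_dense X a C FX C0 XC); first exact: AC.
  exact: strict_strong_cvg xi1 Xa.
Qed.

(** * Kolmogorov decomposition *)

Section ClosedPositivity.
Variables (R : realType) (B : cstarAlg R).

(** Approximants within distance 1 have norm at most t = |a| + 1, so |t - b| <= t holds with one t
    for all of them and passes to the limit. *)
Lemma cpos_closed (a : B) :
  (forall e : R, 0 < e -> exists b, cpos b /\ nrm (a - b) <= e) -> cpos a.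
Proof.
move=> h; apply: near_scalar_cpos; split.
  apply/eqP; rewrite /selfadj -subr_eq0; apply/eqP; apply: nrm_eq0; apply/eqP.
  rewrite eq_le nrm_ge0 andbT; apply/ler_addgt0Pr => e e0; rewrite add0r.
  have e2 : 0 < e / 2 by rewrite divr_gt0.
  have [b [/cpos_selfadj bs ab]] := h _ e2.
  have -> : star a - a = star (a - b) - (a - b) by rewrite starB bs; lmod R[i] B.
  by apply: le_trans (nrmB _ _) _; rewrite nrm_star; lra.
exists (nrm a + 1); split; first by rewrite addr_ge0 ?nrm_ge0.
apply/ler_addgt0Pr => e e0.
pose d := Num.min e 1; have d0 : 0 < d by rewrite lt_min e0 ltr01.
have [b [bp ab]] := h _ d0; have bs := cpos_selfadj bp.
have [de d1] : d <= e /\ d <= 1 by rewrite !ge_min !lexx orbT.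
have b1 : nrm b <= nrm a + 1.
  by have := nrmB a (a - b); rewrite subKr; lra.
have [u [hu uu _ _]] := near_scalar_sqrt (cpos_near_scalar bp).
have := @sq_near R B u (nrm a + 1) hu; rewrite uu => /(_ b1) h1.
have -> : (nrm a + 1)%:C *: (1 : B) - a = ((nrm a + 1)%:C *: (1 : B) - b) - (a - b).
  by lmod R[i] B.
by apply: le_trans (nrmB _ _) _; lra.
Qed.
End ClosedPositivity.

Record pd_kernel (R : realType) (B : cstarAlg R) (I : Type) := PDKernel {
  ker :> I -> I -> B;
  ker_star : forall i j, star (ker i j) = ker j i;
  ker_pos : forall L : seq (I * B),
    cpos (\sum_(p <- L) \sum_(q <- L) star p.2 * ker p.1 q.1 * q.2)
}.

Section Kolmogorov.
Variables (R : realType) (B : cstarAlg R) (I : Type) (K : pd_kernel B I).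
Local Notation V := (seq (I * B)).
Implicit Types (x y z : V) (b : B).

(** Lists stand for formal sums of elements i b in the free right module on I. The form may be
    degenerate, and [++], [vsc] and [vact] act as the module operations. *)
Definition vip x y : B := \sum_(p <- x) \sum_(q <- y) star p.2 * K p.1 q.1 * q.2.
Definition vact x b : V := [seq (p.1, p.2 * b) | p <- x].
Definition vsc (k : R[i]) x : V := [seq (p.1, k *: p.2) | p <- x].
Definition vn x : R := Num.sqrt (nrm (vip x x)).

Lemma vip_catr x y z : vip x (y ++ z) = vip x y + vip x z.
Proof. by rewrite /vip -big_split; apply: eq_bigr => p _; rewrite big_cat. Qed.
Lemma vip_scr k x y : vip x (vsc k y) = k *: vip x y.
Proof.
rewrite /vip scaler_sumr; apply: eq_bigr => p _; rewrite big_map scaler_sumr.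
by apply: eq_bigr => q _ /=; rewrite scalAr.
Qed.
Lemma vip_actr x y b : vip x (vact y b) = vip x y * b.
Proof.
rewrite /vip mulr_suml; apply: eq_bigr => p _; rewrite big_map mulr_suml.
by apply: eq_bigr => q _ /=; rewrite mulrA.
Qed.
Lemma star_sum (T : Type) (s : seq T) (f : T -> B) :
  star (\sum_(i <- s) f i) = \sum_(i <- s) star (f i).
Proof. by elim: s => [|i s IH]; rewrite ?big_nil ?star0 // !big_cons starD IH. Qed.
Lemma vip_star x y : star (vip x y) = vip y x.
Proof.
rewrite /vip star_sum [RHS]exchange_big; apply: eq_bigr => p _.
rewrite star_sum; apply: eq_bigr => q _.
by rewrite !starM starK ker_star mulrA.
Qed.
Lemma vip_scl (r : R) x y : vip (vsc r%:C x) y = r%:C *: vip x y.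
Proof. by rewrite -vip_star vip_scr starZr vip_star. Qed.
Lemma vip_actl x y b : vip (vact x b) y = star b * vip x y.
Proof. by rewrite -vip_star vip_actr starM vip_star. Qed.
Lemma vip_pos x : cpos (vip x x). Proof. exact: ker_pos. Qed.

Definition vsub x y := x ++ vsc (-1)%:C y.
Lemma vip_subr x y z : vip x (vsub y z) = vip x y - vip x z.
Proof. by rewrite vip_catr vip_scr rmorphN1 scaleN1r. Qed.
Lemma vip_subl x y z : vip (vsub x y) z = vip x z - vip y z.
Proof. by rewrite -vip_star vip_subr starB !vip_star. Qed.

Lemma vn_ge0 x : 0 <= vn x. Proof. exact: sqrtr_ge0. Qed.
Lemma vn_sqr x : vn x ^+ 2 = nrm (vip x x).
Proof. by rewrite sqr_sqrtr // nrm_ge0. Qed.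

Lemma vip_cs x y : nrm (vip x y) <= vn x * vn y.
Proof.
have H r : 0 < r -> vn x ^+ 2 <= r -> nrm (vip x y) ^+ 2 <= r * vn y ^+ 2.
  move=> r0 xr; rewrite -nrm_starM vn_sqr -{1}(gtr0_norm r0) -nrmZr.
  apply: cle_nrm; first by exists (vip x y).
  apply: (@cauchy_schwarz_elt _ _ _ (vip x x)) => //; first exact: vip_star.
    by rewrite -vn_sqr.
  have := vip_pos (vsub (vsc r%:C y) (vact x (vip x y))).
  rewrite vip_subl !vip_subr !vip_actr !vip_actl !vip_scr !vip_scl -!(vip_star x y).
  congr cpos.
  by rewrite !rmorphM !scalAl !scalAr; lmod R[i] B.
have H2 : nrm (vip x y) ^+ 2 <= (vn x * vn y) ^+ 2.
  apply/ler_addgt0Pr => e e0.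
  have y0 : 0 < vn y ^+ 2 + 1 by rewrite ltr_wpDl // exprn_ge0 // vn_ge0.
  have d0 : 0 < e / (vn y ^+ 2 + 1) by rewrite divr_gt0.
  have x0 : 0 <= vn x ^+ 2 by rewrite exprn_ge0 // vn_ge0.
  apply: le_trans (H (vn x ^+ 2 + e / (vn y ^+ 2 + 1)) _ _) _.
  - by rewrite ltr_wpDl.
  - by rewrite lerDl ltW.
  rewrite mulrDl -exprMn lerD2l mulrAC ler_pdivrMr // ler_pM2l //.
  by rewrite lerDl.
by rewrite -(ler_pXn2r (ltn0Sn 1)) ?nnegrE ?mulr_ge0 ?vn_ge0 ?nrm_ge0.
Qed.

Definition appr (f : V -> B) x (e : R) := forall y, nrm (f y - vip y x) <= e * vn y.

(* The completion of V, as limits of the functionals <-, x> in the dual norm.  *)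
Record kolm := Kolm {
  kfun :> V -> B;
  kfunP : forall e : R, 0 < e -> exists x, appr kfun x e
}.
Implicit Types f g h : kolm.

(** Vectors of length 0 give the zero functional, so the quotient by them is built in. *)
Lemma kolm_eq f g : (forall y, f y = g y) -> f = g.
Proof.
case: f g => [f fP] [g gP] /= /funext fg; move: fP; rewrite fg => fP.
by congr Kolm; apply: Prop_irrelevance.
Qed.

HB.instance Definition _ := gen_eqMixin kolm.
HB.instance Definition _ := gen_choiceMixin kolm.

Lemma kvec_P x (e : R) : 0 < e -> exists z, appr (vip^~ x) z e.
Proof.
by move=> e0; exists x => y; rewrite subrr nrm0 mulr_ge0 ?vn_ge0 // ltW.
Qed.
Definition kvec x := Kolm (kvec_P x).

Lemma kadd_P f g (e : R) : 0 < e -> exists x, appr (fun y => f y + g y) x e.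
Proof.
move=> e0; have e2 : 0 < e / 2 by rewrite divr_gt0.
have [x xP] := kfunP f e2; have [z zP] := kfunP g e2.
exists (x ++ z) => y; rewrite vip_catr opprD addrACA.
by apply: le_trans (nrmD _ _) _; have := xP y; have := zP y; lra.
Qed.
Definition kadd f g := Kolm (kadd_P f g).

Lemma kscale_P (k : R[i]) f (e : R) : 0 < e -> exists x, appr (fun y => k *: f y) x e.
Proof.
move=> e0; have k0 : 0 <= complex.Re `|k| by rewrite normc_def sqrtr_ge0.
have k1 : 0 < complex.Re `|k| + 1 by rewrite ltr_wpDl.
have [x xP] := kfunP f (divr_gt0 e0 k1).
exists (vsc k x) => y; rewrite vip_scr -scalerBr nrmZ.
have := ler_wpM2l (ltW k1) (xP y); rewrite mulrA mulrCA mulfV ?gt_eqF // mulr1.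
by have := nrm_ge0 (f y - vip y x); lra.
Qed.
Definition kscale k f := Kolm (kscale_P k f).

Lemma kact_P f b (e : R) : 0 < e -> exists x, appr (fun y => f y * b) x e.
Proof.
move=> e0; have b1 : 0 < nrm b + 1 by rewrite ltr_wpDl ?nrm_ge0.
have [x xP] := kfunP f (divr_gt0 e0 b1).
exists (vact x b) => y; rewrite vip_actr -mulrBl; apply: le_trans (nrmM _ _) _.
have := ler_wpM2r (ltW b1) (xP y); rewrite mulrAC divfK ?gt_eqF //.
by have := nrm_ge0 (f y - vip y x); lra.
Qed.
Definition kact f b := Kolm (kact_P f b).

Lemma kaddA : associative kadd.
Proof. by move=> f g h; apply: kolm_eq => y /=; rewrite addrA. Qed.
Lemma kaddC : commutative kadd.
Proof. by move=> f g; apply: kolm_eq => y /=; rewrite addrC. Qed.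
Lemma kadd0 : left_id (kvec [::]) kadd.
Proof.
move=> f; apply: kolm_eq => y /=; rewrite /vip big1 ?add0r // => p _.
by rewrite big_nil.
Qed.
Lemma kaddN : left_inverse (kvec [::]) (kscale (-1)) kadd.
Proof.
move=> f; apply: kolm_eq => y /=; rewrite scaleN1r addNr /vip big1 // => p _.
by rewrite big_nil.
Qed.
HB.instance Definition _ := GRing.isZmodule.Build kolm kaddA kaddC kadd0 kaddN.

Lemma kscaleA (k l : R[i]) f : kscale k (kscale l f) = kscale (k * l) f.
Proof. by apply: kolm_eq => y /=; rewrite scalerA. Qed.
Lemma kscale1 : left_id 1 kscale.
Proof. by move=> f; apply: kolm_eq => y /=; rewrite scale1r. Qed.
Lemma kscaleDr : right_distributive kscale +%R.
Proof. by move=> k f g; apply: kolm_eq => y /=; rewrite scalerDr. Qed.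
Lemma kscaleDl f : {morph kscale^~ f : k l / k + l}.
Proof. by move=> k l; apply: kolm_eq => y /=; rewrite scalerDl. Qed.
HB.instance Definition _ := GRing.Zmodule_isLmodule.Build R[i] kolm
  kscaleA kscale1 kscaleDr kscaleDl.

Definition kbnd f (c : R) := 0 <= c /\ forall y, nrm (f y) <= c * vn y.

Lemma kbnd_exists f : exists c, kbnd f c.
Proof.
have [x xP] := kfunP f ltr01; exists (1 + vn x); split.
  by rewrite addr_ge0 ?vn_ge0.
move=> y; have := nrmD (f y - vip y x) (vip y x); rewrite subrK.
by have := xP y; have := vip_cs y x; lra.
Qed.

Lemma appr_vn f x (e c : R) : 0 <= e -> kbnd f c -> appr f x e -> vn x <= c + e.
Proof.
move=> e0 [c0 fc] xP; have [->|nx] := eqVneq (vn x) 0; first exact: addr_ge0.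
have x0 : 0 < vn x by rewrite lt_neqAle eq_sym nx vn_ge0.
rewrite -(ler_pM2r x0) -expr2 vn_sqr.
have := nrmB (f x) (f x - vip x x); rewrite subKr.
by have := xP x; have := fc x; lra.
Qed.

Lemma appr_sub f x z (e d : R) : 0 <= e -> 0 <= d -> appr f x e -> appr f z d ->
  vn (vsub x z) <= e + d.
Proof.
move=> e0 d0 xP zP; have [->|nx] := eqVneq (vn (vsub x z)) 0; first exact: addr_ge0.
have v0 : 0 < vn (vsub x z) by rewrite lt_neqAle eq_sym nx vn_ge0.
rewrite -(ler_pM2r v0) -expr2 vn_sqr; set v := vsub x z.
rewrite {2}/v vip_subr.
have -> : vip v x - vip v z = (f v - vip v z) - (f v - vip v x) by lmod R[i] B.
by apply: le_trans (nrmB _ _) _; have := xP v; have := zP v; lra.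
Qed.

Lemma kfun_sub f x z : f (vsub x z) = f x - f z.
Proof.
apply/eqP; rewrite -subr_eq0; apply/eqP; apply: nrm_eq0; apply/eqP.
rewrite eq_le nrm_ge0 andbT; apply/ler_addgt0Pr => e e0; rewrite add0r.
pose M := vn (vsub x z) + vn x + vn z + 1.
have M0 : 0 < M by rewrite ltr_wpDl // !addr_ge0 // vn_ge0.
have [w wP] := kfunP f (divr_gt0 e0 M0).
have -> : f (vsub x z) - (f x - f z) = (f (vsub x z) - vip (vsub x z) w) -
   (f x - vip x w) + (f z - vip z w) by rewrite vip_subl; lmod R[i] B.
apply: le_trans (nrmD _ _) _.
have := nrmB (f (vsub x z) - vip (vsub x z) w) (f x - vip x w).
have := wP (vsub x z); have := wP x; have := wP z.
have : e / M * M = e by rewrite divfK // gt_eqF.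
have : 0 < e / M by rewrite divr_gt0.
rewrite /M; lra.
Qed.

(** <f, g> is the limit of g along vectors approximating f. The error estimate pins it down
    independently of the approximating sequence. *)
Lemma kip_exists f g : exists b : B, forall (x : V) (e c : R), 0 <= e -> appr f x e ->
  kbnd g c -> nrm (b - g x) <= c * e.
Proof.
have pos n : 0 < n.+1%:R^-1 :> R by rewrite invr_gt0.
have /choice [u uP] n := kfunP f (pos n).
have small (e : R) : 0 < e -> exists N, forall n, (N <= n)%N -> n.+1%:R^-1 < e.
  move=> e0; have ei : 0 <= e^-1 by rewrite invr_ge0 ltW.
  exists (Num.bound e^-1) => n Nn; rewrite -[ltRHS]invrK ltf_pV2 ?posrE ?invr_gt0 //.
  by apply: lt_le_trans (archi_boundP ei) _; rewrite ler_nat leqW.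
have dist x (e c : R) n : 0 <= e -> appr f x e -> kbnd g c ->
    nrm (g (u n) - g x) <= c * (n.+1%:R^-1 + e).
  move=> e0 xP [c0 gc]; rewrite -kfun_sub; apply: le_trans (gc _) _.
  by rewrite ler_wpM2l //; apply: (appr_sub (ltW (pos n)) e0 (uP n) xP).
have [c0 c0P] := kbnd_exists g; have [c00 _] := c0P.
have c1 : 0 < 2 * (c0 + 1) by rewrite mulr_gt0 // ltr_wpDl.
have [|b bP] := @nrm_complete R B (fun n => g (u n)).
  move=> e e0; have [N NP] := small _ (divr_gt0 e0 c1); exists N => m n Nm Nn.
  apply: le_lt_trans (dist _ _ c0 _ (ltW (pos n)) (uP n) c0P) _.
  have h : m.+1%:R^-1 + n.+1%:R^-1 <= 2 * (e / (2 * (c0 + 1))).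
    by rewrite mulr_natl mulr2n; apply: lerD; apply/ltW/NP.
  apply: le_lt_trans (ler_wpM2l c00 h) _.
  have -> : c0 * (2 * (e / (2 * (c0 + 1)))) = e * (c0 / (c0 + 1)).
    by field; rewrite gt_eqF // ltr_wpDl.
  by rewrite gtr_pMr // ltr_pdivrMr ?mul1r ?ltrDl // ltr_wpDl.
exists b => x e c e0 xP gc; have [cc0 _] := gc.
apply/ler_addgt0Pr => d d0.
have d2 : 0 < d / 2 by rewrite divr_gt0.
have c2 : 0 < c + 1 by rewrite ltr_wpDl.
have [N NP] := bP _ d2; have [M MP] := small _ (divr_gt0 d2 c2).
pose n := maxn N M; have := NP n (leq_maxl _ _); have := MP n (leq_maxr _ _).
rewrite ltr_pdivlMr // => h1 h2; move: h1 h2 (dist x e c n e0 xP gc) (pos n).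
move: (n.+1%:R^-1) => t h1 h2 h3 t0; have := nrmB (g (u n) - g x) (g (u n) - b).
have -> : g (u n) - g x - (g (u n) - b) = b - g x by lmod R[i] B.
lra.
Qed.

Definition kip f g : B := sval (cid (kip_exists f g)).

Lemma kip_near f g x (e c : R) : 0 <= e -> appr f x e -> kbnd g c ->
  nrm (kip f g - g x) <= c * e.
Proof. by rewrite /kip; case: cid => /= b h; apply: h. Qed.

(** Restricting to e <= 1 keeps the approximating vectors bounded, so that one constant C serves for
    all e. *)
Lemma kip_unique f g (b : B) (C : R) :
  (forall e : R, 0 < e -> e <= 1 -> exists x, appr f x e /\ nrm (b - g x) <= C * e) ->
  kip f g = b.
Proof.
move=> h; apply/eqP; rewrite -subr_eq0; apply/eqP; apply: nrm_eq0; apply/eqP.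
rewrite eq_le nrm_ge0 andbT; apply/ler_addgt0Pr => e e0; rewrite add0r.
have [c gc] := kbnd_exists g; have [c0 _] := gc.
have M0 : 0 < c + `|C| + 1 by rewrite ltr_wpDl // addr_ge0.
pose d := Num.min (e / (c + `|C| + 1)) 1.
have d0 : 0 < d by rewrite lt_min ltr01 andbT divr_gt0.
have [de d1] : d <= e / (c + `|C| + 1) /\ d <= 1 by rewrite !ge_min !lexx orbT.
have [x [xP bx]] := h d d0 d1.
have -> : kip f g - b = (kip f g - g x) - (b - g x) by lmod R[i] B.
apply: le_trans (nrmB _ _) _.
have := kip_near (ltW d0) xP gc.
have : C * d <= `|C| * d by rewrite ler_wpM2r ?ler_norm // ltW.
by move: de; rewrite ler_pdivlMr //; lra.
Qed.

Lemma kip_vec x y : kip (kvec x) (kvec y) = vip x y.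
Proof.
apply: (@kip_unique _ _ _ 0) => e e0 _; exists x; split => /=.
  by move=> z; rewrite subrr nrm0 mulr_ge0 ?vn_ge0 // ltW.
by rewrite subrr nrm0 mul0r.
Qed.

Lemma kip_Dr f g h : kip f (g + h) = kip f g + kip f h.
Proof.
have [c gc] := kbnd_exists g; have [d hd] := kbnd_exists h.
apply: (@kip_unique _ _ _ (c + d)) => e e0 _; have [x xP] := kfunP f e0.
exists x; split => //=; rewrite opprD addrACA mulrDl.
apply: le_trans (nrmD _ _) _.
by apply: lerD; apply: kip_near => //; apply: ltW.
Qed.

Lemma kip_Zr (k : R[i]) f g : kip f (k *: g) = k *: kip f g.
Proof.
have [c gc] := kbnd_exists g.
apply: (@kip_unique _ _ _ (complex.Re `|k| * c)) => e e0 _; have [x xP] := kfunP f e0.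
have k0 : 0 <= complex.Re `|k| by rewrite normc_def sqrtr_ge0.
exists x; split => //=; rewrite -scalerBr nrmZ -mulrA ler_wpM2l //.
by apply: kip_near => //; apply: ltW.
Qed.

Lemma kip_act f g b : kip f (kact g b) = kip f g * b.
Proof.
have [c gc] := kbnd_exists g.
apply: (@kip_unique _ _ _ (c * nrm b)) => e e0 _; have [x xP] := kfunP f e0.
exists x; split => //=; rewrite -mulrBl; apply: le_trans (nrmM _ _) _.
by rewrite mulrAC ler_wpM2r ?nrm_ge0 //; apply: kip_near => //; apply: ltW.
Qed.

Lemma kip_star f g : star (kip f g) = kip g f.
Proof.
have [c gc] := kbnd_exists g; have [d fd] := kbnd_exists f.
symmetry; apply: (@kip_unique _ _ _ (c + (d + 1) + (c + 1))) => e e0 e1.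
have [x xP] := kfunP g e0; have [y yP] := kfunP f e0.
exists x; split => //.
have -> : star (kip f g) - f x = star (kip f g - g y) + star (g y - vip y x) -
   (f x - vip x y) by rewrite !starB vip_star; lmod R[i] B.
apply: le_trans (nrmB _ _) _.
have := nrmD (star (kip f g - g y)) (star (g y - vip y x)); rewrite !nrm_star.
have := kip_near (ltW e0) yP gc; have := xP y; have := yP x.
have vy := appr_vn (ltW e0) fd yP; have vx := appr_vn (ltW e0) gc xP.
have : e * vn y <= e * (d + 1) by rewrite ler_pM2l //; lra.
have : e * vn x <= e * (c + 1) by rewrite ler_pM2l //; lra.
lra.
Qed.

Lemma kip_self_near f (c : R) : kbnd f c -> forall e : R, 0 < e -> e <= 1 ->
  exists x, appr f x e /\ nrm (kip f f - vip x x) <= (c + (c + 1)) * e.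
Proof.
move=> fc e e0 e1; have [x xP] := kfunP f e0; exists x; split => //.
have -> : kip f f - vip x x = (kip f f - f x) + (f x - vip x x) by lmod R[i] B.
apply: le_trans (nrmD _ _) _; have := kip_near (ltW e0) xP fc; have := xP x.
have vx := appr_vn (ltW e0) fc xP.
have : e * vn x <= e * (c + 1) by rewrite ler_pM2l //; lra.
lra.
Qed.

Lemma kip_pos f : cpos (kip f f).
Proof.
have [c fc] := kbnd_exists f; have [c0 _] := fc.
have M0 : 0 < c + (c + 1) by lra.
apply: cpos_closed => e e0.
pose d := Num.min (e / (c + (c + 1))) 1.
have d0 : 0 < d by rewrite lt_min ltr01 andbT divr_gt0.
have [de d1] : d <= e / (c + (c + 1)) /\ d <= 1 by rewrite !ge_min !lexx orbT.
have [x [_ h]] := kip_self_near fc d0 d1.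
exists (vip x x); split; first exact: vip_pos.
by apply: le_trans h _; rewrite mulrC -ler_pdivlMr.
Qed.

Lemma kip_norm_le f (c : R) : kbnd f c -> nrm (kip f f) <= c ^+ 2.
Proof.
move=> fc; have [c0 _] := fc; apply/ler_addgt0Pr => e e0.
have M0 : 0 < c + c + 1 by rewrite ltr_wpDl // addr_ge0.
have d0 : 0 < e / (c + c + 1) by rewrite divr_gt0.
have [x xP] := kfunP f d0.
have := kip_near (ltW d0) xP fc; have := appr_vn (ltW d0) fc xP.
have := fc.2 x; have := nrmD (kip f f - f x) (f x); rewrite subrK.
have dE : e / (c + c + 1) * (c + c + 1) = e by rewrite divfK // gt_eqF.
set d := e / (c + c + 1) in dE d0 xP *.
move=> h1 h2 h3 h4; have := ler_wpM2l c0 h3; rewrite expr2; lra.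
Qed.

(** For s^2 > |<f, f>| fine approximants of f have length at most s, and Cauchy-Schwarz for them
    passes to the limit. Thus the norm of [kip] dominates the dual norm, which yields definiteness
    and completeness. *)
Lemma kfun_norm_le f y : nrm (f y) ^+ 2 <= nrm (kip f f) * vn y ^+ 2.
Proof.
have [c fc] := kbnd_exists f; have [c0 _] := fc.
set k := nrm (kip f f); have k0 : 0 <= k := nrm_ge0 _.
have H (r : R) : k < r -> nrm (f y) ^+ 2 <= r * vn y ^+ 2.
  move=> kr; pose s := Num.sqrt r.
  have rp : 0 < r := le_lt_trans k0 kr.
  have s2 : s ^+ 2 = r by rewrite sqr_sqrtr // ltW.
  have s0 : 0 <= s := sqrtr_ge0 _.
  rewrite -s2 -exprMn ler_pXn2r ?nnegrE ?mulr_ge0 ?vn_ge0 ?nrm_ge0 //.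
  apply/ler_addgt0Pr => e e0.
  have M0 : 0 < c + (c + 1) by lra.
  have y0 : 0 < vn y + 1 by rewrite ltr_wpDl ?vn_ge0.
  pose d := Num.min (Num.min ((r - k) / (c + (c + 1))) (e / (vn y + 1))) 1.
  have rk : 0 < r - k by rewrite subr_gt0.
  have d0 : 0 < d by rewrite !lt_min ltr01 andbT !divr_gt0.
  have [d1 d2 d3] : [/\ d <= (r - k) / (c + (c + 1)), d <= e / (vn y + 1) & d <= 1].
    by rewrite !ge_min !lexx !orbT.
  have [x [xP xx]] := kip_self_near fc d0 d3.
  have vx : vn x <= s.
    rewrite -(ler_pXn2r (ltn0Sn 1)) ?nnegrE ?vn_ge0 // vn_sqr s2.
    have := nrmB (kip f f) (kip f f - vip x x); rewrite subKr -/k.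
    by move: d1; rewrite ler_pdivlMr //; lra.
  have := nrmD (f y - vip y x) (vip y x); rewrite subrK.
  have := xP y; have := vip_cs y x; have := ler_wpM2l (vn_ge0 y) vx.
  by move: d2; rewrite ler_pdivlMr //; have := vn_ge0 y; lra.
apply/ler_addgt0Pr => e e0.
have y0 : 0 < vn y ^+ 2 + 1 by rewrite ltr_wpDl // exprn_ge0 // vn_ge0.
apply: le_trans (H (k + e / (vn y ^+ 2 + 1)) _) _.
  by rewrite ltrDl divr_gt0.
by rewrite mulrDl lerD2l mulrAC ler_pdivrMr // ler_pM2l // lerDl.
Qed.

Lemma kip_eq0 f : kip f f = 0 -> f = 0.
Proof.
move=> f0; apply: kolm_eq => y.
have := kfun_norm_le f y; rewrite f0 nrm0 mul0r => h.
have -> : f y = 0.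
  by apply: nrm_eq0; apply/eqP; rewrite -sqrf_eq0 eq_le h exprn_ge0 ?nrm_ge0.
by rewrite [RHS]/(vip y [::]) /vip big1 // => p _; rewrite big_nil.
Qed.

Lemma kactDl f g b : kact (f + g) b = kact f b + kact g b.
Proof. by apply: kolm_eq => y /=; rewrite mulrDl. Qed.
Lemma kactDr f b c : kact f (b + c) = kact f b + kact f c.
Proof. by apply: kolm_eq => y /=; rewrite mulrDr. Qed.
Lemma kactM f b c : kact f (b * c) = kact (kact f b) c.
Proof. by apply: kolm_eq => y /=; rewrite mulrA. Qed.
Lemma kact1 f : kact f 1 = f.
Proof. by apply: kolm_eq => y /=; rewrite mulr1. Qed.
Lemma kactZl (k : R[i]) f b : kact (k *: f) b = k *: kact f b.
Proof. by apply: kolm_eq => y /=; rewrite scalAl. Qed.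
Lemma kactZr (k : R[i]) f b : kact f (k *: b) = k *: kact f b.
Proof. by apply: kolm_eq => y /=; rewrite scalAr. Qed.

HB.instance Definition _ := @isPreHilbertModule.Build R B kolm kact kip
  kactDl kactDr kactM kact1 kactZl kactZr kip_Dr kip_Zr kip_act kip_star kip_pos kip_eq0.

Lemma kolm_hnorm_le f (c : R) : kbnd f c -> hnorm f <= c%:C.
Proof.
move=> fc; have [c0 _] := fc; rewrite /hnorm normE.
have n0 : 0 <= (nrm (kip f f))%:C by rewrite lecR nrm_ge0.
have c0C : 0 <= c%:C by rewrite lecR.
rewrite -(ler_pXn2r (ltn0Sn 1)) ?nnegrE ?sqrtC_ge0 //.
by rewrite sqrtCK -rmorphXn lecR; apply: kip_norm_le.
Qed.

Lemma kfun_hnorm_lt f y (e : R) : hnorm f < e%:C -> nrm (f y) <= e * vn y.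
Proof.
rewrite /hnorm normE => fe.
have n0 : 0 <= (nrm (kip f f))%:C by rewrite lecR nrm_ge0.
have e0 : 0 < e.
  by rewrite -ltcR; apply: le_lt_trans fe; rewrite sqrtC_ge0.
rewrite -(ler_pXn2r (ltn0Sn 1)) ?nnegrE ?mulr_ge0 ?vn_ge0 ?nrm_ge0 //; last exact: ltW.
apply: le_trans (kfun_norm_le f y) _; rewrite exprMn ler_wpM2r ?exprn_ge0 ?vn_ge0 //.
have : sqrtC (nrm (kip f f))%:C ^+ 2 <= e%:C ^+ 2.
  by rewrite ler_pXn2r ?nnegrE ?sqrtC_ge0 // ?lecR ltW.
by rewrite sqrtCK -rmorphXn lecR.
Qed.

(** The pointwise limit is approached uniformly in the dual norm, so vectors close to a late member
    of the sequence approximate the limit too. *)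
Lemma kolm_complete (u : nat -> kolm) :
  (forall e : R[i], 0 < e -> exists N, forall m n,
     (N <= m)%N -> (N <= n)%N -> hnorm (u m - u n) < e) ->
  exists l : kolm, forall e : R[i], 0 < e -> exists N, forall n,
     (N <= n)%N -> hnorm (u n - l) < e.
Proof.
move=> uC.
have {uC}uC (e : R) : 0 < e -> exists N, forall m n, (N <= m)%N -> (N <= n)%N ->
    forall y, nrm (u m y - u n y) <= e * vn y.
  move=> e0; have [|N NP] := uC e%:C; first by rewrite ltcR.
  exists N => m n Nm Nn y; have := kfun_hnorm_lt y (NP m n Nm Nn).
  by rewrite -[(u m - u n) y]/(u m y + -1 *: u n y) scaleN1r.
have /choice [l lP] y : exists b, clim (fun n => u n y) b.
  apply: nrm_complete => e e0; have y0 : 0 < vn y + 1 by rewrite ltr_wpDl ?vn_ge0.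
  have [N NP] := uC _ (divr_gt0 e0 y0); exists N => m n Nm Nn.
  apply: le_lt_trans (NP m n Nm Nn y) _.
  by rewrite mulrAC ltr_pdivrMr // ltr_pM2l // ltrDl.
have ul (e : R) : 0 < e -> exists N, forall n, (N <= n)%N ->
    forall y, nrm (u n y - l y) <= e * vn y.
  move=> e0; have [N NP] := uC e e0; exists N => n Nn y.
  apply/ler_addgt0Pr => d d0; have [M MP] := lP y d d0.
  have := NP n (maxn N M) Nn (leq_maxl _ _) y; have := MP _ (leq_maxr N M).
  have := nrmD (u n y - u (maxn N M) y) (u (maxn N M) y - l y).
  by rewrite addrA subrK; lra.
have lk (e : R) : 0 < e -> exists x, appr l x e.
  move=> e0; have e2 : 0 < e / 2 by rewrite divr_gt0.
  have [N NP] := ul _ e2; have [x xP] := kfunP (u N) e2; exists x => y.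
  have -> : l y - vip y x = (u N y - vip y x) - (u N y - l y) by lmod R[i] B.
  by apply: le_trans (nrmB _ _) _; have := NP _ (leqnn N) y; have := xP y; lra.
exists (Kolm lk) => e /[dup] e0; case: e e0 => e e' e0; rewrite ltcE /= => /andP [/eqP E r0].
have e2 : 0 < e / 2 by rewrite divr_gt0.
have [N NP] := ul _ e2; exists N => n Nn.
apply: (@le_lt_trans _ _ (e / 2)%:C); last by rewrite ltcE /= E eqxx /=; lra.
apply: kolm_hnorm_le; split; first exact: ltW.
move=> y; rewrite -[(u n - Kolm lk) y]/(u n y + -1 *: l y) scaleN1r.
exact: NP.
Qed.

HB.instance Definition _ := @isHilbertModule.Build R B kolm kolm_complete.

Definition kdelta (i : I) : kolm := kvec [:: (i, 1)].

Lemma kdelta_ip i j : ip (kdelta i) (kdelta j) = K i j.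
Proof.
rewrite [LHS]kip_vec /vip !big_seq1 /= star1 mul1r mulr1 //.
Qed.

Lemma kdelta_dense : dense (fun p : I * B => ract (kdelta p.1) p.2).
Proof.
move=> f e e0; have e2 : 0 < e / 2 by rewrite divr_gt0.
have [x xP] := kfunP f e2; exists [seq (1, p) | p <- x].
apply: (@le_lt_trans _ _ (e / 2)); last by lra.
rewrite -lecR -hnormE; apply: kolm_hnorm_le; split; first exact: ltW.
move=> y; set g := comb _ _.
have -> : (f - g) y = f y - vip y x; last exact: xP.
rewrite -[LHS]/(f y + -1 *: g y) scaleN1r; congr (_ - _).
rewrite /g; elim: x {xP g} => [|p x IH].
  by rewrite comb_nil.
rewrite comb_cons; have -> : vip y (p :: x) = vip y [:: p] + vip y x by rewrite -vip_catr.
rewrite -IH.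
set g := comb _ _; rewrite -[LHS]/(1 *: (vip y [:: (p.1, 1)] * p.2) + kfun g y) scale1r.
congr (_ + _); rewrite /vip mulr_suml; apply: eq_bigr => q _.
by rewrite !big_seq1 /= mulr1.
Qed.

End Kolmogorov.

Theorem kolmogorov (R : realType) (B : cstarAlg R) (I : Type) (K : pd_kernel B I) :
  exists (H : hilbModType B) (v : I -> H), (forall i j, ip (v i) (v j) = K i j) /\
    dense (fun p : I * B => ract (v p.1) p.2).
Proof.
exists (kolm K), (@kdelta R B I K).
by split; [exact: kdelta_ip | exact: kdelta_dense].
Qed.

(** * The Gram kernel of a unit *)

(** What the half line and the natural numbers share: cancellation, no negatives, and comparability
    of any two times. *)
Record linear_time (S : nmodType) : Prop := LinearTime {
  lt_can : forall r s t : S, r + t = s + t -> r = s;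
  lt_con : forall r s : S, r + s = 0 -> r = 0;
  lt_tot : forall s t : S, exists r, t = r + s \/ s = r + t
}.

Lemma time_linear (R : realType) (k : time_kind) : linear_time (time R k).
Proof.
case: k; split.
- move=> r s t /(congr1 (@hl_val R)) /= /addIr h; exact: val_inj.
- move=> r s /(congr1 (@hl_val R)) /= rs0; apply: val_inj => /=.
  by have := hl_ge0 r; have := hl_ge0 s; lra.
- move=> s t; have [st|/ltW st] := leP (hl_val s) (hl_val t).
    have h : 0 <= hl_val t - hl_val s by rewrite subr_ge0.
    by exists (HalfLine h); left; apply: val_inj; rewrite /= subrK.
  have h : 0 <= hl_val s - hl_val t by rewrite subr_ge0.
  by exists (HalfLine h); right; apply: val_inj; rewrite /= subrK.
- by move=> r s t /addIn.
- by move=> [|r] s.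
- move=> s t; case/orP: (leq_total s t) => st.
    by exists (t - s)%N; left; rewrite -[LHS](subnK st).
  by exists (s - t)%N; right; rewrite -[LHS](subnK st).
Qed.

Section Unitary.
Variables (R : realType) (B : cstarAlg R).

Lemma unitary_ip (E F : hilbModType B) (u : unitary E F) x y : ip (u x) (u y) = ip x y.
Proof.
rewrite op_adjP; congr (ip x _).
exact: (congr1 (fun a : adjop E E => a y) (un_starL u)).
Qed.

Lemma unitary_adjK (E F : hilbModType B) (u : unitary E F) y : u (op_adj u y) = y.
Proof. exact: (congr1 (fun a : adjop F F => a y) (un_starR u)). Qed.
End Unitary.

Section Index.
Variables (R : realType) (B : cstarAlg R) (S : nmodType).
Hypothesis HS : linear_time S.
Variables (E : product_system B S) (xi : psunit E).

Lemma pmul_ip s t (x x' : E s) (y y' : E t) :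
  ip (pmul x y) (pmul x' y') = ip y (lact (ip x x') y').
Proof. by rewrite /pmul unitary_ip it_ip. Qed.

Lemma pmul_ractr s t (x : E s) (y : E t) b : pmul x (ract y b) = ract (pmul x y) b.
Proof. by rewrite /pmul -it_ract bu_ract. Qed.

Lemma pmul_lactl s t (x : E s) (y : E t) b : pmul (lact b x) y = lact b (pmul x y).
Proof. by rewrite /pmul -it_lact bu_lact. Qed.

Lemma pmul_dense s t : dense (fun p : E s * E t => pmul p.1 p.2).
Proof.
have d : dense (fun p : E s * E t => it_tens (pd_tens E s t) p.1 p.2).
  apply: (total_dense (it_total (i := pd_tens E s t))) => _ [x [y ->]].
  by exists (x, y).
move=> z e e0; set u := pd_u E s t.
have [L LP] := d (op_adj u z) e e0; exists L.
rewrite -(unitary_adjK u z).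
have -> : comb (fun p : E s * E t => pmul p.1 p.2) L =
    u (comb (fun p : E s * E t => it_tens (pd_tens E s t) p.1 p.2) L).
  by rewrite (bl_comb _ _ (adjop_blin u)).
by rewrite -opB /hn unitary_ip.
Qed.

Lemma pmulDr s t (x : E s) (y y' : E t) : pmul x (y + y') = pmul x y + pmul x y'.
Proof.
apply: (dense_ip_eq (@pmul_dense s t)) => -[a b] /=.
by rewrite ipDr !pmul_ip opD ipDr.
Qed.

Lemma pmulZr s t (k : R[i]) (x : E s) (y : E t) : pmul x (k *: y) = k *: pmul x y.
Proof.
apply: (dense_ip_eq (@pmul_dense s t)) => -[a b] /=.
by rewrite ipZr !pmul_ip opZ ipZr.
Qed.

(** Bundling a vector with its time absorbs transports ([mk_ptr]), so associativity and the unit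
    laws become plain equalities. *)
Definition idx := {t : S & E t}.
HB.instance Definition _ := gen_eqMixin idx.
Definition mk t (x : E t) : idx := existT (fun t => E t) t x.
Implicit Types p q w : idx.

Lemma mk_ptr s t (e : s = t) (x : E s) : mk (ptr e x) = mk x.
Proof. by case: t / e. Qed.

Definition imul p q : idx := mk (pmul (projT2 p) (projT2 q)).
Definition iact p (b : B) : idx := mk (ract (projT2 p) b).
Definition gam r q := imul (mk (xi r)) q.

Lemma imulA p q w : imul p (imul q w) = imul (imul p q) w.
Proof. by rewrite /imul -ps_mulA mk_ptr. Qed.

Lemma gam0 q : gam 0 q = q.
Proof.
case: q => t x; rewrite /gam /imul /= pu_zero.
rewrite -[LHS](mk_ptr (add0r t)) ps_mul1l.
by rewrite lact1E.
Qed.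

Lemma gamD r s q : gam r (gam s q) = gam (r + s) q.
Proof. by rewrite /gam imulA /imul /= pu_mul. Qed.

Lemma gam_mul r p q : gam r (imul p q) = imul (gam r p) q.
Proof. exact: imulA. Qed.

Lemma gam_act r p b : gam r (iact p b) = iact (gam r p) b.
Proof. by rewrite /gam /iact /imul /= pmul_ractr. Qed.

Lemma imul1r p : imul p (mk (pd_one E (1 : B))) = p.
Proof.
case: p => t x; rewrite /imul /=.
rewrite -[LHS](mk_ptr (addr0 t)) ps_mul1r.
by rewrite ract1.
Qed.

(** The value 0 at distinct times is a mere default: [gram] compares vectors at equal times only. *)
Definition ipI p q : B :=
  match pselect (projT1 p = projT1 q) with
  | left e => ip (ptr e (projT2 p)) (projT2 q)
  | right _ => 0
  end.

Lemma ipI_same t (x y : E t) : ipI (mk x) (mk y) = ip x y.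
Proof.
rewrite /ipI /=; case: pselect => // e.
by rewrite (Prop_irrelevance e erefl).
Qed.

Lemma ipI_star p q : star (ipI p q) = ipI q p.
Proof.
case: p q => s x [t y]; have [st|st] := pselect (s = t).
  by case: t / st y => y; rewrite !ipI_same ip_star.
rewrite /ipI /=; case: pselect => // _; case: pselect => [e|_]; last by rewrite star0.
by case: st.
Qed.

Lemma ipI_act p q b c : ipI (iact p b) (iact q c) = star b * ipI p q * c.
Proof.
case: p q => s x [t y]; have [st|st] := pselect (s = t).
  by case: t / st y => y; rewrite !ipI_same ip_ract ip_ractl.
by rewrite /ipI /=; case: pselect => // _; rewrite mulr0 mul0r.
Qed.

Lemma ipI_mul p q t (y y' : E t) : projT1 p = projT1 q ->
  ipI (imul p (mk y)) (imul q (mk y')) = ip y (lact (ipI p q) y').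
Proof.
case: p q => s x [s' x'] /= ss'; case: s' / ss' x' => x'.
by rewrite /imul /= !ipI_same pmul_ip.
Qed.

Lemma ipI_Dr w t (y y' : E t) : ipI w (mk (y + y')) = ipI w (mk y) + ipI w (mk y').
Proof.
case: w => s x; have [st|st] := pselect (s = t).
  by case: t / st y y' => y y'; rewrite !ipI_same ipDr.
by rewrite /ipI /=; case: pselect => // _; rewrite addr0.
Qed.

Lemma ipI_Zr w t (k : R[i]) (y : E t) : ipI w (mk (k *: y)) = k *: ipI w (mk y).
Proof.
case: w => s x; have [st|st] := pselect (s = t).
  by case: t / st y => y; rewrite !ipI_same ipZr.
by rewrite /ipI /=; case: pselect => // _; rewrite scaler0.
Qed.

(* <v_s x, v_t y> for the embeddings v_t : E_t -> E into the dilation space. *)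
Definition gram p q : B :=
  match pselect (exists r, projT1 p = r + projT1 q) with
  | left h => ipI p (gam (sval (cid h)) q)
  | right _ =>
    match pselect (exists r, projT1 q = r + projT1 p) with
    | left h => ipI (gam (sval (cid h)) p) q
    | right _ => 0
    end
  end.

Lemma gram_ge p q r : projT1 p = r + projT1 q -> gram p q = ipI p (gam r q).
Proof.
move=> pq; rewrite /gram; case: pselect => [h|]; last by case; exists r.
case: cid => /= u; rewrite pq => /(lt_can HS) <- //.
Qed.

(** If the first branch of [gram] applies as well, the two time differences add up to 0, hence
    vanish, and both formulas give the same inner product. *)
Lemma gram_le p q r : projT1 q = r + projT1 p -> gram p q = ipI (gam r p) q.
Proof.
move=> pq; rewrite /gram; case: pselect => [h|_].
  case: cid => /= u uE; have : r + u = 0.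
    apply: (lt_can HS (t := projT1 q)); rewrite add0r {2}pq uE.
    by rewrite addrA.
  move=> /[dup] /(lt_con HS) ->; rewrite addrC => /(lt_con HS) ->.
  by rewrite !gam0.
case: pselect => [h|]; last by case; exists r.
case: cid => /= u; rewrite pq => /(lt_can HS) <- //.
Qed.

Lemma time_cases (P : idx -> idx -> Prop) :
  (forall p q r, projT1 p = r + projT1 q -> P p q) ->
  (forall p q r, projT1 q = r + projT1 p -> P p q) -> forall p q, P p q.
Proof.
move=> h1 h2 p q; have [r [e|e]] := lt_tot HS (projT1 p) (projT1 q).
  exact: h2 e.
exact: h1 e.
Qed.

Lemma gram_star p q : star (gram p q) = gram q p.
Proof.
move: p q; apply: time_cases => p q r e.
  by rewrite (gram_ge e) (gram_le e) ipI_star.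
by rewrite (gram_ge e) (gram_le e) ipI_star.
Qed.

Lemma gram_act p q b c : gram (iact p b) (iact q c) = star b * gram p q * c.
Proof.
move: p q; apply: time_cases => p q r e.
  by rewrite (@gram_ge p q r) // (@gram_ge _ _ r) // gam_act ipI_act.
by rewrite (@gram_le p q r) // (@gram_le _ _ r) // gam_act ipI_act.
Qed.

Lemma gram_same t (x y : E t) : gram (mk x) (mk y) = ip x y.
Proof. by rewrite (@gram_ge _ _ 0) /= ?add0r // gam0 ipI_same. Qed.

(** The unit is inserted on the left, so a factor on the right is not affected; this makes [vm] an
    isometry. *)
Lemma gram_mul p q t (y y' : E t) :
  gram (imul p (mk y)) (imul q (mk y')) = ip y (lact (gram p q) y').
Proof.
move: p q; apply: time_cases => p q r e.
  rewrite (gram_ge e) (@gram_ge _ _ r) /= ?e ?addrA //.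
  by rewrite gam_mul ipI_mul.
rewrite (gram_le e) (@gram_le _ _ r) /= ?e ?addrA //.
by rewrite gam_mul ipI_mul.
Qed.

Lemma gram_Dr w t (y y' : E t) : gram w (mk (y + y')) = gram w (mk y) + gram w (mk y').
Proof.
have [r [e|e]] := lt_tot HS (projT1 w) t.
  by rewrite !(@gram_le w _ r) // ipI_Dr.
rewrite !(@gram_ge w _ r) // -ipI_Dr; congr ipI.
by rewrite /gam /imul /= pmulDr.
Qed.

Lemma gram_Zr w t (k : R[i]) (y : E t) : gram w (mk (k *: y)) = k *: gram w (mk y).
Proof.
have [r [e|e]] := lt_tot HS (projT1 w) t.
  by rewrite !(@gram_le w _ r) // ipI_Zr.
rewrite !(@gram_ge w _ r) // -ipI_Zr; congr ipI.
by rewrite /gam /imul /= pmulZr.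
Qed.

Lemma gram_Dl w t (y y' : E t) : gram (mk (y + y')) w = gram (mk y) w + gram (mk y') w.
Proof. by rewrite -gram_star gram_Dr starD !gram_star. Qed.

(** Seen from times after r + t, a vector q at time t and xi_r (.) q look alike. *)
Lemma gram_gamr w q r u : projT1 w = u + (r + projT1 q) -> gram w (gam r q) = gram w q.
Proof.
move=> e; rewrite (@gram_ge w q (u + r)) ?e ?addrA //.
by rewrite (@gram_ge w (gam r q) u) // gamD.
Qed.

Lemma gram_gaml w q r u : projT1 w = u + (r + projT1 q) -> gram (gam r q) w = gram q w.
Proof. by move=> e; rewrite -gram_star (gram_gamr e) gram_star. Qed.

Definition qform (L : seq idx) : B := \sum_(p <- L) \sum_(q <- L) gram p q.

Lemma qform_cons p L : qform (p :: L) =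
  gram p p + (\sum_(q <- L) gram p q + \sum_(q <- L) gram q p) + qform L.
Proof.
rewrite /qform !big_cons.
have -> : \sum_(j <- L) \sum_(q <- (p :: L)) gram j q =
    \sum_(j <- L) gram j p + \sum_(j <- L) \sum_(q <- L) gram j q.
  by rewrite -big_split; apply: eq_bigr => j _; rewrite big_cons.
by rewrite !addrA.
Qed.

Definition leT p q : bool := `[< exists r, projT1 q = r + projT1 p >].

Lemma leT_trans : transitive leT.
Proof.
move=> q p w /asboolP [r e] /asboolP [u e']; apply/asboolP.
by exists (u + r); rewrite e' e addrA.
Qed.

Lemma leT_total p q : leT p q || leT q p.
Proof.
have [r [e|e]] := lt_tot HS (projT1 p) (projT1 q).
  by apply/orP; left; apply/asboolP; exists r.
by apply/orP; right; apply/asboolP; exists r.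
Qed.

Hypothesis xi_contr : contractive_unit xi.

(** Contractivity makes 1 - <xi_r, xi_r> = c^*c, and the defect equals <c x, c x>. *)
Lemma gram_gam_defect p r : cpos (gram p p - gram (gam r p) (gam r p)).
Proof.
case: p => t x; rewrite /gam /imul /= !gram_same pmul_ip.
have [c cE] := xi_contr r.
have -> : ip x x - ip x (lact (ip (xi r) (xi r)) x) = ip (lact c x) (lact c x).
  by rewrite lact_ip -lactME -cE lactBE ipBr lact1E.
exact: ip_pos.
Qed.

(* Replacing the two earliest vectors x, y by y + xi_r (.) x changes the form *)
(* by the positive element |x|^2 - |xi_r (.) x|^2.                            *)
Lemma qform_sorted L : sorted leT L -> cpos (qform L).
Proof.
elim: {L}(size L) {-2}L (leqnn (size L)) => [|n IH] [|p [|q L]] //= sz.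
- by move=> _; rewrite /qform big_nil; apply: cpos0.
- by move=> _; rewrite /qform big_nil; apply: cpos0.
- move=> _; rewrite /qform !big_seq1; case: p => t x; rewrite gram_same.
  exact: ip_pos.
move=> /andP [/asboolP [r pq] qL].
have qLall := order_path_min leT_trans qL.
pose p' := gam r p.
have tp' : projT1 p' = projT1 q by rewrite pq.
(* All remaining times are at least that of q, so [gram_gamr] lets p' replace p in the mixed
   terms. *)
have p'E w : w \in q :: L -> gram p w = gram p' w /\ gram w p = gram w p'.
  move=> wq; have [u wu] : exists u, projT1 w = u + (r + projT1 p).
    rewrite -pq; move: wq; rewrite in_cons => /orP [/eqP ->|wL].
      by exists 0; rewrite add0r.
    by move/allP: qLall => /(_ w wL) /asboolP.
  by rewrite (gram_gamr wu) (gram_gaml wu).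
have -> : qform [:: p, q & L] = (gram p p - gram p' p') + qform [:: p', q & L].
  rewrite !(qform_cons _ (q :: L)).
  have -> : \sum_(w <- q :: L) gram p w = \sum_(w <- q :: L) gram p' w.
    by apply: eq_big_seq => w /p'E [].
  have -> : \sum_(w <- q :: L) gram w p = \sum_(w <- q :: L) gram w p'.
    by apply: eq_big_seq => w /p'E [].
  by lmod R[i] B.
apply: cposD; first exact: gram_gam_defect.
case: q p' tp' pq qL {qLall p'E} sz => s y [s' x] /= ss'; case: s / ss' y => y pq qL sz.
(* Now the first two vectors live at the same time and merge into their sum, which shortens the
   list. *)
have -> : qform [:: mk x, mk y & L] = qform (mk (y + x) :: L).
  rewrite !qform_cons !big_cons !gram_Dl !gram_Dr.
  have -> : \sum_(q <- L) gram (mk (y + x)) q =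
     \sum_(q <- L) gram (mk y) q + \sum_(q <- L) gram (mk x) q.
    by rewrite -big_split; apply: eq_bigr => q _; rewrite gram_Dl.
  have -> : \sum_(q <- L) gram q (mk (y + x)) =
     \sum_(q <- L) gram q (mk y) + \sum_(q <- L) gram q (mk x).
    by rewrite -big_split; apply: eq_bigr => q _; rewrite gram_Dr.
  by lmod R[i] B.
apply: IH => //=; case: L qL {sz} => //=.
Qed.

Lemma qform_pos L : cpos (qform L).
Proof.
have := qform_sorted (sort_sorted leT_total L); congr cpos.
have pL : perm_eq (sort leT L) L by rewrite perm_sort.
rewrite /qform (perm_big _ pL) /=; apply: eq_bigr => p _.
exact: perm_big.
Qed.

Lemma gram_pos (L : seq (idx * B)) :
  cpos (\sum_(u <- L) \sum_(v <- L) star u.2 * gram u.1 v.1 * v.2).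
Proof.
have := qform_pos [seq iact u.1 u.2 | u <- L]; congr cpos.
rewrite /qform big_map; apply: eq_bigr => u _; rewrite big_map.
by apply: eq_bigr => v _; rewrite gram_act.
Qed.

Definition gram_kernel : pd_kernel B idx := PDKernel gram_star gram_pos.

End Index.

(** * Construction of the dilation *)

Lemma ketbraE (R : realType) (B : cstarAlg R) (E F : hilbModType B) (x : F) (y z : E) :
  ketbra x y z = ract x (ip y z).
Proof. by []. Qed.

Section Realization.
Variables (R : realType) (B : cstarAlg R) (S : nmodType).
Hypothesis HS : linear_time S.
Variables (E : product_system B S) (xi : psunit E) (H : hilbModType B).
Variable v : idx E -> H.
Hypothesis v_ip : forall p q, ip (v p) (v q) = gram xi p q.
Hypothesis v_dense : dense v.
Implicit Types (p q w : idx E) (z : H).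

Let gram_ge := @gram_ge R B S HS E xi.
Let gram_le := @gram_le R B S HS E xi.

Lemma vD t (x y : E t) : v (mk (x + y)) = v (mk x) + v (mk y).
Proof.
by apply: (dense_ip_eq v_dense) => p; rewrite ipDr !v_ip (gram_Dr HS).
Qed.
Lemma vZ t (k : R[i]) (x : E t) : v (mk (k *: x)) = k *: v (mk x).
Proof.
by apply: (dense_ip_eq v_dense) => p; rewrite ipZr !v_ip (gram_Zr HS).
Qed.
Lemma v_act p b : v (iact p b) = ract (v p) b.
Proof.
apply: (dense_ip_eq v_dense) => q; rewrite ip_ract !v_ip.
have q1 : iact q 1 = q by case: q => t x; rewrite /iact ract1.
by rewrite -[in LHS]q1 (gram_act HS) star1 mul1r.
Qed.
Lemma v_isom t (x y : E t) : ip (v (mk x)) (v (mk y)) = ip x y.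
Proof. by rewrite v_ip (gram_same HS). Qed.
Lemma hn_v t (x : E t) : hn (v (mk x)) = hn x.
Proof. by rewrite /hn v_isom. Qed.
Lemma vB t (x y : E t) : v (mk (x - y)) = v (mk x) - v (mk y).
Proof. by rewrite vD -scaleN1r vZ scaleN1r. Qed.
Lemma v_comb t (I : Type) (f : I -> E t) L : v (mk (comb f L)) = comb (fun i => v (mk (f i))) L.
Proof.
elim: L => [|p L IH]; last by rewrite !comb_cons vD vZ IH.
by rewrite !comb_nil -(scale0r 0) vZ scale0r.
Qed.

Definition vmul t (y : E t) p := v (imul p (mk y)).

Lemma vmul_ip t (y y' : E t) L M :
  ip (comb (vmul y) L) (comb (vmul y') M) = ip y (lact (ip (comb v L) (comb v M)) y').
Proof.
elim: M => [|q M IH]; first by rewrite !comb_nil !ip0r lact0E ip0r.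
rewrite !comb_cons !ipDr !ipZr lactDE lactZE ipDr ipZr -IH; congr (_ *: _ + _).
elim: L {IH} => [|p L IH]; first by rewrite !comb_nil !ip0l lact0E ip0r.
rewrite !comb_cons !ipDl !ipZl lactDE lactZE ipDr ipZr -IH; congr (_ *: _ + _).
by rewrite /vmul !v_ip (gram_mul HS).
Qed.

(** By [vmul_ip] the image of z has square <y, <z, z> y>, at most |y|^2 |z|^2. *)
Lemma vm_exists t (y : E t) : exists f : H -> H, blin f /\ forall p, f (v p) = vmul y p.
Proof.
have [||f [f1 f2 _]] := @blin_extend _ _ _ _ _ v (vmul y) (hn y) v_dense.
- exact: hn_ge0.
- move=> L; rewrite -(ler_pXn2r (ltn0Sn 1)) ?nnegrE ?mulr_ge0 ?hn_ge0 //.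
  rewrite hn_sqr vmul_ip; apply: le_trans (cauchy_schwarz _ _) _.
  rewrite exprMn [hn (comb v L) ^+ 2]hn_sqr.
  apply: le_trans (ler_wpM2l (hn_ge0 _) (lact_bound _ _)) _.
  by rewrite mulrCA mulrC -expr2.
by exists f.
Qed.

(* The isometry from the tensor product of H and E_t into H.                  *)
Definition vm t z (y : E t) : H := sval (cid (vm_exists y)) z.

Lemma vm_blin t (y : E t) : blin (fun z => vm z y).
Proof. by rewrite /vm; case: cid => f []. Qed.
Lemma vm_v t (y : E t) p : vm (v p) y = v (imul p (mk y)).
Proof. by rewrite /vm; case: cid => f [? h] /=; rewrite h. Qed.

Lemma blin_ip_vm t (y y' : E t) z : blin (fun z' => ip y (lact (ip z z') y') : regular B).
Proof.
have l : blin ((fun b => lact b y') : regular B -> E t).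
  split => [b c|k b|]; [exact: lactDE | exact: lactZE |].
  exists (hn y'); split; first exact: hn_ge0.
  by move=> b; rewrite reg_hn mulrC lact_bound.
exact: (blin_comp (blin_ip y) (blin_comp l (blin_ip z))).
Qed.

Lemma vm_ip t z (y : E t) z' (y' : E t) :
  ip (vm z y) (vm z' y') = ip y (lact (ip z z') y').
Proof.
(* Density extends identities in the second argument; taking adjoints exchanges the arguments, so it
   can be used for each in turn. *)
have flip u (a : E t) u' (a' : E t) : ip (vm u a) (vm u' a') = ip a (lact (ip u u') a') ->
    ip (vm u' a') (vm u a) = ip a' (lact (ip u' u) a).
  by move=> h; rewrite -ip_star h ip_star lact_ip ip_star.
have ext u (a : E t) (a' : E t) :
    (forall q, ip (vm u a) (vm (v q) a') = ip a (lact (ip u (v q)) a')) ->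
    forall u', ip (vm u a) (vm u' a') = ip a (lact (ip u u') a').
  move=> h; apply: (@blin_eq_dense _ _ _ _ (regular B) v _ _ v_dense _ _ h).
    exact: (blin_comp (blin_ip (vm u a)) (vm_blin a')).
  exact: blin_ip_vm.
apply: (ext z y y') => q; apply: flip; apply: (ext (v q) y' y) => p.
by rewrite !vm_v !v_ip (gram_mul HS).
Qed.

Definition vone : idx E := mk (pd_one E (1 : B)).
Definition vxi : H := v vone.

Lemma pd_oneE b : pd_one E b = ract (pd_one E (1 : B)) b.
Proof. by rewrite -bu_ract; congr (pd_one E _); exact: (esym (mul1r b)). Qed.

Lemma vxi_unit : ip vxi vxi = 1.
Proof.
rewrite v_isom unitary_ip; exact: (etrans (mulr1 (star (1 : B))) (star1 B)).
Qed.

Lemma imul1l p : imul vone p = p.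
Proof. by have := gam0 xi p; rewrite /gam pu_zero. Qed.

Lemma vm_xi t (y : E t) : vm vxi y = v (mk y).
Proof. by rewrite vm_v imul1l. Qed.

Lemma vm_one z : vm z (pd_one E (1 : B)) = z.
Proof.
move: z; apply: (blin_eq_dense v_dense) => [||p].
- exact: vm_blin.
- by split => //; exists 1; split => // z; rewrite mul1r.
- by rewrite vm_v imul1r.
Qed.

Lemma perp_v t (g : H) : (forall p (y : E t), ip (v (imul p (mk y))) g = 0) ->
  m_perp (@vm t) g.
Proof.
move=> h z y; rewrite -ip_star [X in star X](_ : _ = 0) ?star0 //; move: z.
apply: (@blin_eq_dense _ _ _ _ (regular B) v (fun z => ip g (vm z y)) (fun=> 0) v_dense).
- exact: (blin_comp (blin_ip g) (vm_blin y)).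
- split => [*|*|]; rewrite ?addr0 ?scaler0 //.
  by exists 0; split => // z; rewrite hn0 mul0r.
- by move=> p; rewrite vm_v -ip_star h star0.
Qed.

(** A vector at a time r >= t is a limit of sums of products with right factor in E_t. At an earlier
    time, v y is v (xi_q (.) y) plus a vector orthogonal to H (.) E_t. *)
Lemma vm_dense t : dense (amp_fam (m := @vm t)).
Proof.
apply: (dense_trans v_dense) => -[r y] e e0.
have [q [rE|tE]] := lt_tot HS t r.
  subst r; have [L LP] := pmul_dense y e0.
  exists [seq (l.1, inl (v (mk l.2.1), l.2.2)) | l <- L].
  rewrite -[existT _ _ _]/(mk y); congr (_ < e): LP.
  rewrite (comb_map _ (fun l => inl (v (mk l.1), l.2))) -hn_v vB v_comb; congr (hn (_ - comb _ _)).
  by apply/funext => l /=; rewrite vm_v.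
subst t; pose y' := pmul (xi q) y.
have gp : m_perp (@vm (q + r)) (v (mk y) - v (mk y')).
  apply: perp_v => p x; rewrite ipBr !v_ip.
  rewrite -[mk y']/(gam xi q (mk y)).
  by rewrite (@gram_gamr _ _ _ HS _ _ _ _ _ (projT1 p)) // subrr.
exists [:: (1, inl (vxi, y')); (1, inr (exist _ _ gp))].
rewrite !comb_cons comb_nil /= vm_xi !scale1r addr0 (addrC (v (mk y'))) subrK.
by rewrite subrr hn0.
Qed.

Definition vth t : adjop H H -> adjop H H := amp (@vm_ip t) (@vm_dense t).

Lemma vth_vm t a z (y : E t) : vth t a (vm z y) = vm (a z) y.
Proof. exact: amp_m. Qed.

Lemma vth_zero a : vth 0 a = a.
Proof.
apply: (adjop_eq_dense v_dense) => p.
by rewrite -{1}(vm_one (v p)) vth_vm vm_one.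
Qed.

Lemma vm_pmul s t z (x : E t) (y : E s) : vm (vm z x) y = vm z (pmul x y).
Proof.
move: z; apply: (blin_eq_dense v_dense) => [||p].
- exact: (blin_comp (vm_blin y) (vm_blin x)).
- exact: vm_blin.
- by rewrite !vm_v -imulA.
Qed.

(** On tensors this is associativity. If g is orthogonal to H (.) E_(t+s), the composite kills it:
    moved to the other side, the adjoint of [vth t a] maps into the closed span of H (.) E_t. *)
Lemma vth_add s t a : vth (s + t) a = vth s (vth t a).
Proof.
rewrite addrC; symmetry; apply: amp_unique => [z|g gP].
  apply: (blin_eq_dense (@pmul_dense R B S E t s)) => [||[x y]] /=.
  - exact: (blin_comp (adjop_blin _) (blin_mr (@vm_ip _) (@vm_dense _) z)).
  - exact: (blin_mr (@vm_ip _) (@vm_dense _)).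
  - by rewrite -!vm_pmul !vth_vm.
apply: (dense_ip_eq (@vm_dense s)) => i; rewrite ip0r -op_adjP'.
case: i => [[z y]|[h hP]] /=; last by rewrite amp_adj_perp // ip0l.
rewrite amp_adj_m -ip_star [X in star X](_ : _ = 0) ?star0 //.
move: z; apply: (@blin_eq_dense _ _ _ _ (regular B) _
  (fun z => ip g (vm (op_adj (vth t a) z) y)) (fun=> 0) (@vm_dense t)).
- apply: (blin_comp (blin_ip g) (blin_comp (vm_blin y) _)).
  exact: (adjop_blin (adj_star (vth t a))).
- split => [*|*|]; rewrite ?addr0 ?scaler0 //.
  by exists 0; split => // z; rewrite hn0 mul0r.
case=> [[z x]|[h hP]] /=.
  by rewrite amp_adj_m vm_pmul perp_sym.
by rewrite amp_adj_perp // (bl0 (vm_blin y)) ip0r.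
Qed.

Lemma vth_Esemigroup : strict_Esemigroup vth.
Proof.
split.
- move=> t; rewrite /vth; split => [k a b|a b|a].
  + by have [-> _ _] := amp_star_endomorphism (@vm_ip t) (@vm_dense t) a b k.
  + by have [_ -> _] := amp_star_endomorphism (@vm_ip t) (@vm_dense t) a b 0.
  + by have [_ _ ->] := amp_star_endomorphism (@vm_ip t) (@vm_dense t) a a 0.
- exact: vth_zero.
- exact: vth_add.
- by move=> t; apply: (amp_strict _ _ vxi_unit).
Qed.

(** V embeds E_t; its adjoint sends z (.) y to <xi, z> y and kills the complement. Hence the image
    of xi xi^* under [vth t] is the projection onto the embedded E_t. *)
Lemma v_adj t : exists V : adjop (E t) H, (forall y, V y = v (mk y)) /\
  vth t (ketbra vxi vxi) = adj_comp V (adj_star V).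
Proof.
pose w' (i : H * E t + {g | m_perp (@vm t) g}) : E t :=
  match i with inl p => lact (ip vxi p.1) p.2 | inr _ => 0 end.
have [||L|x [[z y]|[g gP]]|V [V1 V2 _]] := @adjop_extend R B (E t) _ (E t) H id
  (fun y => v (mk y)) _ w' 1 _ (@vm_dense t) => /=.
- by move=> x e e0; exists [:: (1, x)]; rewrite comb1 subrr hn0.
- exact: ler01.
- by rewrite mul1r -[X in hn X](v_comb id) hn_v.
- by rewrite -vm_xi vm_ip.
- by rewrite -vm_xi gP ip0r.
exists V; split => //; symmetry; apply: amp_unique => [z y|g gP] /=.
  rewrite (V2 (inl (z, y))) V1 -vm_xi /=.
  by rewrite (m_ract (@vm_ip _) (@vm_dense _)).
by rewrite (V2 (inr (exist _ g gP))) op0.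
Qed.

Lemma ketbra_xi z : ketbra z vxi vxi = z.
Proof. by rewrite ketbraE vxi_unit ract1. Qed.

Lemma v_assoc_iso : assoc_iso vth vxi (fun t (x : E t) => v (mk x)).
Proof.
split.
- by move=> t x y; apply: v_isom.
- move=> t; have [V [V1 V2]] := v_adj t; apply/seteqP; split => [_ [x _ <-]|_ [g _ <-]].
    by exists (v (mk x)) => //; rewrite -vm_xi vth_vm ketbra_xi.
  by exists (op_adj V g) => //; rewrite V2 -V1.
- by move=> t x b; apply: (v_act (mk x) b).
- move=> t b x; rewrite /assoc_lact -!vm_xi vth_vm ketbra_xi.
  by rewrite (m_ract (@vm_ip _) (@vm_dense _)).
- by move=> s t x y; rewrite /assoc_mul -(vm_xi y) vth_vm ketbra_xi vm_v.
- by move=> b; rewrite pd_oneE; apply: (v_act vone b).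
Qed.

(** Projected to the embedded E_t, xi becomes the vector whose inner products with x are <x, xi_t>,
    as the kernel prescribes. *)
Lemma v_unit t : v (mk (xi t)) = vth t (ketbra vxi vxi) vxi.
Proof.
have [V [V1 V2]] := v_adj t; rewrite V2 -V1 /=; congr (V _).
apply: ip_inj => x; rewrite -op_adjP V1 v_ip (@gram_ge _ _ t) /= ?addr0 //.
by rewrite /gam imul1r ipI_same.
Qed.

Lemma v_dilation t b :
  unit_semigroup xi t b = ip vxi (vth t (ketbra (ract vxi b) vxi) vxi).
Proof.
(* Splitting off xi xi^* on the right turns xi into the embedded xi_t, on which the other factor is
   the left action of b. *)
have -> : ketbra (ract vxi b) vxi = adj_comp (ketbra (ract vxi b) vxi) (ketbra vxi vxi).
  apply/adjop_eq/funext => z.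
  by rewrite /= ip_ract vxi_unit mul1r.
rewrite (se_comp (es_endo vth_Esemigroup t)) /= -v_unit.
rewrite -[_ (v _)]/(assoc_lact vth vxi t b (v (mk (xi t)))).
rewrite -(ai_lact v_assoc_iso) v_ip (@gram_le _ _ t) /= ?addr0 //.
by rewrite /gam imul1r ipI_same.
Qed.

Definition v_dilate : weak_dilation (unit_semigroup xi) :=
  WeakDilation vth_Esemigroup vxi_unit v_dilation.

Lemma v_dilate_has_product_system : has_product_system xi v_dilate.
Proof.
exists (fun t (x : E t) => v (mk x)); split; first exact: v_assoc_iso.
exact: v_unit.
Qed.

Lemma v_dilate_generated : is_generated v_dilate.
Proof.
apply: (dense_total v_dense) => -[t x]; exists t => //.
by rewrite -(ai_onto v_assoc_iso t); exists x.
Qed.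

End Realization.

(** * Uniqueness of the dilation *)

Section CPSemigroup.
Variables (R : realType) (B : cstarAlg R) (S : nmodType).
Variables (E : product_system B S) (xi : psunit E).
Hypothesis xi_contr : contractive_unit xi.

Lemma unit_cp_semigroup : contractive_cp_semigroup (unit_semigroup xi).
Proof.
split.
- move=> b; rewrite /unit_semigroup pu_zero -bu_lact unitary_ip.
  exact: (etrans (congr1 (fun c => c * (b * 1)) (star1 B)) (etrans (mul1r _) (mulr1 b))).
(* The right factor of a tensor gives the outer map, so T_s after T_t belongs to xi_t (.) xi_s. *)
- move=> s t b; rewrite /unit_semigroup addrC -pu_mul -pmul_lactl pmul_ip //.
- move=> t; split => [k a b|n a b]; rewrite /unit_semigroup.
    by rewrite lactDE lactZE ipDr ipZr.
  have := ip_pos (\sum_(i < n) ract (lact (a i) (xi t)) (b i)); congr cpos.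
  rewrite ip_suml; apply: eq_bigr => i _; rewrite ip_sumr; apply: eq_bigr => j _.
  by rewrite ip_ract ip_ractl lact_ip lactME.
- move=> t b; rewrite !normE lecR; apply: le_trans (cauchy_schwarz _ _) _.
  have x1 : hn (xi t) <= 1.
    rewrite -(ler_pXn2r (ltn0Sn 1)) ?nnegrE ?hn_ge0 // hn_sqr expr1n.
    apply: le_trans (cle_nrm (ip_pos _) (xi_contr t)) (nrm1_le _).
  have := lact_bound b (xi t); have := hn_ge0 (lact b (xi t)).
  have := ler_piMr (nrm_ge0 b) x1; have := hn_ge0 (xi t).
  move=> h0 h1 h2 h3; apply: le_trans h1; apply: le_trans h3.
  by rewrite ler_piMl.
Qed.
End CPSemigroup.

Lemma cpos_sum (R : realType) (B : cstarAlg R) (I : Type) (s : seq I) (f : I -> B) :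
  (forall i, cpos (f i)) -> cpos (\sum_(i <- s) f i).
Proof.
move=> fp; elim: s => [|i s IH]; first by rewrite big_nil; apply: cpos0.
by rewrite big_cons; apply: cposD.
Qed.

(* u = 1 - (1 - T)^n, where T is a small multiple of the sum of the z z^* for   *)
(* the given vectors z: since T (1 - T)^(2k) decreases with k and sums up to    *)
(* at most 1, |(1 - T)^n z|^2 is of order 1/n.                                  *)
Section ApproximateUnit.
Variables (R : realType) (B : cstarAlg R) (H : hilbModType B).
Implicit Types (x y z : H) (Z : seq H).

Definition finite_rank (u : adjop H H) :=
  exists L : seq (H * H), u = \sum_(p <- L) ketbra p.1 p.2.

Section Iteration.
Variables (Z : seq H) (r : R).
Hypotheses (r0 : 0 < r) (Zr : forall z, z \in Z -> hn z ^+ 2 <= r)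
  (rZ : (size Z)%:R * r <= 1).

Let T x : H := \sum_(z <- Z) ract z (ip z x).
Let f x : H := x - T x.

Let T_sa x y : ip (T x) y = ip x (T y).
Proof.
rewrite /T ip_suml ip_sumr; apply: eq_bigr => z _.
by rewrite ip_ract ip_ractl ip_star.
Qed.

Let TB x y : T (x - y) = T x - T y.
Proof.
rewrite /T -sumrB; apply: eq_bigr => z _; rewrite ipBr.
by rewrite -[- ip z y]scaleN1r ractDr ractZr scaleN1r.
Qed.

Let T_pos x : cpos (ip x (T x)).
Proof.
rewrite /T ip_sumr; apply: cpos_sum => z; exists (ip z x).
by rewrite ip_ract ip_star.
Qed.

Let T_le1 x : cpos (ip x x - ip x (T x)).
Proof.
have h : cpos ((((size Z)%:R * r)%:C *: ip x x) - ip x (T x)).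
  rewrite /T ip_sumr; elim: Z Zr => [_|z L IH LP].
    rewrite big_nil subr0 /= mul0r scale0r; exact: cpos0.
  have LP' z' : z' \in L -> hn z' ^+ 2 <= r.
    by move=> zL; apply: LP; rewrite in_cons zL orbT.
  have := cposD (cauchy_schwarz_cle x r0 (LP z (mem_head _ _))) (IH LP').
  rewrite big_cons ip_ract; congr cpos.
  rewrite [size (z :: L)]/= -natr1 mulrDl mul1r rmorphD.
  by lmod R[i] B.
have s0 : 0 <= 1 - (size Z)%:R * r by rewrite subr_ge0.
have := cposD (cposZ s0 (ip_pos x)) h; congr cpos.
by rewrite rmorphB; lmod R[i] B.
Qed.

Let T_sq x : cpos (ip x (T x) - ip (T x) (T x)).
Proof.
have := cposD (T_le1 (T x)) (T_pos (x - T x)); congr cpos.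
rewrite TB ipBl !ipBr -(T_sa x) -(T_sa x (T x)).
by lmod R[i] B.
Qed.

Let f_step x : cpos (ip x x - ip (f x) (f x) - ip x (T x)).
Proof.
have := T_sq x; congr cpos; rewrite /f ipBl !ipBr -(T_sa x x).
by lmod R[i] B.
Qed.

Let f_decr x : cpos (ip x (T x) - ip (f x) (T (f x))).
Proof.
have := cposD (T_le1 (T x)) (ip_pos (T x)); congr cpos.
rewrite /f TB ipBl !ipBr -(T_sa x) -(T_sa x (T x)).
by lmod R[i] B.
Qed.

Let it n x := iter n f x.

Let it_sa n x y : ip (it n x) y = ip x (it n y).
Proof.
rewrite /it; elim: n x y => // n IH x y; rewrite iterS iterSr -IH.
by rewrite /f ipBl ipBr T_sa.
Qed.

(** Each step loses at least <y, T y>, and these losses decrease, so n steps lose at least n times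
    the last one. *)
Let it_bound n x :
  cpos (ip x x - ip (it n x) (it n x) - n%:R%:C *: ip (it n x) (T (it n x))).
Proof.
elim: n => [|n IH]; first by rewrite /= subrr scale0r subrr; apply: cpos0.
have n0 : 0 <= n.+1%:R :> R by [].
have := cposD (cposD IH (f_step (it n x))) (cposZ n0 (f_decr (it n x))).
rewrite /it iterS -/(it n x); congr cpos.
by rewrite -natr1 rmorphD; lmod R[i] B.
Qed.

Let it_contr n x : hn (it n x) <= hn x.
Proof.
rewrite -(ler_pXn2r (ltn0Sn 1)) ?nnegrE ?hn_ge0 // !hn_sqr.
apply: cle_nrm; first exact: ip_pos.
have n0 : 0 <= n%:R :> R by [].
have := cposD (it_bound n x) (cposZ n0 (T_pos (it n x))).
by rewrite subrK.
Qed.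

(** With y = f^n z one has <z, f^n y> = <y, y>. As z z^* is at most T, [it_bound] for y gives n |<y,
    y>|^2 <= |<y, y>|. *)
Let it_small n z : z \in Z -> n%:R * hn (it n z) ^+ 2 <= 1.
Proof.
move=> zZ; set y := it n z.
have h1 : cpos (ip y y - n%:R%:C *: (ip (it n y) z * ip z (it n y))).
  have n0 : 0 <= n%:R :> R by [].
  have h2 : cpos (ip (it n y) (T (it n y)) - ip (it n y) z * ip z (it n y)).
    rewrite /T ip_sumr (big_rem z zZ) ip_ract addrAC subrr add0r.
    by apply: cpos_sum => w; exists (ip w (it n y)); rewrite ip_ract ip_star.
  have := cposD (cposD (it_bound n y) (ip_pos (it n y))) (cposZ n0 h2).
  by congr cpos; lmod R[i] B.
have zy : ip z (it n y) = ip y y by rewrite -it_sa.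
have h3 : n%:R * nrm (ip y y) ^+ 2 <= nrm (ip y y).
  have n0 : 0 <= n%:R :> R by [].
  rewrite -nrm_starM -{1}(ger0_norm n0) -nrmZr; apply: cle_nrm.
    by apply: cposZ => //; exists (ip y y).
  by move: h1; rewrite -(ip_star z) zy.
rewrite hn_sqr; have [->|ny] := eqVneq (nrm (ip y y)) 0; first by rewrite mulr0.
have y0 : 0 < nrm (ip y y) by rewrite lt_neqAle eq_sym ny nrm_ge0.
by rewrite -(ler_pM2r y0) mul1r -mulrA -expr2.
Qed.

Lemma approx_unit_small n : exists u : adjop H H,
  [/\ finite_rank u, forall x, op_adj u x = u x, forall x, hn (u x) <= 2 * hn x &
      forall z, z \in Z -> n%:R * hn (u z - z) ^+ 2 <= 1].
Proof.
pose u : adjop H H := adj_one H - AdjOp (it_sa n).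
have uE x : u x = x - it n x by rewrite /u opBE.
exists u; split.
- rewrite /u; elim: n {u uE} => [|k [L LE]].
    exists [::]; rewrite big_nil; apply/adjop_eq/funext => x; rewrite opBE.
    by rewrite /= subrr.
  (* f^k - f^(k+1) = T f^k is the sum of the rank one operators of z and f^k z. *)
  exists ([seq (z, it k z) | z <- Z] ++ L); rewrite big_cat /= -LE big_map.
  apply/adjop_eq/funext => x; rewrite opBE.
  have -> (a b : adjop H H) : (a + b) x = a x + b x by [].
  rewrite (big_morph (fun a : adjop H H => a x) (op1 := +%R) (id1 := 0)) // opBE /=.
  rewrite -/(it k x) /f /T opprB addrCA; congr (_ + _).
  by apply: eq_bigr => z _; rewrite -it_sa.
- by move=> x; rewrite /u adjB opBE.
- by move=> x; rewrite uE; apply: le_trans (hnB _ _) _; have := it_contr n x; lra.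
- by move=> z zZ; rewrite uE hnBC opprB addrC subrK; apply: it_small.
Qed.
End Iteration.

Lemma approx_unit Z (e : R) : 0 < e -> exists u : adjop H H,
  [/\ finite_rank u, forall x, op_adj u x = u x, forall x, hn (u x) <= 2 * hn x &
      forall z, z \in Z -> hn (u z - z) <= e].
Proof.
move=> e0.
have [M [M0 MP]] : exists M : R, 0 < M /\ forall z, z \in Z -> hn z <= M.
  elim: Z => [|z L [M [M0 MP]]]; first by exists 1.
  exists (M + hn z); split; first by rewrite ltr_wpDr ?hn_ge0.
  move=> w; rewrite in_cons => /orP [/eqP ->|wL]; first by rewrite lerDr ltW.
  by apply: le_trans (MP w wL) _; rewrite lerDl hn_ge0.
pose N : R := (size Z)%:R + 1; have N1 : 1 <= N by rewrite lerDr.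
have N0 : 0 < N by apply: lt_le_trans N1.
(* Scaling by s makes |s z|^2 <= 1 / N, and N exceeds the number of vectors, so T <= 1. *)
pose s : R := (M * N)^-1; have s0 : 0 < s by rewrite invr_gt0 mulr_gt0.
pose Z' := [seq s%:C *: z | z <- Z].
have NV0 : 0 < N^-1 by rewrite invr_gt0.
have Zr z : z \in Z' -> hn z ^+ 2 <= N^-1.
  case/mapP => w wZ ->; rewrite hnZr gtr0_norm //.
  have h : s * hn w <= N^-1.
    by rewrite /s ler_pdivrMl ?mulr_gt0 // mulfK ?gt_eqF // MP.
  have h0 : 0 <= s * hn w by rewrite mulr_ge0 ?hn_ge0 // ltW.
  rewrite expr2; apply: le_trans (ler_pM h0 h0 h h) _.
  by rewrite ler_piMr ?invf_le1 // ltW.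
have rZ : (size Z')%:R * N^-1 <= 1.
  by rewrite size_map ler_pdivrMr // mul1r lerDl.
have se0 : 0 < (s * e) ^- 2 by rewrite invr_gt0 exprn_gt0 // mulr_gt0.
pose n := Num.bound ((s * e) ^- 2).
have [u [u1 u2 u3 u4]] := approx_unit_small NV0 Zr rZ n.
exists u; split => // z zZ.
have := u4 (s%:C *: z) (map_f _ zZ).
rewrite opZ -scalerBr hnZr gtr0_norm // exprMn.
have := archi_boundP (ltW se0); rewrite -/n exprMn invfM => hn1.
move=> h; rewrite leNgt; apply/negP => lt.
have h2 : e ^+ 2 < hn (u z - z) ^+ 2 by rewrite ltr_pXn2r ?nnegrE ?hn_ge0 // ltW.
have s2 : 0 < s ^+ 2 by rewrite exprn_gt0.
have e2 : 0 < e ^+ 2 by rewrite exprn_gt0.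
have n0 : 0 < n%:R :> R by apply: lt_trans hn1; rewrite mulr_gt0 // invr_gt0.
have : 1 < n%:R * (s ^+ 2 * e ^+ 2).
  by move: hn1; rewrite -invfM -[ltLHS]mul1r ltr_pdivrMr ?mulr_gt0.
have : n%:R * (s ^+ 2 * e ^+ 2) < n%:R * (s ^+ 2 * hn (u z - z) ^+ 2).
  by rewrite !ltr_pM2l.
lra.
Qed.

End ApproximateUnit.

Section StrictUnit.
Variables (R : realType) (B : cstarAlg R) (H : hilbModType B).
Variable th : adjop H H -> adjop H H.
Hypotheses (th_endo : star_endomorphism th) (th_strict : strict_on_bounded th).
Variable xi : H.
Hypothesis xi1 : ip xi xi = 1.

Lemma thD a b : th (a + b) = th a + th b.
Proof. by have := se_linear th_endo 1 a b; rewrite !scale1r. Qed.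
Lemma th0 : th 0 = 0.
Proof. by apply: (@addrI _ (th 0)); rewrite -thD !addr0. Qed.
Lemma thZ (k : R[i]) a : th (k *: a) = k *: th a.
Proof. by have := se_linear th_endo k a 0; rewrite th0 !addr0. Qed.

Let apx (Z : seq H) (e : R) : set (adjop H H) :=
  [set u | [/\ finite_rank u, forall x, op_adj u x = u x,
      forall x, hn (u x) <= 2 * hn x & forall z, z \in Z -> hn (u z - z) <= e]].

(** The section filter of the net of approximate units, indexed by a finite list of vectors and a
    tolerance. *)
Let X : set_system (adjop H H) :=
  [set U | exists Z, exists2 e : R, 0 < e & apx Z e `<=` U].

Let X_filter : Filter X.
Proof.
split.
- by exists [::], 1.
- move=> U V [Z [e e0 ZU]] [W [d d0 WV]].
  exists (Z ++ W), (Num.min e d); first by rewrite lt_min e0.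
  move=> u [u1 u2 u3 u4]; split.
    apply: ZU; split => // z zZ.
    have := u4 z; rewrite mem_cat zZ => /(_ isT); rewrite le_min => /andP [] //.
  apply: WV; split => // z zW.
  have := u4 z; rewrite mem_cat zW orbT => /(_ isT); rewrite le_min => /andP [] //.
- by move=> U V UV [Z [e e0 ZU]]; exists Z, e => // u /ZU /UV.
Qed.

(* Strictness brings th 1 into the closure of the image of the finite rank    *)
(* operators.                                                                 *)
Lemma strict_one_perp x :
  (forall z w g, ip x (th (ketbra z w) g) = 0) -> forall g, ip x (th (adj_one H) g) = 0.
Proof.
move=> hx g.
pose A : set (adjop H H) := [set a | forall x, hn (a x) <= 2 * hn x].
have A1 : A (adj_one H) by move=> y /=; have := hn_ge0 y; lra.
have bA : op_bounded A.
  by exists 2%:C => a aA; apply/opnorm_leP; split.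
have XA : X A by exists [::], 1 => // u [].
have X1 : strict_cvg X (adj_one H).
  apply: (@strong_strict_cvg _ _ _ _ _ 2) => // z e e0.
  exists [:: z], e => // u [_ u2 _ u4] /=.
  by rewrite u2; split; apply: u4; rewrite mem_head.
have := strict_strong_cvg (fmap_filter th X_filter) xi1 (th_strict bA A1 X_filter XA X1).
move=> sX; apply: nrm_eq0; apply/eqP; rewrite eq_le nrm_ge0 andbT.
apply/ler_addgt0Pr => e e0; rewrite add0r.
have x0 : 0 < hn x + 1 by rewrite ltr_wpDl ?hn_ge0.
have [Z [d d0 Zd]] := sX g _ (divr_gt0 e0 x0).
have [u uP] := approx_unit Z d0; have [/= h _] := Zd u uP.
case: uP => -[L LE] _ _ _.
have u0 : ip x (th u g) = 0.
  rewrite LE (big_morph th thD th0).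
  rewrite (big_morph (fun a : adjop H H => a g) (op1 := +%R) (id1 := 0)) //.
  by rewrite ip_sumr big1.
have -> : ip x (th (adj_one H) g) = - ip x (th u g - th (adj_one H) g).
  by rewrite ipBr u0 sub0r opprK.
rewrite nrmN; apply: le_trans (cauchy_schwarz _ _) _.
move: h; rewrite ler_pdivlMr // mulrC => h.
apply: le_trans h; rewrite ler_wpM2r ?hn_ge0 //; lra.
Qed.

End StrictUnit.

(** * Every such dilation realizes the kernel *)

Section DilationRealization.
Variables (R : realType) (B : cstarAlg R) (S : nmodType).
Hypothesis HS : linear_time S.
Variables (E : product_system B S) (u : psunit E) (H : hilbModType B).
Variables (th : S -> adjop H H -> adjop H H) (xi : H) (w : forall t, E t -> H).
Hypotheses (th_sg : strict_Esemigroup th) (xi1 : ip xi xi = 1)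
  (iso : assoc_iso th xi w)
  (wu : forall t, w (u t) = th t (ketbra xi xi) xi)
  (gen : total (\bigcup_t assoc_member th xi t)).

Definition emb (p : idx E) : H := w (projT2 p).

Let k := ketbra xi xi.

Let kk : adj_comp k k = k.
Proof. by apply/adjop_eq/funext => z; rewrite /= ip_ract xi1 mul1r. Qed.

Let k_sa : adj_star k = k.
Proof. exact: adjop_eq. Qed.

Let thk_w t (y : E t) : th t k (w y) = w y.
Proof.
have [g _ <-] : assoc_member th xi t (w y) by rewrite -(ai_onto iso); exists y.
rewrite -/k -[LHS]/(adj_comp (th t k) (th t k) g) -(se_comp (es_endo th_sg t)).
by rewrite kk.
Qed.

(** As th_r(k) xi xi^* = th_r(k) k, applying th_s turns the product with the unit vector into
    th_(r+s)(k), so the embedded xi_r (.) y is a projection of the embedded y. *)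
Let emb_gam r p : emb (gam u r p) = th (r + projT1 p) k (emb p).
Proof.
case: p => s y; rewrite /emb /= (ai_mul iso) /assoc_mul wu.
have -> : ketbra (th r k xi) xi = adj_comp (th r k) k.
  by apply/adjop_eq/funext => z; rewrite /= op_ract.
by rewrite (se_comp (es_endo th_sg s)) /= thk_w addrC (es_add th_sg).
Qed.

Let emb_ipI p q : projT1 p = projT1 q -> ipI p q = ip (emb p) (emb q).
Proof.
case: p q => s x [t y] /= st; case: t / st y => y.
by rewrite (ipI_same x y) (ai_ip iso).
Qed.

(** The later vector is fixed by its projection th(k); moved to the earlier vector, that projection
    inserts the unit by [emb_gam]. *)
Lemma emb_ip p q : ip (emb p) (emb q) = gram u p q.
Proof.
have key p' q' r : projT1 p' = r + projT1 q' -> ip (emb p') (emb q') = gram u p' q'.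
  move=> e; rewrite (gram_ge HS u e) (@emb_ipI p' (gam u r q')) // emb_gam -e.
  have -> : th (projT1 p') k = adj_star (th (projT1 p') k).
    by rewrite -(se_star (es_endo th_sg _)) k_sa.
  by rewrite /= -op_adjP /emb thk_w.
have [r [e|e]] := lt_tot HS (projT1 p) (projT1 q); last exact: key e.
by rewrite -ip_star (key _ _ _ e) (gram_star HS).
Qed.

Lemma emb_dense : dense emb.
Proof.
apply: (total_dense gen) => x [t _]; rewrite -(ai_onto iso) => -[y _ <-].
by exists (mk y).
Qed.

Let thD' t a b : th t (a + b) = th t a + th t b.
Proof. exact: (thD (es_endo th_sg t)). Qed.
Let thZ' t (c : R[i]) a : th t (c *: a) = c *: th t a.
Proof. exact: (thZ (es_endo th_sg t)). Qed.

Let ketbra_blin t (y : E t) : blin (fun z => th t (ketbra z xi) (w y)).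
Proof.
split.
- move=> z z'; have -> : ketbra (z + z') xi = ketbra z xi + ketbra z' xi.
    by apply/adjop_eq/funext => x /=; rewrite ractDl.
  by rewrite thD'.
- move=> c z; have -> : ketbra (c *: z) xi = c *: ketbra z xi.
    by apply/adjop_eq/funext => x /=; rewrite ractZl.
  by rewrite thZ'.
exists (hn y); split; first exact: hn_ge0.
move=> z; rewrite -(ler_pXn2r (ltn0Sn 1)) ?nnegrE ?mulr_ge0 ?hn_ge0 // hn_sqr op_adjP.
have -> : op_adj (th t (ketbra z xi)) (th t (ketbra z xi) (w y)) =
    w (lact (ip z z) y).
  rewrite (ai_lact iso) /assoc_lact.
  rewrite -[LHS]/(adj_comp (adj_star (th t (ketbra z xi))) (th t (ketbra z xi)) (w y)).
  rewrite -(se_star (es_endo th_sg t)) -(se_comp (es_endo th_sg t)).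
  congr (th t _ _); apply/adjop_eq/funext => x /=.
  by rewrite ip_ract ractM.
rewrite (ai_ip iso); apply: le_trans (cauchy_schwarz _ _) _.
apply: le_trans (ler_wpM2l (hn_ge0 _) (lact_bound _ _)) _.
by rewrite -hn_sqr exprMn mulrCA mulrC -expr2.
Qed.

Lemma vm_ketbra t z (y : E t) : vm HS emb_ip emb_dense z y = th t (ketbra z xi) (w y).
Proof.
move: z; apply: (blin_eq_dense emb_dense) => [||[s x]].
- exact: vm_blin.
- exact: ketbra_blin.
- by rewrite vm_v /emb /= (ai_mul iso).
Qed.

(** On tensors, a composed with z xi^* is (a z) xi^*, so multiplicativity decides. On the complement
    th_t(a) = th_t(1) th_t(a), and [strict_one_perp] reduces vanishing to rank one operators. *)
Lemma th_vth t : th t = vth HS emb_ip emb_dense t.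
Proof.
apply/funext => a; apply: amp_unique => [z y|g gP].
  rewrite !vm_ketbra -[LHS]/(adj_comp (th t a) (th t (ketbra z xi)) (w y)).
  rewrite -(se_comp (es_endo th_sg t)); congr (th t _ _).
  by apply/adjop_eq/funext => x /=; rewrite op_ract.
apply: ip_inj => h; rewrite ip0r.
have -> : ip h (th t a g) = star (ip g (th t (adj_one H) (th t (adj_star a) h))).
  rewrite -[th t (adj_one H) _]/(adj_comp (th t (adj_one H)) (th t (adj_star a)) h).
  rewrite -(se_comp (es_endo th_sg t)).
  have -> : adj_comp (adj_one H) (adj_star a) = adj_star a by apply: adjop_eq.
  by rewrite (se_star (es_endo th_sg t)) ip_star /= op_adjP'.
rewrite (strict_one_perp (es_endo th_sg t) (@es_strict _ _ _ _ _ th_sg t) xi1) ?star0 //.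
move=> z z' f.
(* Factoring through xi xi^* puts the values of th_t at rank one operators into the span of the
   tensors, to which g is orthogonal. *)
have -> : ketbra z z' = adj_comp (ketbra z xi) (adj_comp k (ketbra xi z')).
  apply/adjop_eq/funext => x; rewrite /= !ip_ract xi1 !mul1r.
  by [].
rewrite !(se_comp (es_endo th_sg t)) /=.
have : assoc_member th xi t (th t k (th t (ketbra xi z') f)) by exists (th t (ketbra xi z') f).
by rewrite -(ai_onto iso) => -[y _ <-]; rewrite -vm_ketbra perp_sym.
Qed.

End DilationRealization.

(** * Unitary equivalence of two realizations of one kernel *)

Section Uniqueness.
Variables (R : realType) (B : cstarAlg R) (S : nmodType).
Hypothesis HS : linear_time S.
Variables (E : product_system B S) (xi : psunit E) (H H' : hilbModType B).
Variables (v : idx E -> H) (v' : idx E -> H').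
Hypotheses (v_ip : forall p q, ip (v p) (v q) = gram xi p q) (v_dense : dense v).
Hypotheses (v_ip' : forall p q, ip (v' p) (v' q) = gram xi p q) (v_dense' : dense v').

Lemma realization_unitary : exists U : unitary H H',
  (forall p, U (v p) = v' p) /\ forall p, op_adj U (v' p) = v p.
Proof.
have [|L|p q|a [a1 a2 _]] := @adjop_extend R B _ _ H H' v v' v' v 1 v_dense v_dense' => //.
- by rewrite mul1r /hn (ip_comb_eq (v := v) (w' := v) L L) // => i j; rewrite v_ip v_ip'.
- by rewrite v_ip v_ip'.
have h1 : adj_comp (adj_star a) a = adj_one H.
  by apply: (adjop_eq_dense v_dense) => p /=; rewrite a1 a2.
have h2 : adj_comp a (adj_star a) = adj_one H'.
  by apply: (adjop_eq_dense v_dense') => p /=; rewrite a2 a1.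
by exists (Unitary h1 h2).
Qed.

Lemma vm_intertwine (U : unitary H H') t z (y : E t) : (forall p, U (v p) = v' p) ->
  U (vm HS v_ip v_dense z y) = vm HS v_ip' v_dense' (U z) y.
Proof.
move=> Uv; move: z; apply: (blin_eq_dense v_dense) => [||p].
- exact: (blin_comp (adjop_blin U) (vm_blin _ _ _ y)).
- exact: (blin_comp (vm_blin _ _ _ y) (adjop_blin U)).
- by rewrite Uv !vm_v Uv.
Qed.

Lemma vth_conj (U : unitary H H') t a : (forall p, U (v p) = v' p) ->
  conj_op U (vth HS v_ip v_dense t a) = vth HS v_ip' v_dense' t (conj_op U a).
Proof.
move=> Uv; apply: amp_unique => [z y|g gP] /=.
  rewrite -[z](unitary_adjK U) -vm_intertwine //.
  have UK x : op_adj U (U x) = x.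
    exact: (congr1 (fun a : adjop H H => a x) (un_starL U)).
  by rewrite !UK vth_vm vm_intertwine.
rewrite amp_perp ?op0 // => z y.
by rewrite -op_adjP vm_intertwine // gP.
Qed.
End Uniqueness.

Theorem theorem1p2 (R : realType) (k : time_kind) (B : cstarAlg R)
    (E : product_system B (time R k)) (xi : psunit E) :
  contractive_unit xi ->
  contractive_cp_semigroup (unit_semigroup xi) /\
  exists D : weak_dilation (unit_semigroup xi),
    has_product_system xi D /\ is_generated D /\
    forall D' : weak_dilation (unit_semigroup xi),
      has_product_system xi D' -> is_generated D' -> unitarily_equivalent D D'.
Proof.
move=> xi_contr; split; first exact: unit_cp_semigroup.
have HS := time_linear R k.
have [H [v [v_ip v_dense0]]] := kolmogorov (gram_kernel HS xi_contr).
(* Right multiples stay in the family: v (p b) and (v p) b differ by a vector of length 0, by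
   [gram_act]. *)
have v_dense : dense v.
  apply: (dense_trans v_dense0) => -[p b] e e0; exists [:: (1, iact p b)].
  rewrite comb1 /= (_ : ract _ _ = v (iact p b)) ?subrr ?hn0 //.
  apply/eqP; rewrite -subr_eq0; apply/eqP; apply: (@ip_eq0 _ B).
  have p1 : iact p 1 = p by case: p => t x; rewrite /iact ract1.
  have gr : gram xi p (iact p b) = gram xi p p * b.
    by rewrite -{1}p1 (gram_act HS) star1 mul1r.
  have gl : gram xi (iact p b) p = star b * gram xi p p.
    by rewrite -[X in gram xi _ X]p1 (gram_act HS) mulr1.
  rewrite ipBl !ipBr !ip_ract !ip_ractl !v_ip /= gr gl (gram_act HS).
  by rewrite !mulrA !subrr.
exists (v_dilate HS v_ip v_dense); split; first exact: v_dilate_has_product_system.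
split; first exact: v_dilate_generated.
move=> D' [w [iso wu]] gen.
have sg := wd_Esemigroup D'; have xi1 := wd_unit D'.
(* The embedded vectors of D' form a second total family with the same kernel. *)
pose ve := emb_ip HS sg xi1 iso wu; pose de := emb_dense iso gen.
have [U [Uv _]] := realization_unitary v_ip v_dense ve de.
exists U; split.
  by rewrite /= /vxi Uv /emb /= (ai_one iso) ract1.
move=> t a; rewrite (th_vth HS sg xi1 iso wu gen) -[wd_th t a]/(vth HS v_ip v_dense t a).
exact: vth_conj.
Qed.
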